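(* Consider the shape invariant model $Y_{i,j}=a_jf(X_i-\theta_j)+v_j+\varepsilon_{i,j}$, $1\le j\le p$, $i\ge 1$, under the assumptions listed in the context, and let $(\widehat\theta_n)_{n\ge0}$ be the projected Robbins-Monro sequence in $[-1/4,1/4]^p$ given by an arbitrary initial value $\widehat\theta_0\in[-1/4,1/4]^p$ and, for $n\ge0$ and $1\le j\le p$, $$\widehat\theta_{n+1,j}=\pi_K\Bigl(\widehat\theta_{n,j}+\gamma_{n+1}\,\mathrm{sign}(a_jf_1)\,T_{n+1,j}\Bigr),\qquad T_{n+1,j}=\frac{\sin\bigl(2\pi(X_{n+1}-\widehat\theta_{n,j})\bigr)}{g(X_{n+1})}\,Y_{n+1,j},$$ with $\gamma_n=1/n$. Suppose in addition that $(\varepsilon_{i,j})$ has a finite moment of order $>2$ and that $$4\pi|f_1|\min_{1\le j\le p}|a_j|>1.$$ Then $\sqrt n\,(\widehat\theta_n-\theta)$ converges in distribution to $\mathcal N_p(0,\Sigma(\theta))$ as $n\to+\infty$, where for all $1\le k,l\le p$ $$\Sigma(\theta)_{k,l}=\frac{\varphi(\theta)_{k,l}}{2\pi(|a_k|+|a_l|)|f_1|-1}.$$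
   Context: Setting. Let $p\ge2$ be an integer. - $(X_i)_{i\ge1}$ are independent identically distributed real random variables with probability density $g$; $g$ is zero outside $[-1/2,1/2]$, strictly positive on $[-1/2,1/2]$, and on $[-1/2,1/2]$ it is continuous and twice differentiable with bounded derivatives. - $f:\mathbb R\to\mathbb R$ is (measurable,) symmetric ($f(-x)=f(x)$), bounded, periodic with period $1$, and $\int_{-1/2}^{1/2}f(x)\,dx=0$. Its first Fourier coefficient is $f_1=\int_{-1/2}^{1/2}\cos(2\pi x)f(x)\,dx\ne0$. - $a=(a_1,\dots,a_p)^T$, $\theta=(\theta_1,\dots,\theta_p)^T$, $v=(v_1,\dots,v_p)^T$ are vectors of $\mathbb R^p$ with $a_j\ne0$ for all $j$, $a_1=1$, $\theta_1=0$ and $\max_{1\le j\le p}|\theta_j|<1/4$. - The noise variables $(\varepsilon_{i,j})_{i\ge1,1\le j\le p}$ are mutually independent, independent of $(X_i)_{i\ge 1}$, with mean zero and variance $\mathbb E[\varepsilon_{i,j}^2]=\sigma_j^2$; for each $j$ the variables $(\varepsilon_{i,j})_{i\ge1}$ are identically distributed. ''Finite moment of order $>2$'' means that there is $q>2$ with $\mathbb E|\varepsilon_{1,j}|^q<\infty$ for all $j$. - $K=[-1/4,1/4]$ and $\pi_K:\mathbb R\to K$ is the projection: $\pi_K(x)=x$ if $|x|\le1/4$, $\pi_K(x)=1/4$ if $x\ge1/4$, $\pi_K(x)=-1/4$ if $x\le-1/4$. - $Y=(Y_1,\dots,Y_p)^T$ with $Y_j=a_jf(X-\theta_j)+v_j+\varepsilon_j$,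 where $(X,\varepsilon_1,\dots,\varepsilon_p)$ has the same distribution as $(X_i,\varepsilon_{i,1},\dots,\varepsilon_{i,p})$. - For $t\in\mathbb R^p$, $D(X,t)=\frac1{g(X)}\mathrm{diag}\bigl(\sin(2\pi(X-t_1)),\dots,\sin(2\pi(X-t_p))\bigr)$, $V(t)=\mathrm{diag}\bigl(\mathrm{sign}(a_1f_1),\dots,\mathrm{sign}(a_pf_1)\bigr)D(X,t)Y$, and $\varphi(t)=\mathbb E[V(t)V(t)^T]$, a $p\times p$ matrix. *)

(* Defs.v *)
From HB Require Import structures.
From mathcomp Require Import all_boot all_order all_algebra.
From mathcomp Require Import all_classical all_reals all_analysis.

Set Implicit Arguments.
Unset Strict Implicit.
Unset Printing Implicit Defensive.

Import Order.TTheory GRing.Theory Num.Theory.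
Import numFieldNormedType.Exports.

Local Open Scope classical_set_scope.
Local Open Scope ring_scope.

Section Independence.
Context {R : realType} {d : measure_display} {Omega : measurableType d}.
Context (P : probability Omega R).

Definition mutually_independent (I : eqType) (Z : I -> {RV P >-> R}) : Prop :=
  forall (s : seq I) (B : I -> set R),
    uniq s -> (forall i, measurable (B i)) ->
    P (\bigcap_(i in [set` s]) (Z i @^-1` B i)) =
    (\prod_(i <- s) P (Z i @^-1` B i))%E.

Definition sigma_generated (I : Type) (Z : I -> {RV P >-> R}) :
    set (set Omega) :=
  <<s \bigcup_(i in [set: I]) preimage_set_system setT (Z i) measurable >>.

Definition independent_families (I J : Type)
    (Z : I -> {RV P >-> R}) (W : J -> {RV P >-> R}) : Prop :=
  forall A B : set Omega, sigma_generated Z A -> sigma_generated W B ->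
    P (A `&` B) = (P A * P B)%E.

Definition same_law (Z W : {RV P >-> R}) : Prop :=
  forall B : set R, measurable B -> P (Z @^-1` B) = P (W @^-1` B).

Definition has_density (Z : {RV P >-> R}) (g : R -> R) : Prop :=
  forall B : set R, measurable B ->
    P (Z @^-1` B) = (\int[lebesgue_measure]_(x in B) (g x)%:E)%E.

End Independence.

Section Gaussian.
Context {R : realType}.

(* The law N(m, s2), the point mass at m when the variance s2 is 0
   ([normal_prob m 0] is not that point mass). *)
Definition normal_law (m s2 : R) (B : set R) : \bar R :=
  if 0 < s2 then normal_prob m (Num.sqrt s2) B else dirac m B.

Definition borelVec (p : nat) := g_sigma_algebraType (@open 'cV[R]_p).

(* mu = N_p(m, S), possibly degenerate: every linear form has the expected
   one-dimensional normal law under mu. *)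
Definition is_normal_vector_law (p : nat) (mu : probability (borelVec p) R)
    (m : 'cV[R]_p) (S : 'M[R]_p) : Prop :=
  S^T = S /\
  forall u : 'cV[R]_p,
    0 <= (u^T *m S *m u) 0 0 /\
    forall B : set R, measurable B ->
      mu [set x : 'cV[R]_p | B ((u^T *m x) 0 0)] =
      normal_law ((u^T *m m) 0 0) ((u^T *m S *m u) 0 0) B.

Definition cvg_in_law (d : measure_display) (Omega : measurableType d)
    (P : probability Omega R) (p : nat)
    (Z : nat -> Omega -> 'cV[R]_p) (mu : probability (borelVec p) R) : Prop :=
  forall h : 'cV[R]_p -> R,
    continuous h -> (exists M : R, forall x, `|h x| <= M) ->
    (\int[P]_w (h (Z n w))%:E)%E @[n --> \oo] -->
    (\int[mu]_x (h x)%:E)%E.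

(* N_p(m, S) exists exactly when S is symmetric positive semidefinite, and is
   then unique; its existence is part of the assertion. *)
Definition cvg_in_law_to_normal (d : measure_display)
    (Omega : measurableType d) (P : probability Omega R) (p : nat)
    (Z : nat -> Omega -> 'cV[R]_p) (m : 'cV[R]_p) (S : 'M[R]_p) : Prop :=
  exists mu : probability (borelVec p) R,
    is_normal_vector_law mu m S /\ cvg_in_law P Z mu.

End Gaussian.

Section Model.
Context {R : realType}.

Definition half_itv : set R := `[- 2^-1, 2^-1].

(* One-sided at an end point of the interval A. *)
Definition derivative_on (A : set R) (h h' : R -> R) : Prop :=
  forall x, A x -> (h y - h x) / (y - x) @[y --> within A x^'] --> h' x.

Definition bounded_on (A : set R) (h : R -> R) : Prop :=
  exists M : R, forall x, A x -> `|h x| <= M.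

Definition regular_density (g : R -> R) : Prop :=
  [/\ forall x, ~ half_itv x -> g x = 0,
      forall x, half_itv x -> 0 < g x,
      {within half_itv, continuous g} &
      exists g' g'' : R -> R,
        [/\ derivative_on half_itv g g', derivative_on half_itv g' g'',
            bounded_on half_itv g' & bounded_on half_itv g''] ].

Definition admissible_shape (f : R -> R) : Prop :=
  [/\ measurable_fun setT f,
      forall x, f (- x) = f x,
      bounded_on setT f,
      forall x, f (x + 1) = f x &
      (\int[lebesgue_measure]_(x in half_itv) f x) = 0 ].

Definition fourier1 (f : R -> R) : R :=
  \int[lebesgue_measure]_(x in half_itv) (cos (2 * pi * x) * f x).

Definition piK (x : R) : R :=
  if `|x| <= 4^-1 then x else if 4^-1 <= x then 4^-1 else - 4^-1.

Context (p : nat).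
Implicit Types (a theta v t : 'cV[R]_p) (x : R) (e : 'I_p -> R).

Definition response (f : R -> R) a theta v x e : 'cV[R]_p :=
  \col_j (a j 0 * f (x - theta j 0) + v j 0 + e j).

Definition Dmat (g : R -> R) x t : 'M[R]_p :=
  (g x)^-1 *: diag_mx (\row_j sin (2 * pi * (x - t j 0))).

Definition Vvec (g f : R -> R) a theta v t x e : 'cV[R]_p :=
  diag_mx (\row_j Num.sg (a j 0 * fourier1 f)) *m Dmat g x t
    *m response f a theta v x e.

Context {d : measure_display} {Omega : measurableType d}.
Context (P : probability Omega R).

Definition phi (g f : R -> R) a theta v
    (X : Omega -> R) (eps : 'I_p -> Omega -> R) t : 'M[R]_p :=
  \matrix_(k, l) fine (expectation P (fun w =>
    let V := Vvec g f a theta v t (X w) (fun j => eps j w) in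
    (V *m V^T) k l)).

Definition Sigma (f : R -> R) a (Phi : 'M[R]_p) : 'M[R]_p :=
  \matrix_(k, l) (Phi k l /
    (2 * pi * (`|a k 0| + `|a l 0|) * `|fourier1 f| - 1)).

(* Observations are numbered from 0: [X n] and [eps n] stand for X_{n+1} and
   eps_{n+1}, the data used to pass from iterate n to iterate n+1. *)
Fixpoint robbins_monro (g f : R -> R) a theta v (gamma : nat -> R)
    (X : nat -> Omega -> R) (eps : nat -> 'I_p -> Omega -> R)
    (theta0 : 'cV[R]_p) (n : nat) (w : Omega) : 'cV[R]_p :=
  if n is m.+1 then
    let th := robbins_monro g f a theta v gamma X eps theta0 m w in
    let Y := response f a theta v (X m w) (fun j => eps m j w) in
    \col_j piK (th j 0 + gamma m.+1 * Num.sg (a j 0 * fourier1 f) *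
      (sin (2 * pi * (X m w - th j 0)) / g (X m w) * Y j 0))
  else theta0.

End Model.

(* Main.v *)
(* Write D for the error of the n-th iterate. In the variable t = tan (pi D) the
   drift of the recursion, which is periodic in D, becomes the exact polynomial
   (1 - t^2) A - 2 t B, where A and B are the sine and cosine scores at theta:
   E A = 0, E B_j = |a_j f1| and E [A A^T] = phi(theta). The projection acts only
   away from theta, so it costs a quadratic error and the inequality for t^2
   survives; since 4 pi |a_j f1| > 1, E t^2 = O(1/n). Hence sqrt n t is nearly a
   linear recursion with martingale noise A. Comparing E cos (u . sqrt n t + b)
   with the Gaussian value exp (- u . Sigma u / 2) cos b, the difference is
   Lipschitz in u near 0 and each step maps u to a shorter vector, so its
   Lipschitz constant contracts by 1 - kap / n, up to o(1/n) by a Lindeberg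
   estimate. Trigonometric polynomials then give convergence in law. *)
Require Import Defs.
From HB Require Import structures.
From mathcomp Require Import all_boot all_order all_algebra.
From mathcomp Require Import all_classical all_reals all_analysis.
From mathcomp Require Import measurable_realfun ring lra.

Set Implicit Arguments.
Unset Strict Implicit.
Unset Printing Implicit Defensive.

Import Order.TTheory GRing.Theory Num.Theory.
Import numFieldNormedType.Exports.

Local Open Scope classical_set_scope.
Local Open Scope ring_scope.

(** The tangent makes the second-moment recursion close globally. In [t = tan (pi D)] the whole
    coefficient of [A] depends on the past and disappears in mean, and what remains is a contraction
    whose rate is [2 * c j] with [c j = 2 pi |a_j f1|]. The rate [O(1/n)] thus comes without a prior
    proof of almost sure convergence and without localisation near [theta]. For characteristic
    functions, each step costs an error [o(1/n)], which need not be summable. At [u = 0] the two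
    sides agree, so all errors can be kept proportional to the size of [u]. The shortening of [u]
    then puts a factor [1 - kap / n] in front of the previous modulus, and the divergence of the
    harmonic series absorbs the errors. This is why every estimate carries a factor [norm1 u] and
    holds for a whole ball of frequencies at once. The phase [b] treats real and imaginary parts
    together and keeps everything real. The uniform bound on first absolute moments supplies the
    tightness needed to pass from trigonometric polynomials to bounded continuous functions. *)

Ltac positivity := repeat first
  [ done | exact: ltW | exact: sqr_ge0 | exact: normr_ge0
  | apply: mulr_gt0 | apply: addr_gt0 | apply: exprn_gt0 | rewrite invr_gt0
  | apply: mulr_ge0 | apply: addr_ge0 | apply: exprn_ge0 | rewrite invr_ge0 ].

(** * Taylor and Lipschitz bounds for sine and cosine *)

Section Trigonometry.
Context {R : realType}.
Implicit Types x y h : R.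

(** Each Taylor inequality below is the nonnegativity of the derivative for the next one, so this
    lemma climbs from [cos <= 1] up to the quartic bound. *)
Lemma ge0_of_derive_ge0 (f f' : R -> R) :
  (forall x, is_derive x 1 f (f' x)) -> (forall x, 0 <= x -> 0 <= f' x) ->
  f 0 = 0 -> forall x, 0 <= x -> 0 <= f x.
Proof.
move=> fd f'0 f0 x x0.
have fc : {within `[0, x], continuous f}.
  apply: derivable_within_continuous => y _.
  by have := fd y; case.
have [c] := MVT_segment x0 (fun y _ => fd y) fc.
rewrite in_itv/= f0 !subr0 => /andP[c0 _] ->.
by rewrite mulr_ge0// f'0.
Qed.

Lemma sin_le_id x : 0 <= x -> sin x <= x.
Proof.
move=> x0; rewrite -subr_ge0; move: x x0.
apply: (@ge0_of_derive_ge0 (fun x => x - sin x) (fun x => 1 - cos x)) => [x _|].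
- by rewrite subr_ge0 cos_le1.
- by rewrite sin0 subr0.
Qed.

Lemma cos_ge_quadratic x : 1 - x ^+ 2 / 2 <= cos x.
Proof.
wlog x0 : x / 0 <= x => [H|].
  have [/H//|/ltW x0] := leP 0 x.
  by rewrite -cosN -sqrrN H// oppr_ge0.
suff: 0 <= cos x - 1 + 2^-1 * x ^+ 2 by lra.
have fd (y : R) : is_derive y 1 (fun y => cos y - 1 + 2^-1 * y ^+ 2) (- sin y + y).
  by apply: is_derive_eq; rewrite /GRing.scale/=; lra.
apply: (ge0_of_derive_ge0 fd) x0 => [y y0|].
- by rewrite addrC subr_ge0 sin_le_id.
- by rewrite cos0; lra.
Qed.

Lemma sin_ge_cubic x : 0 <= x -> x - x ^+ 3 / 6 <= sin x.
Proof.
move=> x0; suff: 0 <= sin x - x + 6^-1 * x ^+ 3 by lra.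
have fd (y : R) : is_derive y 1 (fun y => sin y - y + 6^-1 * y ^+ 3) (cos y - 1 + y ^+ 2 / 2).
  by apply: is_derive_eq; rewrite /GRing.scale/=; lra.
apply: (ge0_of_derive_ge0 fd) x0 => [y y0|].
- by have := cos_ge_quadratic y; lra.
- by rewrite sin0; lra.
Qed.

Lemma cos_le_quartic x : cos x <= 1 - x ^+ 2 / 2 + x ^+ 4 / 24.
Proof.
wlog x0 : x / 0 <= x => [H|].
  have [/H//|/ltW x0] := leP 0 x.
  have := H (- x); rewrite oppr_ge0 cosN sqrrN => /(_ x0).
  by rewrite (_ : (- x) ^+ 4 = x ^+ 4)//; ring.
suff: 0 <= 1 - cos x - 2^-1 * x ^+ 2 + 24^-1 * x ^+ 4 by lra.
have fd (y : R) : is_derive y 1 (fun y => 1 - cos y - 2^-1 * y ^+ 2 + 24^-1 * y ^+ 4)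
    (sin y - y + y ^+ 3 / 6).
  by apply: is_derive_eq; rewrite /GRing.scale/=; lra.
apply: (ge0_of_derive_ge0 fd) x0 => [y y0|].
- by have := sin_ge_cubic y0; lra.
- by rewrite cos0; lra.
Qed.

Lemma norm_sin_le x : `|sin x| <= `|x|.
Proof.
wlog x0 : x / 0 <= x => [H|].
  have [/H//|/ltW x0] := leP 0 x.
  by rewrite -normrN -sinN -(normrN x) H// oppr_ge0.
have s := sin_le_id x0; rewrite (ger0_norm x0) ler_norml s andbT.
have [x1|x1] := leP x 1; last by have := sin_geN1 x; lra.
have := sin_ge_cubic x0; nra.
Qed.

(** The factor [Num.min 1 |x|] keeps the remainder quadratic for large [x], hence integrable against
    square-integrable noise, and cubic for small [x]: the shape of the Lindeberg condition. *)
Lemma norm_sinB_id_le x : `|sin x - x| <= x ^+ 2 * Num.min 1 `|x|.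
Proof.
wlog x0 : x / 0 <= x => [H|].
  have [/H//|/ltW x0] := leP 0 x.
  have := H (- x); rewrite oppr_ge0 sqrrN normrN => /(_ x0); apply: le_trans.
  by rewrite -normrN opprB sinN opprK addrC.
have s := sin_le_id x0; have s3 := sin_ge_cubic x0; have s1 := sin_geN1 x.
rewrite distrC ger0_norm ?subr_ge0// (ger0_norm x0).
by have [x1|x1] := leP 1 x; nra.
Qed.

Lemma cosB1_bounds x : - (x ^+ 2 / 2) <= cos x - 1 <= 0.
Proof. by have := cos_ge_quadratic x; have := cos_le1 x; lra. Qed.

Lemma cos_taylor2_le x : `|cos x - 1 + x ^+ 2 / 2| <= x ^+ 2 * Num.min 1 `|x|.
Proof.
have /andP[c1 c2] := cosB1_bounds x; have c4 := cos_le_quartic x.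
rewrite ger0_norm; last by lra.
have [x1|x1] := leP 1 `|x|; first by nra.
have x0 := normr_ge0 x; rewrite -(real_normK (num_real x)).
rewrite -(real_normK (num_real x)) in c4.
rewrite (_ : x ^+ 4 = `|x| ^+ 4) in c4; last first.
  by rewrite -[4%N]/(2 * 2)%N !exprM real_normK ?num_real.
nra.
Qed.

Lemma cosD_taylor2_le x h :
  `|cos (x + h) - (cos x - h * sin x - h ^+ 2 / 2 * cos x)| <=
  2 * (h ^+ 2 * Num.min 1 `|h|).
Proof.
rewrite cosD (_ : _ - _ = cos x * (cos h - 1 + h ^+ 2 / 2) - sin x * (sin h - h)); last by ring.
apply: (le_trans (ler_normB _ _)); rewrite !normrM mulrDl mul1r lerD//.
- by rewrite (le_trans (ler_piMl _ (cos_max x)))// cos_taylor2_le.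
- by rewrite (le_trans (ler_piMl _ (sin_max x)))// norm_sinB_id_le.
Qed.

Lemma cos_lipschitz x y : `|cos x - cos y| <= `|x - y|.
Proof.
rewrite [x in cos x](_ : _ = (x + y) / 2 + (x - y) / 2); last by lra.
rewrite [y in _ - cos y](_ : _ = (x + y) / 2 - (x - y) / 2); last by lra.
rewrite cosD cosB (_ : _ - _ = - sin ((x + y) / 2) * (2 * sin ((x - y) / 2))); last by ring.
rewrite normrM normrN (le_trans (ler_piMl _ (sin_max _)))//.
rewrite normrM ger0_norm// mulrC -ler_pdivlMr//.
by rewrite (le_trans (norm_sin_le _))// normrM [`|2^-1|]ger0_norm.
Qed.

End Trigonometry.

(** * The effect of one projected step on the tangent of the error *)

Section TangentStep.
Context {R : realType}.
Implicit Types a b x D : R.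

(** Over the common denominator [cos a * cos b ^+ 2], which is at least [m ^+ 3], the addition
    formulas with [h = a - b] leave three terms, each at most [h ^+ 2]. *)
Lemma tan_taylor1 (m a b : R) : 0 < m -> m <= cos a -> m <= cos b ->
  `|tan a - tan b - (1 + tan b ^+ 2) * (a - b)| <= 3 / m ^+ 3 * (a - b) ^+ 2.
Proof.
move=> m0 ma mb.
have ca : 0 < cos a by exact: lt_le_trans ma.
have cb : 0 < cos b by exact: lt_le_trans mb.
set h := a - b.
have -> : tan a - tan b - (1 + tan b ^+ 2) * h =
    (cos b * (sin h - h) + h * cos b * (1 - cos h) + h * sin h * sin b) /
    (cos a * cos b ^+ 2).
  rewrite -cos2_tan2 ?gt_eqF//.
  transitivity ((sin a * cos b ^+ 2 - sin b * cos a * cos b - h * cos a) /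
      (cos a * cos b ^+ 2)); first by rewrite /tan; field; rewrite !gt_eqF.
  congr (_ / _).
  have -> : sin a = sin h * cos b + cos h * sin b by rewrite -sinD subrK.
  have -> : cos a = cos h * cos b - sin h * sin b by rewrite -cosD subrK.
  transitivity (sin h * cos b * (cos b ^+ 2 + sin b ^+ 2) - h * cos h * cos b + h * sin h * sin b); first by ring.
  by rewrite cos2Dsin2; ring.
rewrite normrM [`|_^-1|]ger0_norm; last first.
  by rewrite invr_ge0 mulr_ge0 ?sqr_ge0 ?ltW.
rewrite [leRHS]mulrAC; apply: ler_pM => //; first by rewrite invr_ge0 mulr_ge0 ?sqr_ge0 ?ltW.
  2: { have m3 : m ^+ 3 <= cos a * cos b ^+ 2.
    rewrite exprS; apply: ler_pM => //; rewrite ?exprn_ge0 ?(ltW m0)//.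
    by rewrite lerXn2r ?nnegrE// ?ltW.
  rewrite lef_pV2// posrE; first by rewrite mulr_gt0 ?exprn_gt0.
  exact: exprn_gt0. }
have s1 : `|sin h - h| <= h ^+ 2.
  by apply: (le_trans (norm_sinB_id_le h)); rewrite ler_piMr ?sqr_ge0// ge_min lexx.
have /andP[c1 c2] := cosB1_bounds h.
have hc : `|h * (1 - cos h)| <= h ^+ 2.
  rewrite normrM -(real_normK (num_real h)) expr2 ler_wpM2l//.
  have := cos_lipschitz 0 h; rewrite cos0 sub0r normrN => //.
have hs : `|h * sin h| <= h ^+ 2.
  by rewrite normrM -(real_normK (num_real h)) expr2 ler_wpM2l// norm_sin_le.
rewrite (_ : 3 * h ^+ 2 = h ^+ 2 + h ^+ 2 + h ^+ 2); last by ring.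
rewrite (le_trans (ler_normD _ _))// lerD//; last first.
  by rewrite normrM (le_trans (ler_piMr _ (sin_max _))).
rewrite (le_trans (ler_normD _ _))// lerD//.
  by rewrite normrM (le_trans (ler_piMl _ (cos_max _))).
by rewrite mulrAC normrM (le_trans (ler_piMr _ (cos_max _))).
Qed.

Lemma tan_lipschitz (m a b : R) : 0 < m -> m <= cos a -> m <= cos b ->
  `|tan a - tan b| <= (m ^+ 2)^-1 * `|a - b|.
Proof.
move=> m0 ma mb.
have ca : 0 < cos a by exact: lt_le_trans ma.
have cb : 0 < cos b by exact: lt_le_trans mb.
have -> : tan a - tan b = (cos a * cos b)^-1 * sin (a - b).
  by rewrite sinB /tan; field; rewrite !gt_eqF.
rewrite normrM [`|_^-1|]ger0_norm; last by positivity.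
apply: ler_pM; [positivity|positivity| |exact: norm_sin_le].
have m2 : m ^+ 2 <= cos a * cos b by rewrite expr2; apply: ler_pM => //; exact: ltW.
by rewrite lef_pV2// posrE; positivity.
Qed.

Lemma tan_bound (m a : R) : 0 < m -> m <= cos a -> `|tan a| <= m^-1.
Proof.
move=> m0 ma; have ca : 0 < cos a by exact: lt_le_trans ma.
rewrite /tan normrM [`|_^-1|]ger0_norm; last by positivity.
rewrite -[leRHS]mul1r; apply: ler_pM => //; first by positivity.
  exact: sin_max.
by rewrite lef_pV2.
Qed.

(** The iterate is within [4^-1] of 0 and the target within [4^-1 - eta], so the error stays [eta]
    away from the poles of [tan (pi D)]; this is the resulting lower bound on the cosine. *)
Lemma cos_pi_ge (eta D : R) : 0 < eta -> `|D| <= 2^-1 - eta ->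
  sin (pi * eta) <= cos (pi * D).
Proof.
move=> e0 De.
have p0 := @pi_gt0 R; have D0 := normr_ge0 D.
have -> : sin (pi * eta) = cos (pi * (2^-1 - eta)).
  by rewrite -cosN -sinDpihalf; congr sin; lra.
rewrite -(cos_norm (pi * D)) normrM (ger0_norm (ltW p0)).
have [->//|ne] := eqVneq `|D| (2^-1 - eta).
rewrite ltW// ltr_cos ?in_itv/= ?ltr_pM2l//; first by rewrite lt_neqAle ne.
- by apply/andP; split; nra.
- by apply/andP; split; nra.
Qed.

Lemma sin_pi_gt0 (eta : R) : 0 < eta < 1 -> 0 < sin (pi * eta).
Proof.
move=> /andP[e0 e1]; have p0 := @pi_gt0 R.
by rewrite sin_gt0_pi// mulr_gt0//= gtr_pMr.
Qed.

(** The tangent dominates the sine. Applied with half the margin, it keeps the tangent away from 0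
    at errors from which a small step can already be projected. *)
Lemma tan_pi_ge (eta D : R) : 0 < eta -> eta <= D -> D < 2^-1 ->
  sin (pi * eta) <= tan (pi * D).
Proof.
move=> e0 eD D2; have p0 := @pi_gt0 R.
have sD : sin (pi * eta) <= sin (pi * D).
  have [->//|ne] := eqVneq eta D.
  rewrite ltW// ltr_sin ?in_itv/= ?ltr_pM2l//; first by rewrite lt_neqAle ne.
  - apply/andP; split; nra.
  - apply/andP; split; nra.
apply: (le_trans sD); have cD : 0 < cos (pi * D).
  by apply: cos_gt0_pihalf; apply/andP; split; nra.
have s0 : 0 < sin (pi * eta) by apply: sin_pi_gt0; lra.
rewrite /tan ler_peMr ?(le_trans (ltW s0))// invf_ge1// cos_le1//.
Qed.

Lemma piK_bound x : `|piK x| <= 4^-1.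
Proof. by rewrite /piK; case: ifP => // _; case: ifP => _; rewrite ?normrN ger0_norm. Qed.

(** The first bound is one-sided, so a projection adds nothing to it beyond [delta ^+ 2]; it feeds
    the recursion for second moments. The second is two-sided, pays [|delta| * t ^+ 2] for a
    projection, and feeds the linearization. *)
Definition tan_step_spec (C t t' delta : R) :=
  t' ^+ 2 <= t ^+ 2 + 2 * t * (pi * (1 + t ^+ 2) * delta) + C * delta ^+ 2 /\
  `|t' - t - pi * (1 + t ^+ 2) * delta| <= C * (delta ^+ 2 + `|delta| * t ^+ 2).

(* A projection can only occur at distance at least [eta] from the target,
   where [tan] is bounded below: this is why the remainder is quadratic. *)
Lemma tan_step (eta : R) : 0 < eta < 4^-1 -> exists2 C : R, 0 < C &
  forall theta D delta : R, `|theta| <= 4^-1 - eta -> `|theta + D| <= 4^-1 ->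
    tan_step_spec C (tan (pi * D)) (tan (pi * (piK (theta + D + delta) - theta)))
      delta.
Proof.
move=> /andP[e0 e4]; have p0 := @pi_gt0 R.
pose m : R := sin (pi * eta).
have m0 : 0 < m by apply: sin_pi_gt0; lra.
pose t0 : R := sin (pi * (eta / 2)).
have t00 : 0 < t0 by apply: sin_pi_gt0; lra.
pose T := m^-1; have T0 : 0 < T by rewrite invr_gt0.
pose K := 3 / m ^+ 3 * pi ^+ 2.
have K0 : 0 < K by rewrite mulr_gt0 ?divr_gt0 ?exprn_gt0.
pose L := (m ^+ 2)^-1 * pi.
have L0 : 0 < L by rewrite mulr_gt0 ?invr_gt0 ?exprn_gt0.
pose S0 := pi * (1 + T ^+ 2).
have S00 : 0 < S0 by rewrite mulr_gt0// addr_gt0 ?exprn_gt0.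
pose C1 := 2 * T * K + L ^+ 2.
have C10 : 0 < C1 by rewrite /C1; positivity.
pose C2 := T ^+ 2 / eta ^+ 2 + 2 * T * S0 / eta.
have C20 : 0 < C2 by rewrite /C2; positivity.
pose C3 := (L + S0) / t0 ^+ 2.
have C30 : 0 < C3 by rewrite /C3; positivity.
pose C4 := (L + S0) * 2 / eta.
have C40 : 0 < C4 by rewrite /C4; positivity.
pose C := C1 + C2 + C3 + C4 + K.
have C0 : 0 < C by exact: (addr_gt0 (addr_gt0 (addr_gt0 (addr_gt0 C10 C20) C30) C40) K0).
exists C => //.
have core (theta D z : R) : `|theta| <= 4^-1 - eta -> `|theta + D| <= 4^-1 ->
    `|theta + z| <= 4^-1 ->
    [/\ `|tan (pi * D)| <= T, `|tan (pi * z)| <= T,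
        `|tan (pi * z) - tan (pi * D) - pi * (1 + tan (pi * D) ^+ 2) * (z - D)| <=
           K * (z - D) ^+ 2 &
        `|tan (pi * z) - tan (pi * D)| <= L * `|z - D|].
  move=> hth hD hz.
  have cD : m <= cos (pi * D).
    by apply: cos_pi_ge => //; move: hth hD; rewrite !ler_norml; lra.
  have cz : m <= cos (pi * z).
    by apply: cos_pi_ge => //; move: hth hz; rewrite !ler_norml; lra.
  split; [exact: tan_bound|exact: tan_bound| |].
  - have := tan_taylor1 m0 cz cD.
    rewrite -mulrBr.
    rewrite (_ : _ * (pi * (z - D)) = pi * (1 + tan (pi * D) ^+ 2) * (z - D)); last by ring.
    by rewrite (_ : K * _ = 3 / m ^+ 3 * (pi * (z - D)) ^+ 2)// /K; ring.
  - have := tan_lipschitz m0 cz cD.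
    by rewrite -mulrBr normrM (gtr0_norm p0) mulrA.
have S0E : S0 = pi * (1 + T ^+ 2) by [].
have C2E : C2 = T ^+ 2 / eta ^+ 2 + 2 * T * S0 / eta by [].
have C3E : C3 = (L + S0) / t0 ^+ 2 by [].
have C4E : C4 = (L + S0) * 2 / eta by [].
have C12 : C1 + C2 <= C by rewrite /C; lra.
have C1C : C1 <= C by rewrite /C; lra.
have C3C : C3 <= C by rewrite /C; lra.
have C4C : C4 <= C by rewrite /C; lra.
have KC : K <= C by rewrite /C; lra.
clearbody C C2 C3 C4 S0 K L T.
have first_order (t t' S h : R) : `|t| <= T -> `|t' - t - S * h| <= K * h ^+ 2 ->
    `|t' - t| <= L * `|h| -> t' ^+ 2 <= t ^+ 2 + 2 * t * (S * h) + C1 * h ^+ 2.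
  move=> tT tK tL.
  have -> : t' ^+ 2 = t ^+ 2 + 2 * t * (S * h) + 2 * (t * (t' - t - S * h)) + (t' - t) ^+ 2.
    by ring.
  have q1 : 2 * (t * (t' - t - S * h)) <= 2 * T * K * h ^+ 2.
    rewrite -!mulrA ler_pM2l//; apply: (le_trans (ler_norm _)).
    by rewrite normrM ler_pM.
  have q2 : (t' - t) ^+ 2 <= L ^+ 2 * h ^+ 2.
    rewrite -(real_normK (num_real (t' - t))) -(real_normK (num_real h)) -exprMn.
    by rewrite lerXn2r ?nnegrE// mulr_ge0// ltW.
  by rewrite /C1; lra.
clearbody C1.
(* A step cut at the upper end: the effective displacement [h = z - D] satisfies [0 <= h <= delta].
   The lower end follows by changing all signs. *)
have up (theta D delta : R) : `|theta| <= 4^-1 - eta -> `|theta + D| <= 4^-1 ->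
    4^-1 < theta + D + delta ->
    tan_step_spec C (tan (pi * D)) (tan (pi * (4^-1 - theta))) delta.
  move=> hth hD hout; set z := 4^-1 - theta.
  have hz : `|theta + z| <= 4^-1.
    by rewrite /z addrC subrK ger0_norm.
  have [tT t'T tK tL] := core _ _ _ hth hD hz.
  have ze : eta <= z by rewrite /z; move: hth; rewrite ler_norml; lra.
  have h0 : 0 <= z - D by clear -hD; rewrite /z; move: hD; rewrite ler_norml; lra.
  have hd : z - D <= delta by clear -hout; rewrite /z; lra.
  have D2 : D < 2^-1 by clear -hth hD e0; move: hth hD; rewrite !ler_norml; lra.
  have D2' : - 2^-1 < D by clear -hth hD e0; move: hth hD; rewrite !ler_norml; lra.
  have d0 : 0 <= delta by clear -h0 hd; lra.
  have tpos : 0 <= D -> 0 <= tan (pi * D).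
    move=> D0; rewrite /tan divr_ge0//.
      by rewrite sin_ge0_pi// mulr_ge0 ?(ltW p0)//= ler_piMr ?(ltW p0)//; clear -D2; lra.
    by rewrite cos_ge0_pihalf//; clear -D2 D2' D0 p0; apply/andP; split; nra.
  have tbig : eta / 2 <= D -> t0 <= tan (pi * D).
    by move=> De; apply: tan_pi_ge => //; clear -e0; lra.
  move: tT t'T tK tL tpos tbig.
  set t := tan (pi * D); set t' := tan (pi * z); set h := z - D in h0 hd *.
  move=> tT t'T tK tL tpos tbig.
  set S := pi * (1 + t ^+ 2) in tK *.
  have SS : 0 <= S <= S0.
    rewrite mulr_ge0 ?(ltW p0) ?addr_ge0 ?sqr_ge0//= S0E ler_pM2l// lerD2l.
    by rewrite -(real_normK (num_real t)) lerXn2r ?nnegrE// ?ltW.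
  case/andP: SS => S1 S2.
  rewrite /tan_step_spec -/t -/t' -/S.
  clearbody S t t'.
  have dd : h ^+ 2 <= delta ^+ 2 by rewrite lerXn2r ?nnegrE.
  have d2 := sqr_ge0 delta.
  split.
  (* If [D >= 0] then [t >= 0], and shortening the step only lowers the drift term. If [D < 0], a
     cut forces [delta >= eta], and every bounded quantity is at most a multiple of [delta ^+ 2]. *)
  - have [D0|D0] := leP 0 D.
      have t0' := tpos D0; apply: (le_trans (first_order _ _ _ _ tT tK tL)).
      rewrite lerD//; first by rewrite lerD2l !ler_wpM2l// mulr_ge0.
      by rewrite ler_pM ?sqr_ge0 ?(ltW C10).
    have de : eta <= delta by clear -hd D0 ze; rewrite /h in hd *; lra.
    have q1 : t' ^+ 2 <= T ^+ 2 / eta ^+ 2 * delta ^+ 2.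
      rewrite -(real_normK (num_real t')) mulrAC ler_pdivlMr ?exprn_gt0//.
      by rewrite ler_pM ?sqr_ge0// lerXn2r ?nnegrE// ?ltW.
    have q2 : - (2 * t * (S * delta)) <= 2 * T * S0 / eta * delta ^+ 2.
      apply: (le_trans (ler_norm _)); rewrite normrN !normrM (ger0_norm S1) (ger0_norm d0).
      rewrite [`|2|]ger0_norm// -!mulrA ler_pM2l// ler_pM ?mulr_ge0//.
      rewrite ler_pM// expr2 mulrA ler_peMl//.
      by rewrite mulrC ler_pdivlMr// mul1r.
    have q3 : (C1 + C2) * delta ^+ 2 <= C * delta ^+ 2 by rewrite ler_wpM2r.
    have q4 := mulr_ge0 (ltW C10) d2; have q5 := sqr_ge0 t.
    by move: q3; rewrite C2E; clear -q1 q2 q4 q5; lra.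
  - have q : `|t' - t - S * delta| <= (L + S0) * delta.
      apply: (le_trans (ler_normB _ _)); rewrite mulrDl lerD//.
        by apply: (le_trans tL); rewrite ger0_norm// ler_pM2l.
      by rewrite normrM (ger0_norm S1) (ger0_norm d0) ler_wpM2r.
    rewrite (ger0_norm d0); apply: (le_trans q); rewrite mulrDr.
    (* Far from the target, [t >= t0] turns the linear error into a multiple of [delta * t ^+ 2];
       close to it, the cut forces [delta >= eta / 2] and the error is a multiple of
       [delta ^+ 2]. *)
    have [De|De] := leP (eta / 2) D.
      have tt := tbig De; rewrite ler_wpDl ?mulr_ge0 ?(ltW C0)//.
      apply: (@le_trans _ _ (C3 * (delta * t ^+ 2))).
        rewrite C3E [leRHS]mulrAC ler_pdivlMr ?exprn_gt0// -!mulrA.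
        rewrite ler_wpM2l ?addr_ge0 ?(ltW L0) ?(ltW S00)// ler_wpM2l//.
        by rewrite lerXn2r ?nnegrE// ?ltW// (lt_le_trans t00).
      by rewrite ler_wpM2r ?(mulr_ge0 d0) ?sqr_ge0.
    apply: ler_wpDr; first by positivity.
    apply: (@le_trans _ _ (C4 * delta ^+ 2)).
      rewrite C4E -!mulrA ler_wpM2l ?addr_ge0 ?(ltW L0) ?(ltW S00)//.
      rewrite mulrCA ler_pdivlMl// expr2 mulrA ler_wpM2r//.
      clear -hd De ze; rewrite /h in hd *; lra.
    by rewrite ler_wpM2r ?sqr_ge0.
move=> theta D delta hth hD; rewrite /piK; case: ifP => [hin|/negbT].
  have [tT _ tK tL] := core theta D (D + delta) hth hD ltac:(by rewrite addrA).
  rewrite (_ : theta + D + delta - theta = D + delta); last by ring.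
  rewrite (_ : D + delta - D = delta) in tK tL; last by ring.
  split.
    apply: (le_trans (first_order _ _ _ _ tT tK tL)).
    by rewrite lerD2l ler_wpM2r ?sqr_ge0// /C; lra.
  apply: (le_trans tK); rewrite mulrDr; apply: ler_wpDr; first by positivity.
  by rewrite ler_wpM2r ?sqr_ge0.
rewrite -ltNge lter_normr => hout; case: ifP => [h4|/negbT h4].
  by apply: up => //; case/orP: hout => //; lra.
have hN : 4^-1 < - theta + - D + - delta by move: hout h4; rewrite -ltNge; lra.
have := up (- theta) (- D) (- delta).
rewrite normrN -opprD normrN => /(_ hth hD); rewrite opprD => /(_ hN).
rewrite /tan_step_spec mulrN tanN (_ : pi * (4^-1 - - theta) = - (pi * (- 4^-1 - theta))); last by ring.
rewrite tanN !sqrrN normrN => -[q1 q2]; split.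
  by move: q1; rewrite (_ : 2 * - _ * (_ * - delta) = 2 * tan (pi * D) * (pi * (1 + tan (pi * D) ^+ 2) * delta))//; ring.
by move: q2; rewrite -[X in X <= _]normrN; congr (`|_| <= _); ring.
Qed.

End TangentStep.

(** * Two deterministic recursions with step [1 / n] *)

Section Recursions.
Context {R : realType}.

Lemma recursion_rate (k C B : R) (x : nat -> R) : 1 < k -> 0 <= C ->
  (forall n, 0 <= x n <= B) ->
  (forall n, x n.+1 <= (1 - k / n.+1%:R) * x n + C / n.+1%:R ^+ 2) ->
  exists2 M : R, 0 <= M & forall n, n%:R * x n <= M.
Proof.
move=> k1 C0 xB xS.
have k0 : 0 < k - 1 by rewrite subr_gt0.
have B0 : 0 <= B by have /andP[a b] := xB 0%N; exact: le_trans b.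
pose N := (Num.trunc k).+1.
have kN : k < N%:R by rewrite /N truncnS_gt.
pose M := N%:R * B + C / (k - 1).
have M0 : 0 <= M by rewrite /M; positivity.
have MC : C <= M * (k - 1).
  rewrite /M mulrDl divfK ?gt_eqF// lerDr; positivity.
have small n : (n <= N)%N -> n%:R * x n <= M.
  move=> nN; have /andP[x0 x1] := xB n.
  apply: (@le_trans _ _ (N%:R * B)).
    by apply: ler_pM => //; rewrite ler_nat.
  rewrite /M lerDl; positivity.
exists M => //; elim => [|n IH]; first by rewrite mul0r.
have [nN|Nn] := leqP n.+1 N; first exact: small.
have n0 : 0 < n%:R :> R by rewrite ltr0n; case: (n) Nn.
have kn : k <= n%:R by rewrite (le_trans (ltW kN))// ler_nat.
have n10 : 0 < n.+1%:R :> R by [].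
have nn1 : n%:R <= n.+1%:R :> R by rewrite ler_nat.
have e1 : n.+1%:R = n%:R + 1 :> R by rewrite natr1.
have /andP[x0 _] := xB n.
have h1 : n.+1%:R * x n.+1 <= (n.+1%:R - k) * x n + C / n.+1%:R.
  have -> : (n.+1%:R - k) * x n + C / n.+1%:R =
      n.+1%:R * ((1 - k / n.+1%:R) * x n + C / n.+1%:R ^+ 2).
    by field; rewrite gt_eqF.
  by rewrite ler_pM2l.
apply: (le_trans h1).
have h2 : C / n.+1%:R <= C / n%:R by rewrite ler_wpM2l// lef_pV2 ?posrE.
have h3 : (n.+1%:R - k) * x n = (1 - (k - 1) / n%:R) * (n%:R * x n).
  by rewrite e1; field; rewrite gt_eqF.
have h4 : 0 <= 1 - (k - 1) / n%:R.
  by rewrite subr_ge0 ler_pdivrMr// mul1r; clear -kn; lra.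
have h5 : (1 - (k - 1) / n%:R) * (n%:R * x n) <= (1 - (k - 1) / n%:R) * M.
  by rewrite ler_wpM2l.
have h6 : C / n%:R <= M * (k - 1) / n%:R by rewrite ler_wpM2r// invr_ge0 ltW.
rewrite h3; apply: (le_trans (lerD h5 (le_trans h2 h6))).
by rewrite mulrBl mul1r mulrAC (mulrC (k - 1)) subrK.
Qed.

(** Once [e] is below [k * eps / 2], the excess [D n - eps / 2] is contracted. The weight
    [1 + k * s n], with [s n] a harmonic sum, stands for the reciprocal of the product of the
    contraction factors: the weighted excess stays below [B], while the weight is unbounded. *)
Lemma recursion_cvg0 (k : R) (N : nat) (D e : nat -> R) : 0 < k ->
  k <= N.+1%:R -> (forall n, (N <= n)%N -> 0 <= D n) ->
  (forall n, (N <= n)%N ->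
     D n.+1 <= (1 - k / n.+1%:R) * D n + e n / n.+1%:R) ->
  e @ \oo --> (0 : R) -> D @ \oo --> (0 : R).
Proof.
move=> k0 kN D0 DS e0; apply/cvgrPdist_le => eps eps0.
have [N1 _ eN1] : \forall n \near \oo, e n <= k * (eps / 2).
  have : \forall n \near \oo, `|0 - e n| <= k * (eps / 2).
    by move/cvgrPdist_le : e0; apply; rewrite mulr_gt0// divr_gt0.
  apply: filterS => n; rewrite sub0r normrN; exact: le_trans (ler_norm _).
pose N2 := maxn N N1.
pose s n := \sum_(N2 <= i < n) (i.+1%:R^-1 : R).
pose B := D N2.
have B0 : 0 <= B by apply: D0; rewrite leq_maxl.
have s0 n : 0 <= s n by rewrite sumr_ge0// => i _; rewrite invr_ge0.
have key m : (D (N2 + m)%N - eps / 2) * (1 + k * s (N2 + m)%N) <= B.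
  elim: m => [|m IH].
    rewrite addn0 /s big_geq// mulr0 addr0 mulr1 /B lerBlDr lerDl.
    by rewrite ltW// divr_gt0.
  rewrite addnS; set n := (N2 + m)%N in IH *.
  have Nn : (N <= n)%N by rewrite (leq_trans (leq_maxl _ N1))// leq_addr.
  have N1n : (N1 <= n)%N by rewrite (leq_trans (leq_maxr N _))// leq_addr.
  have sS : s n.+1 = s n + n.+1%:R^-1 by rewrite /s big_nat_recr//= leq_addr.
  have g0 : 0 < n.+1%:R^-1 :> R by rewrite invr_gt0.
  have kg : k * n.+1%:R^-1 <= 1.
    by rewrite ler_pdivrMr// mul1r (le_trans kN)// ler_nat.
  have h1 := DS n Nn; have h2 := eN1 n N1n.
  rewrite sS; move: (s0 n) g0 kg h1 h2 IH.
  move: (s n) (n.+1%:R^-1 : R) (D n) (D n.+1) (e n) => S g d d' en.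
  move=> S0 g0 kg h1 h2 IH.
  have h3 : d' - eps / 2 <= (1 - k * g) * (d - eps / 2).
    have : en * g <= k * (eps / 2) * g by rewrite ler_pM2r.
    clear -h1; lra.
  have [dl|dl] := leP (d - eps / 2) 0.
    apply: (le_trans _ B0); apply: mulr_le0_ge0; last by positivity.
    by apply: (le_trans h3); rewrite mulr_ge0_le0// subr_ge0.
  apply: le_trans IH; apply: (@le_trans _ _ ((1 - k * g) * (d - eps / 2) * (1 + k * (S + g)))).
    by rewrite ler_wpM2r//; positivity.
  have q : 0 <= (d - eps / 2) * (k * g * (k * (S + g))) by positivity.
  by move: q; clear; lra.
have [m0 sm0] : exists m0, forall m, (m0 <= m)%N -> B <= eps / 2 * (1 + k * s m).
  apply: contrapT => /forallNP H.
  have sle n : s n <= B / (eps / 2 * k).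
    have /existsNP[m /not_implyP[nm /negP]] := H n.
    rewrite -ltNge => h.
    have sn : s n <= s m.
      rewrite /s; have [Nn|nN] := leqP N2 n; last by rewrite [leLHS]big_geq ?(ltnW nN)// s0.
      by rewrite (@big_cat_nat _ _ _ n N2 m)//= lerDl sumr_ge0// => i _; rewrite invr_ge0.
    have q : 0 < eps / 2 * k by positivity.
  apply: (le_trans sn); rewrite ler_pdivlMr//.
    by move: h; clear -eps0; lra.
  apply: (@dvg_harmonic R); apply: nondecreasing_is_cvgn.
    by apply: nondecreasing_series => i _ _; rewrite /harmonic invr_ge0.
  exists (\sum_(0 <= i < N2) (i.+1%:R^-1 : R) + B / (eps / 2 * k)) => _ [n _ <-].
  rewrite /series/=; have [Nn|nN] := leqP N2 n.
    by rewrite (@big_cat_nat _ _ _ N2)//= lerD2l sle.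
  apply: (@le_trans _ _ (\sum_(0 <= i < N2) (i.+1%:R^-1 : R))).
    rewrite (@big_cat_nat _ _ _ n 0%N N2)//= ?(ltnW nN)// lerDl.
    by rewrite sumr_ge0// => i _; rewrite invr_ge0.
  by rewrite lerDl (le_trans (s0 0%N) (sle 0%N)).
exists (maxn N2 m0) => // n /=; rewrite geq_max => /andP[Nn mn].
rewrite sub0r normrN ger0_norm; last by apply: D0; rewrite (leq_trans (leq_maxl _ _) Nn).
have := key (n - N2)%N; rewrite subnKC// => h1; have h2 := sm0 n mn.
have h3 : 0 < 1 + k * s n by rewrite ltr_pwDl//; positivity.
have : D n - eps / 2 <= eps / 2 by rewrite -(ler_pM2r h3) (le_trans h1 h2).
clear; lra.
Qed.

End Recursions.

(** * Image laws, integrability and real-valued expectations *)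

Definition mfun_of d d' (T : measurableType d) (T' : measurableType d')
    (F : T -> T') (mF : measurable_fun setT F) : {mfun T >-> T'} :=
  MeasurableFun.Pack (MeasurableFun.Class (isMeasurableFun.Build _ _ _ _ _ mF)).

Definition law d d' (T : measurableType d) (T' : measurableType d')
    (R : realType) (P : probability T R) (F : T -> T')
    (mF : measurable_fun setT F) : probability T' R :=
  distribution P (mfun_of mF).

Definition L1 d (T : measurableType d) (R : realType) (P : probability T R)
  (F : T -> R) : Prop := P.-integrable setT (EFin \o F).

HB.lock Definition Ex d (T : measurableType d) (R : realType) (P : probability T R)
  (F : T -> R) : R := \int[P]_x F x.
Arguments Ex {d T R} P F.

Section Expectation.
Context d (T : measurableType d) (R : realType) (P : probability T R).
Implicit Types F G : T -> R.

Lemma L1_measurable F : L1 P F -> measurable_fun setT F.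
Proof. by move=> /integrableP[/measurable_EFinP]. Qed.

Lemma L1_le F G : measurable_fun setT F -> (forall w, `|F w| <= G w) ->
  L1 P G -> L1 P F.
Proof.
move=> mF FG; apply: le_integrable => //; first exact/measurable_EFinP.
by move=> w _ /=; rewrite lee_fin (le_trans (FG w))// ler_norm.
Qed.

Lemma L1_cst (c : R) : L1 P (fun=> c).
Proof. exact: finite_measure_integrable_cst. Qed.

Lemma L1_bounded F (M : R) : measurable_fun setT F -> (forall w, `|F w| <= M) ->
  L1 P F.
Proof. by move=> mF FM; apply: (L1_le mF FM); exact: L1_cst. Qed.

Lemma L1D F G : L1 P F -> L1 P G -> L1 P (fun w => F w + G w).
Proof. by move=> iF iG; exact: (integrableD _ iF iG). Qed.

Lemma L1B F G : L1 P F -> L1 P G -> L1 P (fun w => F w - G w).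
Proof. by move=> iF iG; exact: (integrableB _ iF iG). Qed.

Lemma L1Z (c : R) F : L1 P F -> L1 P (fun w => c * F w).
Proof. by move=> iF; exact: (integrableZl _ c iF). Qed.

Lemma L1_norm F : L1 P F -> L1 P (fun w => `|F w|).
Proof. exact: integrable_norm. Qed.

Lemma L1_sum (I : Type) (s : seq I) (Q : pred I) (F : I -> T -> R) :
  (forall i, Q i -> L1 P (F i)) -> L1 P (fun w => \sum_(i <- s | Q i) F i w).
Proof.
move=> iF; rewrite /L1 /comp.
under [X in integrable _ _ X]eq_fun do rewrite -sumEFin.
exact: integrable_sum.
Qed.

Lemma Ex_cst (c : R) : Ex P (fun=> c) = c.
Proof. by rewrite Ex.unlock /Rintegral; have := expectation_cst P c; rewrite unlock => ->. Qed.

Lemma ExD F G : L1 P F -> L1 P G -> Ex P (fun w => F w + G w) = Ex P F + Ex P G.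
Proof. by move=> iF iG; rewrite Ex.unlock; exact: RintegralD. Qed.

Lemma ExB F G : L1 P F -> L1 P G -> Ex P (fun w => F w - G w) = Ex P F - Ex P G.
Proof. by move=> iF iG; rewrite Ex.unlock; exact: RintegralB. Qed.

Lemma ExZ (c : R) F : L1 P F -> Ex P (fun w => c * F w) = c * Ex P F.
Proof. by move=> iF; rewrite Ex.unlock; exact: RintegralZl. Qed.

Lemma ExN F : L1 P F -> Ex P (fun w => - F w) = - Ex P F.
Proof.
move=> iF; rewrite -mulN1r -ExZ//; congr (Ex P); apply/funext => w.
by rewrite mulN1r.
Qed.

Lemma Ex_sum (I : Type) (s : seq I) (F : I -> T -> R) :
  (forall i, L1 P (F i)) ->
  Ex P (fun w => \sum_(i <- s) F i w) = \sum_(i <- s) Ex P (F i).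
Proof.
move=> iF; elim: s => [|i s IH].
  by rewrite big_nil -[RHS]Ex_cst; congr (Ex P); apply/funext => w; rewrite big_nil.
rewrite big_cons -IH -ExD//; last exact: L1_sum.
by congr (Ex P); apply/funext => w; rewrite big_cons.
Qed.

Lemma Ex_le F G : L1 P F -> L1 P G -> (forall w, F w <= G w) -> Ex P F <= Ex P G.
Proof. by move=> iF iG FG; rewrite Ex.unlock; exact: le_Rintegral. Qed.

Lemma Ex_ge0 F : (forall w, 0 <= F w) -> 0 <= Ex P F.
Proof. by move=> F0; rewrite Ex.unlock; exact: Rintegral_ge0. Qed.

Lemma norm_Ex_le F : L1 P F -> `|Ex P F| <= Ex P (fun w => `|F w|).
Proof. by move=> iF; rewrite Ex.unlock; exact: le_normr_Rintegral. Qed.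

Lemma norm_Ex_le_dom F G : measurable_fun setT F -> L1 P G ->
  (forall w, `|F w| <= G w) -> `|Ex P F| <= Ex P G.
Proof.
move=> mF iG FG; have iF := L1_le mF FG iG.
by apply: (le_trans (norm_Ex_le iF)); apply: Ex_le => //; exact: L1_norm.
Qed.

Lemma Ex_integral F : L1 P F -> (\int[P]_w (F w)%:E = (Ex P F)%:E)%E.
Proof. by move=> iF; rewrite Ex.unlock /Rintegral fineK// integrable_fin_num. Qed.

Lemma L1_ge0 F : measurable_fun setT F -> (forall w, 0 <= F w) ->
  (\int[P]_w (F w)%:E < +oo)%E -> L1 P F.
Proof.
move=> mF F0 Foo; apply/integrableP; split; first exact/measurable_EFinP.
by under eq_integral do rewrite /= ger0_norm//.
Qed.

Lemma Ex_dominated_cvg (F : nat -> T -> R) (F0 G : T -> R) :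
  (forall n, measurable_fun setT (F n)) -> L1 P F0 -> L1 P G ->
  (forall n w, `|F n w| <= G w) -> (forall w, F n w @[n --> \oo] --> F0 w) ->
  Ex P (F n) @[n --> \oo] --> Ex P F0.
Proof.
move=> mF iF0 iG FG FF0.
have iF n : L1 P (F n) by exact: L1_le (mF n) (FG n) iG.
have [|//| | | |_ _] := @dominated_convergence _ T R P setT measurableT
    (fun n => EFin \o F n) (EFin \o F0) (EFin \o G).
- by move=> n; exact/measurable_EFinP.
- exact: measurable_int iF0.
- by apply: aeW => w _; apply: cvg_EFin; [exact: nearW|exact: FF0].
- exact: iG.
- by apply: aeW => w n _; rewrite /= lee_fin.
rewrite -[X in _ --> X -> _](@fineK _ (\int[P]_x (EFin \o F0) x)%E); last first.
  exact: integrable_fin_num.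
by rewrite Ex.unlock; move/fine_cvgP => [_].
Qed.

End Expectation.

Section Law.
Context d d' (T : measurableType d) (T' : measurableType d') (R : realType).
Context (P : probability T R) (F : T -> T') (mF : measurable_fun setT F).

Lemma L1_law (h : T' -> R) : measurable_fun setT h ->
  L1 P (h \o F) -> L1 (law P mF) h.
Proof.
move=> mh ih; apply: (@integrable_pushforward _ _ _ _ _ F mF) => //.
exact/measurable_EFinP.
Qed.

Lemma L1_lawP (h : T' -> R) : measurable_fun setT h ->
  L1 (law P mF) h -> L1 P (h \o F).
Proof.
move=> mh /integrableP[_ ih]; apply/integrableP; split.
  by apply/measurable_EFinP; exact: measurableT_comp.
move: ih; rewrite /law ge0_integral_distribution//.
by apply/measurableT_comp => //; exact/measurable_EFinP.
Qed.

Lemma Ex_law (h : T' -> R) : measurable_fun setT h ->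
  L1 P (h \o F) -> Ex (law P mF) h = Ex P (h \o F).
Proof.
move=> mh ih; rewrite Ex.unlock /Rintegral; congr fine.
by apply: integral_distribution => //; exact/measurable_EFinP.
Qed.

End Law.
Arguments L1_law {d d' T T' R P F} mF {h}.
Arguments L1_lawP {d d' T T' R P F} mF {h}.
Arguments Ex_law {d d' T T' R P F} mF {h}.

Lemma eq_Ex_measure d (T : measurableType d) (R : realType)
    (P Q : probability T R) (h : T -> R) :
  (forall A, measurable A -> P A = Q A) -> Ex P h = Ex Q h.
Proof.
by move=> PQ; rewrite Ex.unlock /Rintegral; congr fine; apply: eq_measure_integral => A mA _; exact: PQ.
Qed.

Lemma eq_L1_measure d (T : measurableType d) (R : realType)
    (P Q : probability T R) (h : T -> R) :
  (forall A, measurable A -> P A = Q A) -> L1 P h -> L1 Q h.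
Proof.
move=> PQ /integrableP[mh ih]; apply/integrableP; split => //.
by rewrite -(@eq_measure_integral _ _ _ setT Q P)// => A mA _; exact: PQ.
Qed.

(** * Expectation of a product of two independent variables *)

Section IndependentProduct.
Context d (T : measurableType d) (R : realType) (P : probability T R).
Context (F G : T -> R) (mF : measurable_fun setT F) (mG : measurable_fun setT G).
Hypothesis indep : forall A B : set R, measurable A -> measurable B ->
  P (F @^-1` A `&` G @^-1` B) = (P (F @^-1` A) * P (G @^-1` B))%E.

Let mFG : measurable_fun setT (fun w => (F w, G w)).
Proof. exact: measurable_fun_pair. Qed.

Let lawE (A : set (R * R)) : measurable A ->
  (law P mF \x law P mG)%E A = law P mFG A.
Proof.
by move=> mA; apply: product_measure_unique => // B C mB mC; exact: esym (indep mB mC).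
Qed.

(** Independence on rectangles identifies the joint law with the product of the marginals, and
    Tonelli's theorem then factors the integral of [|x * y|]. *)
Lemma indep_mul_L1 : L1 P F -> L1 P G -> L1 P (fun w => F w * G w).
Proof.
move=> iF iG; have mM : measurable_fun setT (fun z : R * R => z.1 * z.2).
  by apply: measurable_funM; [exact: measurable_fst|exact: measurable_snd].
suff: L1 (law P mFG) (fun z : R * R => z.1 * z.2) by move/(L1_lawP mFG mM).
apply: (eq_L1_measure lawE).
apply/integrable12ltyP; first exact/measurable_EFinP.
have mabs : measurable_fun setT (fun y : R => `|y|%:E).
  by apply/measurable_EFinP; exact: normr_measurable.
have E1 (x : R) : (\int[law P mG]_y `|(x * y)%:E| =
    `|x|%:E * \int[law P mG]_y `|y|%:E)%E.
  rewrite -ge0_integralZl//.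
  by apply: eq_integral => y _; rewrite /= normrM EFinM.
under eq_integral => x _ do rewrite /= E1.
rewrite /= ge0_integralZr//=; last exact: integral_ge0.
have fin (H : T -> R) (mH : measurable_fun setT H) : L1 P H ->
    (\int[law P mH]_x `|x|%:E < +oo)%E.
  move=> /integrableP[_]; by rewrite /law ge0_integral_distribution.
rewrite lte_mul_pinfty ?fin//; last by rewrite ge0_fin_numE ?fin// integral_ge0.
exact: integral_ge0.
Qed.

Lemma indep_mul_Ex : L1 P F -> L1 P G ->
  Ex P (fun w => F w * G w) = Ex P F * Ex P G.
Proof.
move=> iF iG; have iFG := indep_mul_L1 iF iG.
have mM : measurable_fun setT (fun z : R * R => z.1 * z.2).
  by apply: measurable_funM; [exact: measurable_fst|exact: measurable_snd].
rewrite -[LHS](Ex_law mFG mM)//.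
have iM := L1_law mFG mM iFG.
have iM' : ((law P mF \x law P mG)%E).-integrable setT (EFin \o (fun z : R * R => z.1 * z.2)).
  apply: (eq_L1_measure (fun A mA => esym (lawE mA))); exact: iM.
have E : (\int[law P mFG]_z (z.1 * z.2)%:E =
    \int[law P mF \x law P mG]_z (z.1 * z.2)%:E)%E.
  by apply: eq_measure_integral => A mA _; exact/esym/lawE.
rewrite [in LHS]Ex.unlock /Rintegral E.
rewrite -integral12_prod_meas1//= /fubini_F/=.
have mid : measurable_fun setT (@id R) by exact: measurable_id.
under eq_integral => x _.
  under eq_integral => y _ do rewrite EFinM.
  rewrite integralZl//; last exact: (L1_law mG mid iG).
  rewrite (Ex_integral (L1_law mG mid iG)) -EFinM mulrC EFinM.
  over.
rewrite integralZl//; last exact: (L1_law mF mid iF).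
rewrite (Ex_integral (L1_law mF mid iF)) -EFinM/= mulrC.
by rewrite !Ex_law.
Qed.

End IndependentProduct.

(** * Independence of functions of disjoint sets of variables *)

Section IndependentSigmaAlgebras.
Context d (T : measurableType d) (R : realType) (P : probability T R).

Lemma sub_measurable (G : set (set T)) : G `<=` measurable ->
  <<s G >> `<=` measurable.
Proof. by move=> GM; apply: smallest_sub => //; exact: sigma_algebra_measurable. Qed.

(** Dynkin's theorem: the events independent of a fixed [A] are closed under complement and
    countable disjoint union. *)
Lemma indep_pi_lambda (G : set (set T)) (A : set T) : measurable A ->
  setI_closed G -> G `<=` measurable ->
  (forall S, G S -> P (A `&` S) = (P A * P S)%E) ->
  forall S, <<s G >> S -> P (A `&` S) = (P A * P S)%E.
Proof.
move=> mA GI GM GA.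
have sGM := sub_measurable GM.
have fA : P A \is a fin_num by exact: fin_num_measure.
have compl (S : set T) : measurable S -> P (A `&` S) = (P A * P S)%E ->
    P (A `&` ~` S) = (P A * P (~` S))%E.
  move=> mS AS.
  have -> : P (A `&` ~` S) = (P A - P (A `&` S))%E.
    by rewrite -setDE measureD// ltey_eq fA.
  rewrite AS probability_setC//.
  have fS : P S \is a fin_num by exact: fin_num_measure.
  by rewrite muleBr ?mule1// fin_num_adde_defl// fin_numN.
have cup (F : (set T)^nat) : (forall n, measurable (F n)) -> trivIset setT F ->
    (forall n, P (A `&` F n) = (P A * P (F n))%E) ->
    P (A `&` \bigcup_k F k) = (P A * P (\bigcup_k F k))%E.
  move=> mF tF AF; rewrite setI_bigcupr !measure_bigcup//.
  - by rewrite -[P A]fineK// -nneseriesZl//; apply: eq_eseriesr => n _; rewrite fineK//; exact: AF.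
  - by move=> n _; exact: measurableI.
  - exact: trivIset_setIl.
apply: (@dynkin_induction _ (g_sigma_algebraType G) G
    (fun S => P (A `&` S) = (P A * P S)%E) erefl GI) => //.
- by rewrite setIT probability_setT mule1.
- by move=> S /sGM mS AS; exact: compl.
- by move=> F mF; apply: cup => n; exact: sGM (mF n).
Qed.

Section Family.
Context (I : choiceType) (Z : I -> {RV P >-> R}).

Definition cylinders (J : set I) : set (set T) :=
  [set C | exists s : seq I, exists B : I -> set R,
     [/\ uniq s, {in s, forall i, J i}, forall i, measurable (B i) &
         C = \bigcap_(i in [set` s]) (Z i @^-1` B i)]].

(** Records on which variables [F] depends. With disjoint index sets it separates past from present
    without conditional expectations. *)
Definition meas_on (J : set I) (F : T -> R) :=
  @measurable_fun _ _ (g_sigma_algebraType (cylinders J)) R setT F.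

Let measurable_preim i (B : set R) : measurable B -> measurable (Z i @^-1` B).
Proof. by move=> mB; rewrite -[X in measurable X]setTI; exact: measurable_funP. Qed.

Lemma cylinders_measurable J : cylinders J `<=` measurable.
Proof.
move=> _ [s [B [_ _ mB ->]]]; rewrite bigcap_seq.
by apply: bigsetI_measurable => i _; exact: measurable_preim.
Qed.

Lemma cylinders_setI J : setI_closed (cylinders J).
Proof.
move=> _ _ [s1 [B1 [u1 J1 m1 ->]]] [s2 [B2 [u2 J2 m2 ->]]].
exists (undup (s1 ++ s2)).
exists (fun i => (if i \in s1 then B1 i else setT) `&` (if i \in s2 then B2 i else setT)).
split; first exact: undup_uniq.
- by move=> i; rewrite mem_undup mem_cat => /orP[/J1|/J2].
- by move=> i; apply: measurableI; case: ifP.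
apply/seteqP; split => [w [h1 h2] i|w h].
  rewrite /= mem_undup mem_cat => _; split; case: ifP => // hi.
  - exact: h1.
  - exact: h2.
split => i /= si.
- by have := h i; rewrite /= mem_undup mem_cat si => /(_ isT) [].
- by have := h i; rewrite /= mem_undup mem_cat si orbT => /(_ isT) [].
Qed.

Lemma meas_on_measurable J F : meas_on J F -> measurable_fun setT F.
Proof.
move=> mF _ B mB; have := mF measurableT B mB.
by apply: sub_measurable; exact: cylinders_measurable.
Qed.

Lemma meas_on_sub (J K : set I) F : J `<=` K -> meas_on J F -> meas_on K F.
Proof.
move=> JK mF _ B mB; have := mF measurableT B mB.
apply: sub_sigma_algebra2 => C [s [D [us Js mD ->]]].
by exists s, D; split => // i /Js /JK.
Qed.

Lemma meas_on_coord (J : set I) i : J i -> meas_on J (Z i).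
Proof.
move=> Ji _ B mB; rewrite setTI; apply: sub_sigma_algebra.
exists [:: i], (fun=> B); split => //; first by move=> k; rewrite inE => /eqP ->.
by rewrite bigcap_seq big_seq1.
Qed.

Hypothesis Zindep : mutually_independent Z.

Lemma cylinders_indep (J K : set I) (A B : set T) : J `&` K = set0 ->
  cylinders J A -> cylinders K B -> P (A `&` B) = (P A * P B)%E.
Proof.
move=> JK [s1 [B1 [u1 J1 m1 ->]]] [s2 [B2 [u2 K2 m2 ->]]].
have dis i : i \in s2 -> i \notin s1.
  move=> i2; apply/negP => i1.
  by have : (J `&` K) i := conj (J1 _ i1) (K2 _ i2); rewrite JK.
pose D i := if i \in s1 then B1 i else B2 i.
have mD i : measurable (D i) by rewrite /D; case: ifP.
have us : uniq (s1 ++ s2).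
  by rewrite cat_uniq u1 u2 andbT /= -all_predC; apply/allP => i /dis.
transitivity (P (\bigcap_(i in [set` s1 ++ s2]) (Z i @^-1` D i))).
  congr (P _); apply/seteqP; split => [w [h1 h2] i /=|w h].
    rewrite mem_cat /D; case: ifP => [i1 _|_ /= i2]; [exact: h1|exact: h2].
  split => i /= si; have := h i; rewrite /= mem_cat si ?orbT /D => /(_ isT) //.
    by rewrite si.
  by rewrite (negbTE (dis _ si)).
rewrite Zindep// big_cat/= !Zindep//.
congr (_ * _)%E; rewrite big_seq [RHS]big_seq; apply: eq_bigr => i si.
  by rewrite /D si.
by rewrite /D (negbTE (dis _ si)).
Qed.

(** The pi-lambda argument is used twice, freeing one event at a time from the pi-system of
    cylinders. *)
Lemma sigma_indep (J K : set I) (A B : set T) : J `&` K = set0 ->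
  <<s cylinders J >> A -> <<s cylinders K >> B -> P (A `&` B) = (P A * P B)%E.
Proof.
move=> JK sA; move: B; apply: indep_pi_lambda.
- by apply: sub_measurable sA; exact: cylinders_measurable.
- exact: cylinders_setI.
- exact: cylinders_measurable.
move=> S KS; rewrite setIC muleC; move: A sA; apply: indep_pi_lambda.
- exact: cylinders_measurable KS.
- exact: cylinders_setI.
- exact: cylinders_measurable.
by move=> C JC; rewrite setIC muleC; exact: cylinders_indep JC KS.
Qed.

Section Products.
Context (J K : set I) (F G : T -> R).
Hypotheses (JK : J `&` K = set0) (mF : meas_on J F) (mG : meas_on K G).

Let indep_preimages (A B : set R) : measurable A -> measurable B ->
  P (F @^-1` A `&` G @^-1` B) = (P (F @^-1` A) * P (G @^-1` B))%E.
Proof.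
move=> mA mB; apply: (sigma_indep JK).
- by have := mF measurableT mA; rewrite setTI.
- by have := mG measurableT mB; rewrite setTI.
Qed.

Lemma meas_on_mul_L1 : L1 P F -> L1 P G -> L1 P (fun w => F w * G w).
Proof.
apply: indep_mul_L1 => //; [exact: meas_on_measurable mF|exact: meas_on_measurable mG].
Qed.

Lemma meas_on_mul_Ex : L1 P F -> L1 P G ->
  Ex P (fun w => F w * G w) = Ex P F * Ex P G.
Proof.
apply: indep_mul_Ex => //; [exact: meas_on_measurable mF|exact: meas_on_measurable mG].
Qed.

End Products.
End Family.

Section SumFamily.
Context (I J : choiceType) (X : I -> {RV P >-> R}) (Y : J -> {RV P >-> R}).

(** Design and noise become one independent family, so that a single notion of dependence covers
    both. *)
Definition sum_family (k : I + J) : {RV P >-> R} :=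
  match k with inl i => X i | inr j => Y j end.

Lemma split_sum_seq (s : seq (I + J)) :
  exists s1 s2, perm_eq s (map inl s1 ++ map inr s2).
Proof.
elim: s => [|[i|j] s [s1 [s2 ss]]]; first by exists [::], [::].
- by exists (i :: s1), s2; rewrite /= perm_cons.
- exists s1, (j :: s2) => /=; rewrite perm_sym perm_catC /= perm_cons perm_catC perm_sym.
  exact: ss.
Qed.

(** A finite list of indices splits into two blocks. Independence of the families separates the
    blocks, and mutual independence factors each of them. *)
Lemma sum_family_indep : mutually_independent X -> mutually_independent Y ->
  independent_families X Y -> mutually_independent sum_family.
Proof.
move=> iX iY iXY s B us mB.
have [s1 [s2 ss]] := split_sum_seq s.
have := us; rewrite (perm_uniq ss) cat_uniq => /and3P[us1 _ us2].
rewrite (perm_big _ ss)/= big_cat/= !big_map.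
have u1 : uniq s1 by exact: map_uniq us1.
have u2 : uniq s2 by exact: map_uniq us2.
rewrite -(iX s1 (fun i => B (inl i)))// -(iY s2 (fun j => B (inr j)))//.
have -> : \bigcap_(i in [set` s]) (sum_family i @^-1` B i) =
    (\bigcap_(i in [set` s1]) (X i @^-1` B (inl i))) `&`
    (\bigcap_(j in [set` s2]) (Y j @^-1` B (inr j))).
  apply/seteqP; split => [w h|w [h1 h2] [i|j]].
  - split => k /= sk.
      by apply: (h (inl k)); rewrite /= (perm_mem ss) mem_cat map_f.
    by apply: (h (inr k)); rewrite /= (perm_mem ss) mem_cat map_f// orbT.
  - rewrite /= (perm_mem ss) mem_cat => /orP[/mapP[k sk [->]]|/mapP[k _ //]].
    exact: h1.
  - rewrite /= (perm_mem ss) mem_cat => /orP[/mapP[k _ //]|/mapP[k sk [->]]].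
    exact: h2.
have gen (K : choiceType) (Z : K -> {RV P >-> R}) (t : seq K) (D : K -> set R) :
    (forall k, measurable (D k)) ->
    sigma_generated Z (\bigcap_(i in [set` t]) (Z i @^-1` D i)).
  move=> mD; rewrite bigcap_seq.
  pose G := \bigcup_(i in [set: K]) preimage_set_system setT (Z i) measurable.
  elim: t => [|k t IH].
    by rewrite big_nil; exact: (@measurableT _ (g_sigma_algebraType G)).
  rewrite big_cons; apply: (@measurableI _ (g_sigma_algebraType G)) => //.
  apply: sub_sigma_algebra; exists k => //=; exists (D k); first exact: mD.
  by rewrite setTI.
by apply: iXY; exact: gen.
Qed.

End SumFamily.
End IndependentSigmaAlgebras.

(** * Affine change of variable for Lebesgue measure *)

Section AffineChange.
Context {R : realType}.
Local Notation leb := (@lebesgue_measure R).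

Lemma measurable_affine (a b : R) : measurable_fun setT (fun x : R => a * x + b).
Proof. by apply: measurable_funD => //; exact: measurable_funM. Qed.

(** By uniqueness of Lebesgue measure it is enough to compare half-open intervals; the sign of [a]
    decides which end is open in the preimage. *)
Lemma lebesgue_measure_affine (a b : R) (A : set R) : a != 0 -> measurable A ->
  leb A = (`|a|%:E * leb [set x | A (a * x + b)%R])%E.
Proof.
move=> a0 mA.
pose phi := fun x : measurableTypeR R => a * x + b : measurableTypeR R.
have mphi : measurable_fun setT phi by exact: measurable_affine.
pose k : {nonneg R} := NngNum (normr_ge0 a).
transitivity (pushforward (mscale k leb) phi A); last by [].
apply: lebesgue_measure_unique => // _ [[c e]] _ <-.
transitivity (`|a|%:E * leb (phi @^-1` `]c, e]))%E; last by [].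
rewrite lebesgue_measure_itv/= lte_fin.
have [a_gt0|a_lt0|/eqP] := ltgtP 0 a; last by rewrite eq_sym (negbTE a0).
- rewrite (_ : phi @^-1` _ = `](c - b) / a, (e - b) / a]%classic); last first.
    apply/seteqP; split => x; rewrite /phi /preimage/= !in_itv/= ltr_pdivrMr// ler_pdivlMr// (mulrC x);
    by rewrite ltrBlDr lerBrDr.
  rewrite lebesgue_measure_itv/= lte_fin ltr_pM2r ?invr_gt0// ltrD2r.
  case: ifP => ce; last by rewrite mule0.
  by rewrite -!EFinD -EFinM gtr0_norm//; congr (_%:E); field; rewrite gt_eqF.
- rewrite (_ : phi @^-1` _ = `[(e - b) / a, (c - b) / a[%classic); last first.
    apply/seteqP; split => x; rewrite /phi /preimage/= !in_itv/= ltr_ndivlMr// ler_ndivrMr// (mulrC x) andbC;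
    by rewrite ltrBlDr lerBrDr.
  rewrite lebesgue_measure_itv/= lte_fin ltr_nM2r ?invr_lt0// ltrD2r.
  case: ifP => ce; last by rewrite mule0.
  by rewrite -!EFinD -EFinM ltr0_norm//; congr (_%:E); field; rewrite lt_eqF.
Qed.

Lemma ge0_integral_affine (a b : R) (h : R -> \bar R) : a != 0 ->
  measurable_fun setT h -> (forall x, 0 <= h x)%E ->
  (\int[leb]_x h x = `|a|%:E * \int[leb]_x h (a * x + b)%R)%E.
Proof.
move=> a0 mh h0.
pose phi := fun x : measurableTypeR R => a * x + b : measurableTypeR R.
have mphi : measurable_fun setT phi by exact: measurable_affine.
pose k : {nonneg R} := NngNum (normr_ge0 a).
transitivity (\int[pushforward (mscale k leb) phi]_x h x)%E.
  apply: eq_measure_integral => A mA _; exact: lebesgue_measure_affine.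
rewrite ge0_integral_pushforward// preimage_setT ge0_integral_mscale//.
- exact: measurableT_comp.
- by move=> x _; exact: h0.
Qed.

End AffineChange.

(** * Integration against a measure with a density *)

Section Density.
Context d (T : measurableType d) {R : realType}.
Local Notation leb := (@lebesgue_measure R).
Context (m mu : {sigma_finite_measure set T -> \bar R}) (g : T -> R).
Hypotheses (mg : measurable_fun setT g) (g0 : forall x, 0 <= g x).
Hypothesis muE : forall A, measurable A -> mu A = (\int[m]_(x in A) (g x)%:E)%E.

(* Layer-cake formula: both sides are the integral over [t] of the measure of
   [{h > t}]. *)
Lemma ge0_integral_density (h : T -> R) : measurable_fun setT h ->
  (forall x, 0 <= h x) ->
  (\int[mu]_x (h x)%:E = \int[m]_x (h x * g x)%:E)%E.
Proof.
move=> mh h0.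
pose A : set (T * R) := [set z | 0 <= z.2 /\ 0 < h z.1 - z.2].
have mA : measurable A.
  have mA1 : measurable_fun setT (fun z : T * R => z.2) by exact: measurable_snd.
  have mA2 : measurable_fun setT (fun z : T * R => h z.1 - z.2).
    by apply: measurable_funB => //; exact: measurableT_comp.
  have -> : A = (fun z : T * R => z.2) @^-1` `[0, +oo[ `&`
      (fun z : T * R => h z.1 - z.2) @^-1` `]0, +oo[.
    by apply/seteqP; split => z; rewrite /A /preimage/= !in_itv/= !andbT.
  apply: measurableI.
  - by rewrite -[X in measurable X]setTI; exact: mA1.
  - by rewrite -[X in measurable X]setTI; exact: mA2.
have mI : measurable_fun setT (\1_A : T * R -> R) by exact: measurable_indic.
have inner x : (\int[leb]_t (\1_A (x, t))%:E = (h x)%:E)%E.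
  transitivity (\int[leb]_t (\1_(`[0, (h x)[%classic : set R) t)%:E)%E.
    apply: eq_integral => t _; rewrite !indicE.
    have -> // : ((x, t) \in A) = (t \in `[0, (h x)[%classic).
    apply/idP/idP; rewrite !inE /A/= in_itv/= subr_gt0; first by move=> [-> ->].
    by move=> /andP[-> ->].
  rewrite integral_indic// setIT.
  transitivity (leb `[0, h x[%classic); first by [].
  rewrite lebesgue_measure_itv/= lte_fin.
  case: ifP => [_|]; first by rewrite oppr0 adde0.
  by have := h0 x; rewrite le_eqVlt => /orP[/eqP <-|->].
have mIE : measurable_fun setT (fun z : T * R => (\1_A z : R)%:E).
  exact: (proj2 (measurable_EFinP _ _) mI).
have mIg : measurable_fun setT (fun z : T * R => (g z.1 * \1_A z)%:E).
  by apply/measurable_EFinP/measurable_funM => //; exact: measurableT_comp.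
have I0 (z : T * R) : (0 <= (\1_A z : R)%:E)%E by rewrite lee_fin.
have Ig0 (z : T * R) : (0 <= (g z.1 * \1_A z)%:E)%E by rewrite lee_fin mulr_ge0.
transitivity (\int[mu]_x \int[leb]_t (\1_A (x, t))%:E)%E.
  by apply: eq_integral => x _; rewrite inner.
rewrite (@fubini_tonelli _ _ _ _ _ mu leb _ mIE I0).
transitivity (\int[m]_x \int[leb]_t (g x * \1_A (x, t))%:E)%E; last first.
  apply: eq_integral => x _.
  under eq_integral do rewrite EFinM.
  rewrite ge0_integralZl//; first by rewrite inner -EFinM mulrC.
  - by apply/measurable_EFinP; apply: measurableT_comp => //; exact: measurable_pair1.
  - by rewrite lee_fin.
rewrite (@fubini_tonelli _ _ _ _ _ m leb _ mIg Ig0).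
apply: eq_integral => t _ /=.
have mS : measurable [set x | A (x, t)].
  have := measurable_ysection t mA; congr measurable.
  by apply/seteqP; split => x; rewrite /ysection/= inE.
transitivity (mu [set x | A (x, t)]).
  transitivity (\int[mu]_x (\1_[set x | A (x, t)] x)%:E)%E.
    by apply: eq_integral => x _; rewrite !indicE; have -> // : ((x, t) \in A) = (x \in [set x | A (x, t)]); apply/idP/idP; rewrite !inE.
  by rewrite integral_indic// setIT.
rewrite muE// integral_mkcond; apply: eq_integral => x _.
rewrite /patch indicE; case: ifPn => [|]; rewrite ?inE ?notin_setE => xA.
  by rewrite mem_set// mulr1.
by rewrite memNset// mulr0.
Qed.

End Density.

(** * Scaling and convolution of centered normal laws *)

Section GaussianConvolution.
Context {R : realType}.
Local Notation leb := (@lebesgue_measure R).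

Let id_meas : measurable_fun setT (id : measurableTypeR R -> R).
Proof. by []. Qed.

(* [normal_prob] lives on [measurableTypeR R], an alias of [R] carrying another
   instance of the Borel measurable structure. *)
Definition gauss (s : R) : probability R R :=
  law (normal_prob 0 s : probability (measurableTypeR R) R) id_meas.

Lemma gaussE (s : R) (B : set R) : gauss s B = (\int[leb]_(x in B) (normal_pdf 0 s x)%:E)%E.
Proof. by []. Qed.

Lemma gauss_prob (s : R) (B : set R) : gauss s B = normal_prob 0 s B.
Proof. by []. Qed.

Lemma ge0_integral_gauss (s : R) (h : R -> R) : measurable_fun setT h ->
  (forall x, 0 <= h x) ->
  (\int[gauss s]_x (h x)%:E = \int[leb]_x (h x * normal_pdf 0 s x)%:E)%E.
Proof.
move=> mh h0; rewrite /gauss /law ge0_integral_distribution; last 2 first.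
- exact/measurable_EFinP.
- by move=> y; rewrite lee_fin.
apply: (@ge0_integral_density _ (measurableTypeR R) R leb
  (normal_prob 0 s : probability (measurableTypeR R) R) _ _ _ _ h).
- exact: measurable_normal_pdf.
- exact: normal_pdf_ge0.
- by [].
- exact: mh.
- exact: h0.
Qed.

Lemma normal_peakE (s : R) : 0 < s ->
  normal_peak s = s^-1 * (Num.sqrt (pi *+ 2))^-1.
Proof.
move=> s0; rewrite /normal_peak -mulrnAr sqrtrM ?sqr_ge0//.
by rewrite sqrtr_sqr gtr0_norm// invfM.
Qed.

Lemma normal_peak_norm (c : R) : c != 0 -> `|c| * normal_peak `|c| = normal_peak 1.
Proof.
move=> c0; rewrite !normal_peakE ?normr_gt0//.
by rewrite mulrA divff ?normr_eq0// invr1.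
Qed.

Lemma normal_pdf_scale (y c z : R) : c != 0 ->
  `|c| * normal_pdf y `|c| (c * z + y) = normal_pdf 0 1 z.
Proof.
move=> c0; rewrite !normal_pdfE ?oner_eq0 ?normr_eq0// mulrA normal_peak_norm//.
rewrite /normal_fun; congr (_ * expR _).
rewrite real_normK ?num_real// addrK subr0 expr1n.
by field; rewrite c0.
Qed.

Lemma gauss1_affine (y c : R) (B : set R) : c != 0 -> measurable B ->
  gauss 1 [set z | B (c * z + y)] = normal_prob y `|c| B.
Proof.
move=> c0 mB; rewrite gaussE /normal_prob.
rewrite [LHS]integral_mkcond [RHS]integral_mkcond.
rewrite [RHS](ge0_integral_affine y c0); last 2 first.
- apply/(measurable_restrictT _ mB); apply/measurable_funTS/measurable_EFinP.
  exact: measurable_normal_pdf.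
- by move=> x; rewrite /patch; case: ifP => // _; rewrite lee_fin normal_pdf_ge0.
rewrite -ge0_integralZl//; last 2 first.
- apply: (@measurableT_comp _ _ _ _ _ _ _ _ (fun x : R => c * x + y)).
    apply/(measurable_restrictT _ mB); apply/measurable_funTS/measurable_EFinP.
    exact: measurable_normal_pdf.
  exact: measurable_affine.
- by move=> x _; rewrite /patch; case: ifP => // _; rewrite lee_fin normal_pdf_ge0.
apply: eq_integral => z _; rewrite /patch.
have -> : (z \in [set z | B (c * z + y)]) = (c * z + y \in B).
  by apply/idP/idP; rewrite !inE.
by case: ifP => _; rewrite ?mule0// -EFinM normal_pdf_scale.
Qed.

(** Completing the square in [y]: the joint density is the marginal of [u] times the conditional
    density of [y] given [u], which is normal with mean [s ^+ 2 / r2 * u]. *)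
Lemma normal_pdf_mul (s c y u : R) : 0 < s -> 0 < c ->
  let r2 := s ^+ 2 + c ^+ 2 in
  normal_pdf 0 s y * normal_pdf y c u =
  normal_pdf 0 (Num.sqrt r2) u *
    normal_pdf (s ^+ 2 / r2 * u) (s * c / Num.sqrt r2) y.
Proof.
move=> s0 c0 r2.
have r20 : 0 < r2 by rewrite addr_gt0 ?exprn_gt0.
have r0 : 0 < Num.sqrt r2 by rewrite sqrtr_gt0.
have rr : Num.sqrt r2 ^+ 2 = r2 by rewrite sqr_sqrtr// ltW.
have t0 : 0 < s * c / Num.sqrt r2 by rewrite divr_gt0 ?mulr_gt0.
rewrite !normal_pdfE ?gt_eqF// !mulrA.
have peaks : normal_peak s * normal_peak c =
    normal_peak (Num.sqrt r2) * normal_peak (s * c / Num.sqrt r2) :> R.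
  rewrite !normal_peakE//; set k := (Num.sqrt (pi *+ 2))^-1.
  by field; rewrite !gt_eqF.
have funs : normal_fun 0 s y * normal_fun y c u =
    normal_fun 0 (Num.sqrt r2) u *
    normal_fun (s ^+ 2 / r2 * u) (s * c / Num.sqrt r2) y.
  rewrite /normal_fun -!expRD; congr expR.
  rewrite expr_div_n rr /r2; field.
  by rewrite !gt_eqF//.
transitivity ((normal_peak s * normal_peak c) * (normal_fun 0 s y * normal_fun y c u)).
  by ring.
by rewrite peaks funs; ring.
Qed.

Lemma measurable_gauss1_affine (c : R) (B : set R) : measurable B ->
  measurable_fun setT (fun y : R => gauss 1 [set z | B (c * z + y)]).
Proof.
move=> mB.
have mA : measurable [set w : R * R | B (c * w.2 + w.1)].
  rewrite -[X in measurable X]setTI.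
  have : measurable_fun setT (fun w : R * R => c * w.2 + w.1).
    apply: measurable_funD; last exact: measurable_fst.
    by apply: measurable_funM => //; exact: measurable_snd.
  exact.
have := @measurable_fun_xsection _ _ _ _ _ (gauss 1) _ mA.
congr (measurable_fun _ _); apply/funext => y /=; congr (gauss 1 _).
by apply/seteqP; split => z; rewrite /xsection/= inE.
Qed.

(** After exchanging the integrals, [normal_pdf_mul] isolates the density of the sum, and the
    conditional density integrates to 1. *)
Lemma gauss_conv (s c : R) (B : set R) : 0 < s -> c != 0 -> measurable B ->
  (\int[gauss s]_y gauss 1 [set z | B (c * z + y)%R] =
   gauss (Num.sqrt (s ^+ 2 + c ^+ 2)) B)%E.
Proof.
move=> s0 c0 mB.
have nc0 : 0 < `|c| by rewrite normr_gt0.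
pose h (y : R) := fine (gauss 1 [set z | B (c * z + y)]).
have mBy (y : R) : measurable [set z | B (c * z + y)].
  rewrite -[X in measurable X]setTI; exact: (measurable_affine c y measurableT mB).
have hE (y : R) : gauss 1 [set z | B (c * z + y)] = (h y)%:E.
  rewrite /h fineK//; apply: fin_num_measure; exact: mBy.
have mh : measurable_fun setT h.
  apply: (@measurableT_comp _ _ _ _ _ _ fine) => //.
  exact: measurable_gauss1_affine.
have h0 y : 0 <= h y by rewrite /h fine_ge0.
transitivity (\int[gauss s]_y (h y)%:E)%E.
  by apply: eq_integral => y _; rewrite hE.
rewrite ge0_integral_gauss//.
pose k (y u : R) := \1_B u * (normal_pdf 0 s y * normal_pdf y `|c| u).
have k0 y u : 0 <= k y u by rewrite /k !mulr_ge0 ?normal_pdf_ge0.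
have mIB : measurable_fun setT (\1_B : R -> R) by exact: measurable_indic.
have mk : measurable_fun setT (fun w : R * R => (k w.1 w.2)%:E).
  apply/measurable_EFinP; rewrite /k; apply: measurable_funM.
    by apply: measurableT_comp => //; exact: measurable_snd.
  apply: measurable_funM.
    apply: (@measurableT_comp _ _ _ _ _ _ (normal_pdf 0 s)); last exact: measurable_fst.
    exact: measurable_normal_pdf.
  rewrite (_ : (fun w : R * R => normal_pdf w.1 `|c| w.2) =
      (fun w => normal_pdf 0 `|c| (w.2 - w.1))); last first.
    apply/funext => w; rewrite !normal_pdfE ?gt_eqF//.
    by rewrite /normal_fun subr0.
  apply: (@measurableT_comp _ _ _ _ _ _ (normal_pdf 0 `|c|)).
    exact: measurable_normal_pdf.
  by apply: measurable_funB; [exact: measurable_snd|exact: measurable_fst].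
transitivity (\int[leb]_y \int[leb]_u (k y u)%:E)%E.
  apply: eq_integral => y _.
  have -> : h y = fine (normal_prob y `|c| B) by rewrite /h gauss1_affine.
  rewrite EFinM fineK; last by apply: fin_num_measure.
  rewrite /normal_prob integral_mkcond muleC -ge0_integralZl//.
  - apply: eq_integral => u _; rewrite /patch /k indicE.
    by case: ifP => _; rewrite ?mul0r ?mule0// mul1r EFinM.
  - apply/(measurable_restrictT _ mB); apply/measurable_funTS/measurable_EFinP.
    exact: measurable_normal_pdf.
  - by move=> u _; rewrite /patch; case: ifP => // _; rewrite lee_fin normal_pdf_ge0.
  - by rewrite lee_fin normal_pdf_ge0.
rewrite (@fubini_tonelli _ _ _ _ _ leb leb (fun w : R * R => (k w.1 w.2)%:E)) //=.
rewrite gaussE [RHS]integral_mkcond; apply: eq_integral => u _.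
rewrite /patch /k indicE; case: ifP => _; last first.
  by apply: integral0_eq => y _; rewrite mul0r.
under eq_integral do rewrite mul1r normal_pdf_mul// EFinM.
rewrite real_normK ?num_real// ge0_integralZl//.
- by rewrite integral_normal_pdf mule1.
- by apply/measurable_EFinP; exact: measurable_normal_pdf.
- by move=> y _; rewrite lee_fin normal_pdf_ge0.
- by rewrite lee_fin normal_pdf_ge0.
- by move=> w; rewrite lee_fin k0.
Qed.

End GaussianConvolution.

#[global] Opaque gauss.

(** * Expectations under a product of two probabilities *)

Section ProductProbability.
Context d1 d2 (T1 : measurableType d1) (T2 : measurableType d2) (R : realType).
Context (P1 : probability T1 R) (P2 : probability T2 R).

Definition prodP : probability (T1 * T2)%type R := (P1 \x P2)%E.

Lemma prodPE (A : set T1) (B : set T2) : measurable A -> measurable B ->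
  prodP (A `*` B) = (P1 A * P2 B)%E.
Proof. by move=> mA mB; rewrite -product_measure1E. Qed.

Let law_fst (A : set T1) : measurable A -> P1 A = law prodP measurable_fst A.
Proof.
move=> mA; transitivity (prodP (A `*` setT)).
  by rewrite prodPE// [X in (_ * X)%E](_ : _ = 1%E) ?mule1//; exact: probability_setT.
by congr (prodP _); apply/seteqP; split => [z [] //|z zA]; split.
Qed.

Let law_snd (A : set T2) : measurable A -> P2 A = law prodP measurable_snd A.
Proof.
move=> mA; transitivity (prodP (setT `*` A)).
  by rewrite prodPE// [X in (X * _)%E](_ : _ = 1%E) ?mul1e//; exact: probability_setT.
by congr (prodP _); apply/seteqP; split => [z [] //|z zA]; split.
Qed.

Lemma L1_fst (F : T1 -> R) : L1 P1 F -> L1 prodP (fun z => F z.1).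
Proof.
move=> iF; apply: (L1_lawP measurable_fst (L1_measurable iF)).
exact: eq_L1_measure law_fst iF.
Qed.

Lemma L1_snd (F : T2 -> R) : L1 P2 F -> L1 prodP (fun z => F z.2).
Proof.
move=> iF; apply: (L1_lawP measurable_snd (L1_measurable iF)).
exact: eq_L1_measure law_snd iF.
Qed.

Lemma Ex_fst (F : T1 -> R) : L1 P1 F -> Ex prodP (fun z => F z.1) = Ex P1 F.
Proof.
move=> iF; rewrite (eq_Ex_measure F law_fst) Ex_law//; last exact: L1_fst.
exact: L1_measurable iF.
Qed.

Lemma Ex_snd (F : T2 -> R) : L1 P2 F -> Ex prodP (fun z => F z.2) = Ex P2 F.
Proof.
move=> iF; rewrite (eq_Ex_measure F law_snd) Ex_law//; last exact: L1_snd.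
exact: L1_measurable iF.
Qed.

Lemma Ex_prod (F : T1 -> R) (G : T2 -> R) : L1 P1 F -> L1 P2 G ->
  L1 prodP (fun z => F z.1 * G z.2) /\
  Ex prodP (fun z => F z.1 * G z.2) = Ex P1 F * Ex P2 G.
Proof.
move=> iF iG; have mF := L1_measurable iF; have mG := L1_measurable iG.
have mF1 : measurable_fun setT (fun z : T1 * T2 => F z.1).
  by apply: measurableT_comp => //; exact: measurable_fst.
have mG2 : measurable_fun setT (fun z : T1 * T2 => G z.2).
  by apply: measurableT_comp => //; exact: measurable_snd.
have ind (A B : set R) : measurable A -> measurable B ->
    prodP ((fun z => F z.1) @^-1` A `&` (fun z => G z.2) @^-1` B) =
    (prodP ((fun z => F z.1) @^-1` A) * prodP ((fun z => G z.2) @^-1` B))%E.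
  move=> mA mB.
  have mFA : measurable (F @^-1` A) by rewrite -[X in measurable X]setTI; exact: mF.
  have mGB : measurable (G @^-1` B) by rewrite -[X in measurable X]setTI; exact: mG.
  transitivity (prodP ((F @^-1` A) `*` (G @^-1` B))); first by [].
  by rewrite prodPE// law_fst// law_snd.
split; first exact: (indep_mul_L1 mF1 mG2 ind (L1_fst iF) (L1_snd iG)).
by rewrite (indep_mul_Ex mF1 mG2 ind (L1_fst iF) (L1_snd iG)) Ex_fst// Ex_snd.
Qed.

End ProductProbability.

(** * The characteristic function of a centered normal law *)

Lemma measurable_cos (R : realType) : measurable_fun setT (@cos R).
Proof. apply: continuous_measurable_fun; exact: continuous_cos. Qed.

Lemma measurable_sin (R : realType) : measurable_fun setT (@sin R).
Proof. apply: continuous_measurable_fun; exact: continuous_sin. Qed.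

Lemma cos_taylor4_le (R : realType) (x : R) : `|cos x - (1 - x ^+ 2 / 2)| <= x ^+ 4.
Proof.
have c1 := cos_ge_quadratic x; have c2 := cos_le_quartic x.
have q : 0 <= x ^+ 4 by rewrite exprn_even_ge0.
by rewrite ler_norml; apply/andP; split; lra.
Qed.

Section GaussianCharacteristic.
Context {R : realType}.
Local Notation leb := (@lebesgue_measure R).
Implicit Types (s t a : R).

Lemma gauss_scale s (A : set R) : 0 < s -> measurable A ->
  law (gauss 1) (measurable_affine s 0) A = gauss s A.
Proof. move=> s0 mA; transitivity (gauss 1 [set z | A (s * z + 0)]); first by [].
by rewrite (gauss1_affine 0 (lt0r_neq0 s0) mA) (gtr0_norm s0) gauss_prob. Qed.

Lemma Ex_gauss_scale s (h : R -> R) : 0 < s -> measurable_fun setT h ->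
  L1 (gauss s) h -> L1 (gauss 1) (fun x : R => h (s * x)) /\
  Ex (gauss s) h = Ex (gauss 1) (fun x : R => h (s * x)).
Proof.
move=> s0 mh ih.
have e : (fun x => h (s * x)) = h \o (fun x => s * x + 0).
  by apply/funext => x /=; rewrite addr0.
have ih' := eq_L1_measure (fun A mA => esym (gauss_scale s0 mA)) ih.
have ihc := L1_lawP (measurable_affine s 0) mh ih'.
rewrite e; split; first exact: ihc.
by rewrite -(eq_Ex_measure h (fun A mA => gauss_scale s0 mA)) Ex_law.
Qed.

Lemma law_gauss_conv s (c : R) : 0 < s -> c != 0 -> forall
    (mL : measurable_fun setT (fun z : R * R => c * z.2 + z.1))
    (B : set R), measurable B ->
  law (prodP (gauss s) (gauss 1)) mL B = gauss (Num.sqrt (s ^+ 2 + c ^+ 2)) B.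
Proof.
move=> s0 c0 mL B mB; rewrite -(gauss_conv s0 c0 mB).
transitivity (\int[gauss s]_y gauss 1 (xsection [set z : R * R | B (c * z.2 + z.1)%R] y))%E.
  by [].
congr (integral _ _ _); apply/funext => y; congr (gauss 1 _).
by apply/seteqP; split => z; rewrite /xsection/= inE.
Qed.

(** The tilted density is [s] times the normal density of standard deviation [s], where
    [s ^+ 2 = 1 / (1 - 2 a)]. The moments needed below are derived from this integral. *)
Lemma integral_gauss1_exp a : a < 2^-1 ->
  (\int[gauss 1]_x (expR (a * x ^+ 2))%:E = ((Num.sqrt (1 - 2 * a))^-1)%:E)%E.
Proof.
move=> a2; set r := Num.sqrt (1 - 2 * a); set s := r^-1.
have q0 : 0 < 1 - 2 * a by lra.
have r0 : 0 < r by rewrite sqrtr_gt0.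
have rr : r ^+ 2 = 1 - 2 * a by rewrite sqr_sqrtr// ltW.
have s0 : 0 < s by rewrite invr_gt0.
rewrite ge0_integral_gauss; last 2 first.
- apply: measurableT_comp => //; apply: measurable_funM => //.
- by move=> x; exact: expR_ge0.
transitivity (s%:E * \int[leb]_x (normal_pdf 0 s x)%:E)%E; last first.
  by rewrite integral_normal_pdf mule1.
rewrite -ge0_integralZl; last 4 first.
- exact: measurableT.
- by apply/measurable_EFinP; exact: measurable_normal_pdf.
- by move=> x _; rewrite lee_fin normal_pdf_ge0.
- by rewrite lee_fin ltW.
apply: eq_integral => x _; rewrite -EFinM; congr (_%:E).
rewrite !normal_pdfE ?gt_eqF// !normal_peakE// /normal_fun invr1 mul1r.
rewrite mulrCA -expRD [RHS]mulrA; congr (_ * expR _).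
  by rewrite mulrA divff ?mul1r// gt_eqF.
rewrite (_ : s ^+ 2 *+ 2 = 2 / (1 - 2 * a)); last by rewrite /s exprVn rr -mulr_natl.
by rewrite expr1n subr0 invf_div; field.
Qed.

Lemma L1_gauss1_exp a : a < 2^-1 -> L1 (gauss 1) (fun x : R => expR (a * x ^+ 2)).
Proof.
move=> a2; apply: L1_ge0.
- apply: measurableT_comp => //; apply: measurable_funM => //.
- by move=> x; exact: expR_ge0.
- by rewrite integral_gauss1_exp// ltry.
Qed.

Lemma L1_gauss1_pow4 : L1 (gauss 1) (fun x : R => x ^+ 4).
Proof.
have a2 : 4^-1 < 2^-1 :> R by rewrite ltf_pV2 ?posrE// ltr_nat.
(* [exp y >= 1 + y ^+ 2 / 2] at [y = x ^+ 2 / 4] gives the factor 32. *)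
apply: (L1_le _ _ (L1Z 32 (L1_gauss1_exp a2))) => [|x]; first by [].
have x4 : 0 <= x ^+ 4 by rewrite exprn_even_ge0.
rewrite ger0_norm//.
have y0 : 0 <= 4^-1 * x ^+ 2 by rewrite mulr_ge0 ?sqr_ge0.
have := expR_ge1Dxn 1 y0; rewrite (_ : (2`!)%:R = 2) //; nra.
Qed.

Lemma L1_gauss1_sqr : L1 (gauss 1) (fun x : R => x ^+ 2).
Proof.
apply: (L1_le _ _ (L1D (L1_cst _ 1) L1_gauss1_pow4)) => [|x]; first by [].
rewrite ger0_norm ?sqr_ge0//; have := sqr_ge0 (x ^+ 2 - 1); have := sqr_ge0 (x ^+ 2); nra.
Qed.

(** From [exp (a x^2) >= 1 + a x^2], the variance [m] satisfies [(1 + a m)^2 (1 - 2 a) <= 1] for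
    small [a] of either sign, so the first-order coefficient [2 (m - 1)] must vanish. *)
Lemma gauss1_var : Ex (gauss 1) (fun x : R => x ^+ 2) = 1.
Proof.
set m := Ex _ _.
have m0 : 0 <= m by apply: Ex_ge0 => x; exact: sqr_ge0.
have key a : a < 2^-1 -> 0 <= 1 + a * m -> (1 + a * m) ^+ 2 * (1 - 2 * a) <= 1.
  move=> a2 am.
  have q0 : 0 < 1 - 2 * a by lra.
  have r0 : 0 < Num.sqrt (1 - 2 * a) by rewrite sqrtr_gt0.
  have rr : Num.sqrt (1 - 2 * a) ^+ 2 = 1 - 2 * a by rewrite sqr_sqrtr// ltW.
  have h : 1 + a * m <= (Num.sqrt (1 - 2 * a))^-1.
    have -> : (Num.sqrt (1 - 2 * a))^-1 = Ex (gauss 1) (fun x : R => expR (a * x ^+ 2)).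
      by rewrite Ex.unlock /Rintegral integral_gauss1_exp.
    rewrite /m -ExZ; last exact: L1_gauss1_sqr.
    rewrite -[X in X + _](Ex_cst (gauss 1)) -ExD; last 2 first.
      exact: L1_cst.
      exact/L1Z/L1_gauss1_sqr.
    apply: Ex_le.
    - apply: L1D; [exact: L1_cst|exact/L1Z/L1_gauss1_sqr].
    - exact: L1_gauss1_exp.
    - by move=> x; exact: expR_ge1Dx.
  have : ((1 + a * m) * Num.sqrt (1 - 2 * a)) ^+ 2 <= 1.
    rewrite expr_le1//; last by rewrite mulr_ge0// ltW.
    by rewrite -ler_pdivlMr// mul1r.
  by rewrite exprMn rr.
apply/eqP; rewrite eq_le; apply/andP; split; rewrite leNgt; apply/negP => m1.
(* Small enough for the first-order term [2 (m - 1) b] to dominate the terms of orders two and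
   three. *)
- pose b := (m - 1) / (1 + 4 * m + 2 * m ^+ 2) / 4.
  have D0 : 0 < 1 + 4 * m + 2 * m ^+ 2 by nra.
  have b0 : 0 < b by rewrite /b !divr_gt0// subr_gt0.
  have bD : b * (1 + 4 * m + 2 * m ^+ 2) = (m - 1) / 4.
    by rewrite /b mulrAC divfK ?gt_eqF.
  have b2 : b < 2^-1 by nra.
  have := key b b2 ltac:(nra); nra.
- pose b := (1 - m) / 8.
  have b0 : 0 < b by rewrite /b; lra.
  have bm : 0 <= 1 + - b * m by rewrite /b; nra.
  have b2 : - b < 2^-1 by lra.
  have := key (- b) b2 bm; have : m = 1 - 8 * b by rewrite /b; lra.
  have b8 : b <= 8^-1 by rewrite /b; lra.
  move=> ->; clear -b0 b8; nra.
Qed.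

Lemma L1_cos d (T : measurableType d) (P : probability T R) (F : T -> R) :
  measurable_fun setT F -> L1 P (fun w => cos (F w)).
Proof.
move=> mF; apply: (@L1_bounded _ _ _ _ _ 1) => [|w]; last exact: cos_max.
by apply: measurableT_comp mF; exact: measurable_cos.
Qed.

Lemma L1_sin d (T : measurableType d) (P : probability T R) (F : T -> R) :
  measurable_fun setT F -> L1 P (fun w => sin (F w)).
Proof.
move=> mF; apply: (@L1_bounded _ _ _ _ _ 1) => [|w]; last exact: sin_max.
by apply: measurableT_comp mF; exact: measurable_sin.
Qed.

Let mid : measurable_fun setT (@id R). Proof. by []. Qed.

(** [gauss s] is the image of [gauss 1] under both [s] and [- s], so the mean of an odd function
    equals its opposite. *)
Lemma Ex_gauss_sin s : 0 < s -> Ex (gauss s) sin = 0.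
Proof.
move=> s0; have i1 : L1 (gauss s) sin by exact: (L1_sin _ mid).
have [_ e1] := Ex_gauss_scale s0 (@measurable_sin R) i1.
have neg (A : set R) : measurable A -> law (gauss 1) (measurable_affine (- s) 0) A = gauss s A.
  move=> mA; transitivity (gauss 1 [set z | A (- s * z + 0)]); first by [].
  have ns0 : - s != 0 by rewrite oppr_eq0 gt_eqF.
  by rewrite (gauss1_affine 0 ns0 mA) normrN (gtr0_norm s0) gauss_prob.
have m1 : measurable_fun setT (fun x : R => sin (- s * x + 0)).
  by apply: measurableT_comp; [exact: measurable_sin|exact: measurable_affine].
have := eq_Ex_measure sin neg; rewrite Ex_law; last 2 first.
- exact: measurable_sin.
- by apply: (@L1_bounded _ _ _ _ _ 1) => // x; exact: sin_max.
rewrite (_ : sin \o _ = (fun x : R => - sin (s * x))); last first.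
  by apply/funext => x /=; rewrite addr0 mulNr sinN.
have iN : L1 (gauss 1) (fun x : R => sin (s * x)) by apply: L1_sin; exact: mulrl_measurable.
have alg (y z t : R) : y = - z -> t = z -> y = t -> t = 0 by lra.
exact: (alg _ _ _ (ExN iN) e1).
Qed.

(** The characteristic function at frequency 1 as a function of the variance, which is additive
    under convolution. *)
Definition gauss_cos (v : R) : R := Ex (gauss (Num.sqrt v)) cos.

Lemma gauss_cosD (v w : R) : 0 < v -> 0 < w ->
  gauss_cos (v + w) = gauss_cos v * gauss_cos w.
Proof.
move=> v0 w0; set s := Num.sqrt v; set c := Num.sqrt w.
have s0 : 0 < s by rewrite sqrtr_gt0.
have c0 : 0 < c by rewrite sqrtr_gt0.
have mL : measurable_fun setT (fun z : R * R => c * z.2 + z.1).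
  by apply: measurable_funD => //; apply: measurable_funM => //; exact: measurable_snd.
have iL : L1 (prodP (gauss s) (gauss 1)) (fun z => cos (c * z.2 + z.1)) by exact: L1_cos.
have -> : gauss_cos (v + w) = Ex (prodP (gauss s) (gauss 1)) (fun z => cos (c * z.2 + z.1)).
  transitivity (Ex (law (prodP (gauss s) (gauss 1)) mL) cos).
    rewrite (eq_Ex_measure cos (law_gauss_conv s0 (lt0r_neq0 c0) mL)).
    by rewrite !sqr_sqrtr ?ltW.
  by rewrite Ex_law//; exact: measurable_cos.
have [i1 e1] := Ex_gauss_scale c0 (@measurable_cos R) (L1_cos (gauss c) mid).
have [i2 e2] := Ex_gauss_scale c0 (@measurable_sin R) (L1_sin (gauss c) mid).
have [j1 f1] := Ex_prod (L1_cos (gauss s) mid) i1.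
have [j2 f2] := Ex_prod (L1_sin (gauss s) mid) i2.
transitivity (Ex (prodP (gauss s) (gauss 1)) (fun z => cos z.1 * cos (c * z.2) - sin z.1 * sin (c * z.2))).
  by congr Ex; apply/funext => z; rewrite addrC cosD.
have alg (D a b x y t q e : R) : D = a - b -> a = x * q -> b = t * y -> t = 0 -> e = q -> D = x * e.
  by move=> -> -> -> -> ->; ring.
exact: (alg _ _ _ _ _ _ _ _ (ExB j1 j2) f1 f2 (Ex_gauss_sin s0) e1).
Qed.

Lemma gauss_cos_le1 v : `|gauss_cos v| <= 1.
Proof.
have iL := L1_cos (gauss (Num.sqrt v)) mid.
apply: (le_trans (norm_Ex_le iL)); rewrite -[leRHS](Ex_cst (gauss (Num.sqrt v))).
apply: Ex_le; [exact: L1_norm|exact: L1_cst|exact: cos_max].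
Qed.

Lemma gauss_cos_taylor : exists2 C : R, 0 <= C &
  forall v, 0 < v <= 1 -> `|gauss_cos v - (1 - v / 2)| <= C * v ^+ 2.
Proof.
exists (Ex (gauss 1) (fun x : R => x ^+ 4)); first by apply: Ex_ge0 => x; rewrite exprn_even_ge0.
move=> v /andP[v0 v1]; set s := Num.sqrt v.
have s0 : 0 < s by rewrite sqrtr_gt0.
have sv : s ^+ 2 = v by rewrite sqr_sqrtr// ltW.
have [i1 e1] := Ex_gauss_scale s0 (@measurable_cos R) (L1_cos (gauss s) mid).
have i2 : L1 (gauss 1) (fun x : R => 1 - v / 2 * x ^+ 2).
  by apply: L1B; [exact: L1_cst|exact/L1Z/L1_gauss1_sqr].
have -> : 1 - v / 2 = Ex (gauss 1) (fun x : R => 1 - v / 2 * x ^+ 2).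
  rewrite ExB; [|exact: L1_cst|exact/L1Z/L1_gauss1_sqr].
  by rewrite Ex_cst (ExZ _ L1_gauss1_sqr) gauss1_var mulr1.
have -> : gauss_cos v - Ex (gauss 1) (fun x : R => 1 - v / 2 * x ^+ 2) =
    Ex (gauss 1) (fun x : R => cos (s * x) - (1 - v / 2 * x ^+ 2)).
  exact: (etrans (congr1 (fun y => y - _) e1) (esym (ExB i1 i2))).
rewrite [leRHS]mulrC -(ExZ _ L1_gauss1_pow4).
apply: norm_Ex_le_dom.
- by apply: L1_measurable; exact: (L1B i1 i2).
- exact/L1Z/L1_gauss1_pow4.
move=> x; rewrite (_ : v ^+ 2 * x ^+ 4 = (s * x) ^+ 4); last by rewrite -sv; ring.
rewrite (_ : v / 2 * x ^+ 2 = (s * x) ^+ 2 / 2); last by rewrite -sv; ring.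
exact: cos_taylor4_le.
Qed.

(** With [v = m * w], both sides are [m]-th powers of numbers in the unit interval of absolute
    values that differ by [O(w^2)]; the powers differ by [m * O(w^2) = O(1/m)]. *)
Lemma gauss_cosE v : 0 < v -> gauss_cos v = expR (- (v / 2)).
Proof.
move=> v0; have [C C0 HC] := gauss_cos_taylor.
apply/eqP; rewrite -subr_eq0 -normr_le0; apply/ler_addgt0Pl => e e0; rewrite addr0.
have He (x : R) : 0 <= x -> `|expR (- x) - (1 - x)| <= x ^+ 2.
  move=> x0; have h1 := expR_ge1Dx (- x).
  rewrite ger0_norm; last by lra.
  have h2 : expR (- x) * (1 + x) <= 1.
    rewrite -[leRHS]expR0 -[0](addNr x) expRD ler_pM2l ?expR_gt0//; exact: expR_ge1Dx.
  have h3 := expR_gt0 (- x).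
  move: h1 h2 h3; generalize (expR (- x)) => y h1 h2 h3.
  nra.
pose K := C * v ^+ 2 + v ^+ 2.
have K0 : 0 <= K by rewrite /K; positivity.
(* [K / e] makes the final error at most [e], and [v] makes [w <= 1]. *)
pose m := (Num.trunc (K / e + v)).+1.
have m0 : 0 < m%:R :> R by [].
have mK : K / e + v < m%:R by rewrite truncnS_gt.
pose w := v / m%:R.
have w0 : 0 < w by rewrite divr_gt0.
have w1 : w <= 1.
  rewrite ler_pdivrMr// mul1r; apply: ltW; apply: le_lt_trans mK.
  by rewrite lerDr divr_ge0// ltW.
have wv : v = m%:R * w by rewrite /w mulrC divfK ?gt_eqF.
have pw (n : nat) : gauss_cos (n.+1%:R * w) = gauss_cos w ^+ n.+1.
  elim: n => [|n IH]; first by rewrite mul1r expr1.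
  have nw : 0 < n.+1%:R * w by rewrite mulr_gt0.
  have -> : n.+2%:R * w = n.+1%:R * w + w by rewrite -[in LHS]natr1 mulrDl mul1r.
  by rewrite (gauss_cosD nw w0) IH [RHS]exprSr.
have pe : expR (- (v / 2)) = expR (- (w / 2)) ^+ m.
  by rewrite -expRM_natl; congr expR; rewrite {1}wv -mulr_natl; ring.
have diff (a b : R) n : `|a| <= 1 -> `|b| <= 1 -> `|a ^+ n - b ^+ n| <= n%:R * `|a - b|.
  move=> a1 b1; elim: n => [|n IH]; first by rewrite !expr0 subrr normr0 mul0r.
  rewrite !exprS (_ : _ - _ = a * (a ^+ n - b ^+ n) + (a - b) * b ^+ n); last by ring.
  have -> : n.+1%:R * `|a - b| = n%:R * `|a - b| + `|a - b| by rewrite -[in LHS]natr1 mulrDl mul1r.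
  apply: (le_trans (ler_normD _ _)); rewrite lerD//.
    by rewrite normrM; apply: le_trans IH; rewrite ler_piMl.
  by rewrite normrM ler_piMr// normrX exprn_ile1.
rewrite pe {1}wv /m pw.
apply: (le_trans (diff _ _ _ (gauss_cos_le1 _) _)).
  by rewrite ger0_norm ?expR_ge0// expR_le1 oppr_le0 divr_ge0// ltW.
have d1 : `|gauss_cos w - expR (- (w / 2))| <= (C + 1) * w ^+ 2.
  rewrite (_ : _ - _ = (gauss_cos w - (1 - w / 2)) - (expR (- (w / 2)) - (1 - w / 2))); last by ring.
  apply: (le_trans (ler_normB _ _)); rewrite mulrDl lerD// ?HC ?w0//.
  apply: (le_trans (He _ _)); first by rewrite divr_ge0// ltW.
  by rewrite mul1r; clear -w0; nra.
apply: (le_trans (ler_wpM2l (ltW m0) d1)).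
rewrite (_ : m%:R * ((C + 1) * w ^+ 2) = K / m%:R); last first.
  by rewrite /K /w; field; rewrite gt_eqF.
rewrite ler_pdivrMr// mulrC -ler_pdivrMr//; apply: ltW; apply: le_lt_trans mK.
by rewrite lerDl ltW.
Qed.

End GaussianCharacteristic.

(** * Approximation by trigonometric polynomials on a box *)

Section TrigonometricPolynomials.
Context {R : realType} {p : nat}.
Implicit Types (u x y : 'cV[R]_p) (s : seq 'I_p) (g : ('I_p -> nat) -> R).

Definition dotc u x : R := \sum_j u j 0 * x j 0.

(** Each triple is an amplitude, a frequency and a phase; the phases provide sines and make the
    class closed under products. *)
Definition trigpoly (T : 'cV[R]_p -> R) := exists s : seq (R * 'cV[R]_p * R),
  forall x, T x = \sum_(c <- s) c.1.1 * cos (dotc c.1.2 x + c.2).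

Lemma dotcDl u1 u2 x : dotc (u1 + u2) x = dotc u1 x + dotc u2 x.
Proof. by rewrite -big_split; apply: eq_bigr => j _; rewrite mxE mulrDl. Qed.

Lemma dotcNl u x : dotc (- u) x = - dotc u x.
Proof. by rewrite -sumrN; apply: eq_bigr => j _; rewrite mxE mulNr. Qed.

Lemma trigpolyD T1 T2 : trigpoly T1 -> trigpoly T2 -> trigpoly (fun x => T1 x + T2 x).
Proof.
by move=> [s1 h1] [s2 h2]; exists (s1 ++ s2) => x; rewrite big_cat h1 h2.
Qed.

Lemma trigpolyZ (a : R) T : trigpoly T -> trigpoly (fun x => a * T x).
Proof.
move=> [s h]; exists [seq (a * c.1.1, c.1.2, c.2) | c <- s] => x.
by rewrite big_map h mulr_sumr; apply: eq_bigr => c _; rewrite mulrA.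
Qed.

Lemma trigpoly_cos (a b : R) u : trigpoly (fun x => a * cos (dotc u x + b)).
Proof. by exists [:: (a, u, b)] => x; rewrite big_seq1. Qed.

Lemma trigpoly_cst (a : R) : trigpoly (fun=> a).
Proof.
exists [:: (a, 0, 0)] => x; rewrite big_seq1 /= addr0.
rewrite (_ : dotc 0 x = 0) ?cos0 ?mulr1//.
by rewrite /dotc big1// => j _; rewrite mxE mul0r.
Qed.

Lemma trigpoly_sum (I : Type) (s : seq I) (T : I -> 'cV[R]_p -> R) :
  (forall i, trigpoly (T i)) -> trigpoly (fun x => \sum_(i <- s) T i x).
Proof.
move=> hT; elim: s => [|i s IH].
  have [s h] := trigpoly_cst 0; exists s => x; rewrite big_nil; exact: h.
have [s' h] := trigpolyD (hT i) IH; exists s' => x; rewrite big_cons; exact: h.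
Qed.

Lemma trigpolyM T1 T2 : trigpoly T1 -> trigpoly T2 -> trigpoly (fun x => T1 x * T2 x).
Proof.
move=> [s1 h1] [s2 h2].
have h c1 c2 : trigpoly (fun x => (c1.1.1 * cos (dotc c1.1.2 x + c1.2)) *
    (c2.1.1 * cos (dotc c2.1.2 x + c2.2))).
  have := trigpolyD (trigpoly_cos (c1.1.1 * c2.1.1 / 2) (c1.2 + c2.2) (c1.1.2 + c2.1.2))
    (trigpoly_cos (c1.1.1 * c2.1.1 / 2) (c1.2 - c2.2) (c1.1.2 - c2.1.2)).
  move=> [s hs]; exists s => x; rewrite -hs !dotcDl dotcNl.
  rewrite (_ : _ + _ + (_ + _) = (dotc c1.1.2 x + c1.2) + (dotc c2.1.2 x + c2.2)); last by ring.
  rewrite (_ : _ - _ + (_ - _) = (dotc c1.1.2 x + c1.2) - (dotc c2.1.2 x + c2.2)); last by ring.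
  move: (dotc c1.1.2 x + c1.2) (dotc c2.1.2 x + c2.2) c1.1.1 c2.1.1 => a b c d.
  by rewrite cosD cosB; field.
have [s hs] := trigpoly_sum s1 (fun c1 => trigpoly_sum s2 (h c1)).
exists s => x; rewrite -hs h1 h2 mulr_suml; apply: eq_bigr => c1 _.
by rewrite mulr_sumr.
Qed.

Lemma trigpoly_sin_coord (M : R) (j : 'I_p) : trigpoly (fun x => sin (x j 0 / M)).
Proof.
have [s h] := trigpoly_cos 1 (- (pi / 2)) (M^-1 *: delta_mx j 0).
exists s => x; rewrite -h mul1r cosBpihalf; congr sin.
rewrite /dotc (bigD1 j)//= big1 => [|i ij]; rewrite !mxE ?eqxx/=.
  by rewrite mulr1 addr0 mulrC.
by rewrite (negbTE ij) mulr0 mul0r.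
Qed.

(* [walk s t g] is the expectation of [g] at the end of a walk in [N^p] whose
   successive steps, for [j] in [s], increment the coordinate [j] with
   probability [t j]; it replaces multivariate Bernstein polynomials. *)
Definition incr (j : 'I_p) (k : 'I_p -> nat) : 'I_p -> nat :=
  fun i => if i == j then (k i).+1 else k i.

Fixpoint walk s (t : 'I_p -> R) g : R :=
  if s is j :: s' then
    t j * walk s' t (fun k => g (incr j k)) + (1 - t j) * walk s' t g
  else g (fun=> 0%N).

Lemma walk_trigpoly s (t : 'I_p -> 'cV[R]_p -> R) g :
  (forall j, trigpoly (t j)) -> trigpoly (fun x => walk s (fun j => t j x) g).
Proof.
move=> ht; elim: s g => [|j s IH] g /=; first exact: trigpoly_cst.
apply: trigpolyD; first exact: trigpolyM.
apply: trigpolyM; last exact: IH.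
have [s' h] := trigpolyD (trigpoly_cst 1) (trigpolyZ (-1) (ht j)).
by exists s' => x; rewrite -h mulN1r.
Qed.

Section WalkEstimates.
Context (t : 'I_p -> R) (t01 : forall j, 0 <= t j <= 1).

Lemma walk_le s g1 g2 : (forall k, g1 k <= g2 k) -> walk s t g1 <= walk s t g2.
Proof.
elim: s g1 g2 => [|j s IH] g1 g2 g12 /=; first exact: g12.
have /andP[t0 t1] := t01 j.
apply: lerD; first by rewrite ler_wpM2l// IH.
by rewrite ler_wpM2l ?subr_ge0// IH.
Qed.

Lemma walkD s g1 g2 : walk s t (fun k => g1 k + g2 k) = walk s t g1 + walk s t g2.
Proof. by elim: s g1 g2 => [//|j s IH] g1 g2 /=; rewrite !IH; ring. Qed.

Lemma walkZ s (a : R) g : walk s t (fun k => a * g k) = a * walk s t g.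
Proof. by elim: s g => [//|j s IH] g /=; rewrite !IH; ring. Qed.

Lemma walk_cst s (a : R) : walk s t (fun=> a) = a.
Proof. by elim: s => [//|j s IH] /=; rewrite !IH; ring. Qed.

Lemma walk_sum s (I : Type) (r : seq I) (g : I -> ('I_p -> nat) -> R) :
  walk s t (fun k => \sum_(i <- r) g i k) = \sum_(i <- r) walk s t (g i).
Proof.
elim: r => [|i r IH].
  rewrite big_nil -[RHS](walk_cst s); congr walk.
  by apply/funext => k; rewrite big_nil.
rewrite big_cons -IH -walkD; congr walk.
by apply/funext => k; rewrite big_cons.
Qed.

Lemma walk_norm_le s g g' (a : R) : (forall k, `|g k - a| <= g' k) ->
  `|walk s t g - a| <= walk s t g'.
Proof.
move=> gg; have h1 := @walk_le s (fun k => a + (-1) * g' k) g.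
have h2 := @walk_le s g (fun k => a + g' k).
rewrite ler_distl; apply/andP; split.
- have := h1 _; rewrite walkD walk_cst walkZ mulN1r; apply=> k.
  by have := gg k; rewrite ler_distl mulN1r => /andP[].
- have := h2 _; rewrite walkD walk_cst; apply=> k.
  by have := gg k; rewrite ler_distl => /andP[].
Qed.

(** The binomial variance of the coordinate [j]. The offset [c] absorbs one centered increment at
    each step of the induction. *)
Lemma walk_sqr s j (c : R) :
  walk s t (fun k => ((k j)%:R + c - (count_mem j s)%:R * t j) ^+ 2) =
  (count_mem j s)%:R * (t j * (1 - t j)) + c ^+ 2.
Proof.
elim: s c => [|i s IH] c /=; first by rewrite !mul0r subr0 !add0r.
have [ij|ij] := eqVneq i j; last first.
  rewrite add0n.
  have -> : (fun k : 'I_p -> nat => ((incr i k j)%:R + c - (count_mem j s)%:R * t j) ^+ 2) =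
      (fun k => ((k j)%:R + c - (count_mem j s)%:R * t j) ^+ 2).
    by apply/funext => k; rewrite /incr eq_sym (negbTE ij).
  by rewrite IH; ring.
have -> : (fun k : 'I_p -> nat => ((incr i k j)%:R + c - (1 + count_mem j s)%:R * t j) ^+ 2) =
    (fun k => ((k j)%:R + (c + 1 - t j) - (count_mem j s)%:R * t j) ^+ 2).
  by apply/funext => k; rewrite /incr ij eqxx natrD -natr1; ring.
have -> : (fun k : 'I_p -> nat => ((k j)%:R + c - (1 + count_mem j s)%:R * t j) ^+ 2) =
    (fun k => ((k j)%:R + (c - t j) - (count_mem j s)%:R * t j) ^+ 2).
  by apply/funext => k; rewrite natrD; ring.
rewrite !IH ij (_ : (true + count_mem j s)%N = (count_mem j s).+1)// -natr1; ring.
Qed.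

End WalkEstimates.

(** With half-sum [m] and half-difference [e], [sin a - sin b = 2 cos m sin e]; since
    [|m| + e <= pi / 2], [cos m >= sin e], and [2 (sin e)^2 = 1 - cos (a - b)]. *)
Lemma sin_dist_ge (a b d : R) : - (pi / 2) <= a <= pi / 2 -> - (pi / 2) <= b <= pi / 2 ->
  0 <= d <= 1 -> d <= `|a - b| -> 1 - cos d <= `|sin a - sin b|.
Proof.
wlog ab : a b / b <= a => [H ha hb hd dab|].
  have [ba|/ltW ba] := leP b a; first exact: H.
  by rewrite distrC H// distrC.
move=> /andP[a1 a2] /andP[b1 b2] /andP[d0 d1]; rewrite ger0_norm ?subr_ge0// => dab.
have p2 := @pi_ge2 R.
set e := (a - b) / 2; set m := (a + b) / 2.
have e0 : 0 <= e by rewrite /e; lra.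
have e2 : e <= pi / 2 by rewrite /e; lra.
have -> : sin a - sin b = 2 * (cos m * sin e).
  have -> : a = m + e by rewrite /m /e; lra.
  have -> : b = m - e by rewrite /m /e; lra.
  by rewrite sinD sinB; ring.
have se : 0 <= sin e by apply: sin_ge0_pi; lra.
have cm : sin e <= cos m.
  have -> : cos m = sin (pi / 2 - `|m|).
    by rewrite -(cos_norm m) -cosBpihalf -cosN; congr cos; lra.
  have me : e <= pi / 2 - `|m|.
    by have [m0|m0] := leP 0 m; [rewrite ger0_norm//|rewrite ltr0_norm//]; rewrite /m /e in m0 *; lra.
  have m0 := normr_ge0 m.
  move: me; rewrite le_eqVlt => /orP[/eqP -> //|me].
  by rewrite ltW// ltr_sin// in_itv/=; apply/andP; split; lra.
rewrite ger0_norm; last by rewrite !mulr_ge0// (le_trans se).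
apply: (@le_trans _ _ (2 * (sin e * sin e))); last by rewrite ler_pM2l// ler_wpM2r.
have -> : 2 * (sin e * sin e) = 1 - cos (a - b).
  have -> : a - b = e *+ 2 by rewrite /e -mulr_natr; lra.
  by rewrite cos_mulr2n; have := cos2Dsin2 e; rewrite -mulr_natr; lra.
rewrite lerD2l lerN2.
move: dab; rewrite le_eqVlt => /orP[/eqP -> //|dab].
by rewrite ltW// ltr_cos// in_itv/=; apply/andP; split; lra.
Qed.

(** Only [x] is confined to the box: the points at which [h] is sampled later may lie outside it. *)
Lemma uniformly_continuous_box (h : 'cV[R]_p -> R) (M e : R) :
  continuous h -> 0 < e -> exists2 d : R, 0 < d &
  forall x, (forall j, `|x j 0| <= M) -> forall y, (forall j, `|y j 0 - x j 0| < d) ->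
    `|h y - h x| < e.
Proof.
move=> ch e0.
pose K : set 'rV[R]_p := [set v | forall j, `[- M, M]%classic (v ord0 j)].
have cK : compact K by apply: (@rV_compact R p (fun=> `[- M, M]%classic)) => j; exact: segment_compact.
pose P (d : R) (v : 'rV[R]_p) := forall y, (forall j, `|y j 0 - v ord0 j| < d) ->
  `|h y - h v^T| < e.
have /(_ R (0^'+) P _ _) cov : near_covering K by exact/compact_near_coveringP.
have : \forall d \near 0^'+, K `<=` P d.
  apply: cov => v Kv.
  have e20 : 0 < e / 2 by rewrite divr_gt0.
  have /cvgrPdist_lt /(_ _ e20) /nbhs_ballP[r /= r0 hr] := ch v^T.
  have hr' y : (forall j, `|v ord0 j - y j 0| < r) -> `|h v^T - h y| < e / 2.
    move=> hy; apply: hr; split => // i j; rewrite !mxE ord1 /ball/=; exact: hy.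
  have r20 : 0 < r / 2 by rewrite divr_gt0.
  exists (ball v (r / 2), [set d : R | 0 < d < r / 2]); first split.
  - exact: nbhsx_ballx.
  - by exists (r / 2) => //= d; rewrite /ball_/= sub0r normrN => dr d0 /=; rewrite d0 (le_lt_trans _ dr)// ler_norm.
  move=> [v' d] [/= [_ vv'] /andP[d0 dr]] y hy.
  have vv j : `|v ord0 j - v' ord0 j| < r / 2 by exact: vv'.
  have h1 : `|h v^T - h v'^T| < e / 2.
    by apply: hr' => j; rewrite mxE (lt_trans (vv j))// ltr_pdivrMr// ltr_pMr// ltr1n.
  have h2 : `|h v^T - h y| < e / 2.
    apply: hr' => j; have := hy j; have := vv j; move: dr; clear.
    by rewrite !ltr_norml; lra.
  move: h1 h2; clear; rewrite !ltr_norml; lra.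
move=> [d /= d0 hd]; exists (d / 2); first by rewrite divr_gt0.
move=> x hx y hy.
have := hd (d / 2); rewrite /ball_/= sub0r normrN gtr0_norm ?divr_gt0//.
rewrite ltr_pdivrMr// ltr_pMr// ltr1n => /(_ isT).
move=> /(_ isT x^T).
rewrite /P trmxK; apply.
- by move=> j /=; rewrite mxE in_itv/= -ler_norml.
- by move=> j; rewrite mxE.
Qed.

(** Bernstein's probabilistic argument, with success probability [(1 + sin (x_j / M)) / 2] for the
    coordinate [j]. The map [y] recovers [x] from the observed frequencies, and Chebyshev's
    inequality controls the deviations. An average of values of [h] keeps its bound [H] everywhere,
    also outside the box. *)
Lemma trigpoly_approx (h : 'cV[R]_p -> R) (H M e : R) : continuous h ->
  (forall x, `|h x| <= H) -> 0 < M -> 0 < e -> exists T, [/\ trigpoly T,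
    forall x, `|T x| <= H &
    forall x, (forall j, `|x j 0| <= M) -> `|T x - h x| <= e].
Proof.
move=> ch hH M0 e0.
have H0 : 0 <= H by apply: le_trans (hH 0).
have e20 : 0 < e / 2 by rewrite divr_gt0.
have [d d0 hd] := uniformly_continuous_box M ch e20.
pose d1 := Num.min 1 (d / M).
have d10 : 0 < d1 by rewrite lt_min ltr01 divr_gt0.
have d11 : d1 <= 1 by rewrite ge_min lexx.
have d1d : d1 <= d / M by rewrite ge_min lexx orbT.
have p2 := @pi_ge2 R.
pose kap := 1 - cos d1.
have kap0 : 0 < kap.
  by rewrite subr_gt0 -cos0 ltr_cos// in_itv/=; apply/andP; split; lra.
(* [N > L] brings the final Chebyshev term, proportional to [1 / N], below [e / 2]. *)
pose L := 2 * H * p%:R * 4 / (kap ^+ 2) / (e / 2).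
pose N := (Num.trunc L).+1.
have N0 : 0 < N%:R :> R by [].
have LN : L < N%:R by rewrite truncnS_gt.
(* The minimum keeps the argument of [asin] in its domain for every [k], including those beyond the
   reach of the walk. *)
pose y (k : 'I_p -> nat) : 'cV[R]_p :=
  \col_j (M * asin (Num.min 1 (2 * (k j)%:R / N%:R - 1))).
pose t (x : 'cV[R]_p) j := 2^-1 + 2^-1 * sin (x j 0 / M).
pose s := flatten (nseq N (enum 'I_p)).
have cs j : count_mem j s = N.
  rewrite /s; elim: (N) => [//|n IH] /=; rewrite count_cat IH.
  by rewrite count_uniq_mem ?enum_uniq// mem_enum.
have t01 x j : 0 <= t x j <= 1.
  by have := sin_geN1 (x j 0 / M); have := sin_le1 (x j 0 / M); rewrite /t; lra.
exists (fun x => walk s (t x) (h \o y)); split.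
- apply: (walk_trigpoly s (t := fun j x => t x j)) => j; apply: trigpolyD; first exact: trigpoly_cst.
  by apply: trigpolyZ; exact: trigpoly_sin_coord.
- move=> x; rewrite -[walk _ _ _]subr0 -[leRHS](walk_cst (t x) s).
  by apply: walk_norm_le => // k; rewrite subr0; exact: hH.
move=> x hx.
pose q j (k : 'I_p -> nat) := ((k j)%:R + 0 - (count_mem j s)%:R * t x j) ^+ 2.
pose A := (N%:R * kap / 2) ^- 2.
have A0 : 0 <= A by rewrite /A invr_ge0 sqr_ge0.
have bnd k : `|(h \o y) k - h x| <= e / 2 + 2 * H * A * \sum_j q j k.
  have q0 j : 0 <= q j k by exact: sqr_ge0.
  have sq0 : 0 <= \sum_j q j k by rewrite sumr_ge0.
  have [close|/existsNP[j /negP far]] := pselect (forall j, `|y k j 0 - x j 0| < d).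
    rewrite ler_wpDr//; first by rewrite !mulr_ge0.
    by rewrite ltW//; apply: hd.
  rewrite ler_wpDl ?(ltW e20)//.
  have big : 1 <= A * q j k.
    rewrite /A mulrC ler_pdivlMr ?exprn_gt0 ?divr_gt0 ?mulr_gt0// mul1r /q cs addr0.
    rewrite -[leRHS]real_normK ?num_real// lerXn2r ?nnegrE//; first by rewrite !mulr_ge0// ltW.
    move: far; rewrite -leNgt /y mxE; set a := Num.min _ _ => far.
    have a1 : -1 <= a <= 1.
      rewrite /a le_min ge_min lexx /=.
      have : 0 <= 2 * (k j)%:R / N%:R :> R by rewrite divr_ge0 ?mulr_ge0.
      by lra.
    have xM : -1 <= x j 0 / M <= 1.
      rewrite ler_pdivlMr// ler_pdivrMr// mulN1r mul1r -ler_norml; exact: hx.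
    have := @sin_dist_ge (asin a) (x j 0 / M) d1.
    rewrite asin_geNpi2// asin_lepi2// asinK ?in_itv//= => /(_ isT).
    have x1 : - (pi / 2) <= x j 0 / M <= pi / 2 by lra.
    rewrite x1 (ltW d10) d11 => /(_ isT isT).
    have dM : d1 <= `|asin a - x j 0 / M|.
      apply: (le_trans d1d); rewrite ler_pdivrMr//.
      have -> : `|asin a - x j 0 / M| * M = `|M * asin a - x j 0|.
        rewrite -{2}(gtr0_norm M0) -normrM; congr (`|_|).
        by field; rewrite gt_eqF.
      exact: far.
    move=> /(_ dM); rewrite -/kap => hk.
    have cl : `|a - sin (x j 0 / M)| <= `|2 * (k j)%:R / N%:R - 1 - sin (x j 0 / M)|.
      rewrite /a; have [|w1] := leP 1 (2 * (k j)%:R / N%:R - 1); last by [].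
      move=> w1; have s1 := sin_le1 (x j 0 / M).
      rewrite !ger0_norm ?subr_ge0//; last by rewrite (le_trans s1).
      by rewrite lerD2r.
    have -> : (k j)%:R - N%:R * t x j = N%:R / 2 * (2 * (k j)%:R / N%:R - 1 - sin (x j 0 / M)).
      by rewrite /t; field; rewrite gt_eqF.
    rewrite normrM ger0_norm ?divr_ge0//.
    by rewrite mulrAC ler_pM2l ?divr_gt0// (le_trans hk).
  apply: (@le_trans _ _ (2 * H * 1)).
    rewrite mulr1 (_ : 2 * H = H + H); last by ring.
    by apply: (le_trans (ler_normB _ _)); rewrite lerD//= hH.
  rewrite -[leRHS]mulrA ler_wpM2l ?mulr_ge0//.
  apply: (le_trans big); rewrite ler_wpM2l//.
  by rewrite (bigD1 j)//= lerDl sumr_ge0.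
apply: (le_trans (walk_norm_le (t01 x) s bnd)).
rewrite walkD walk_cst walkZ walk_sum.
have -> : \sum_j walk s (t x) (q j) = \sum_j N%:R * (t x j * (1 - t x j)).
  by apply: eq_bigr => j _; rewrite walk_sqr cs expr0n addr0.
have S1 : \sum_j N%:R * (t x j * (1 - t x j)) <= p%:R * N%:R.
  have -> : p%:R * N%:R = \sum_(j < p) N%:R :> R by rewrite sumr_const card_ord mulr_natl.
  apply: ler_sum => j _; rewrite -[leRHS]mulr1 ler_pM2l//.
  by have /andP[a b] := t01 x j; nra.
rewrite [leRHS](_ : e = e / 2 + e / 2); last by lra.
rewrite lerD2l; apply: (le_trans (ler_wpM2l _ S1)); first by rewrite !mulr_ge0.
have -> : 2 * H * A * (p%:R * N%:R) = (2 * H * p%:R * 4 / kap ^+ 2) / N%:R.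
  by rewrite /A; field; rewrite !gt_eqF.
by rewrite ler_pdivrMr// [leRHS]mulrC -ler_pdivrMr//; exact: ltW LN.
Qed.

End TrigonometricPolynomials.

(** * Borel measurability of vector-valued maps *)

Section VectorMeasurability.
Context {R : realType} {p : nat}.

Lemma continuous_measurable_borelVec (h : 'cV[R]_p -> R) : continuous h ->
  @measurable_fun _ _ (@borelVec R p) R setT h.
Proof.
move=> /continuousP ch; apply: (measurability _ (RGenOpens.measurableE R)).
move=> _ [_ [a [b ->] <-]]; rewrite setTI; apply: sub_sigma_algebra.
exact/ch/interval_open.
Qed.

Lemma measurable_coord (j : 'I_p) :
  @measurable_fun _ _ (@borelVec R p) R setT (fun x : 'cV[R]_p => x j 0).
Proof. by apply: continuous_measurable_borelVec; exact: coord_continuous. Qed.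

(** An open set is the union of the countably many boxes with rational center and radius [1 / k.+1]
    that it contains. *)
Lemma measurable_borelVec d (T : measurableType d) (F : T -> 'cV[R]_p) :
  (forall j, measurable_fun setT (fun w => F w j 0)) ->
  @measurable_fun _ _ T (borelVec p) setT F.
Proof.
move=> mF; apply: (@measurability _ _ T (borelVec p) setT F (@open 'cV[R]_p)) => //.
move=> _ [U oU <-]; rewrite setTI.
pose box (i : 'cV[rat]_p * nat) : set 'cV[R]_p :=
  [set x | forall j, `|x j 0 - ratr (i.1 j 0)| < i.2.+1%:R^-1].
have mbox i : measurable (F @^-1` box i).
  rewrite (_ : F @^-1` box i = \bigcap_(j in [set: 'I_p])
      ((fun w => F w j 0) @^-1` `](ratr (i.1 j 0) - i.2.+1%:R^-1), (ratr (i.1 j 0) + i.2.+1%:R^-1)[)).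
    apply: fin_bigcap_measurable; first exact: finite_finset.
    by move=> j _; rewrite -[X in measurable X]setTI; apply: mF.
  apply/seteqP; split => w /= h j.
  - by move=> _; rewrite /preimage/= in_itv/= -ltr_distl; exact: h.
  - by have := h j I; rewrite /preimage/= in_itv/= -ltr_distl.
rewrite (_ : F @^-1` U = \bigcup_(i in [set i | box i `<=` U]) (F @^-1` box i)).
  rewrite bigcup_mkcond; apply: countable_bigcupT_measurable; first exact: countableP.
  by move=> i; case: ifP.
apply/seteqP; split => [w Uw|w [i /= iU bi]]; last exact: iU.
have /nbhs_ballP[r /= r0 rU] : nbhs (F w) U by exact: open_nbhs_nbhs.
pose k := Num.trunc (2 / r).
have k0 : 0 < k.+1%:R :> R by [].
have kr : 2 / k.+1%:R < r.
  by rewrite ltr_pdivrMr// mulrC -ltr_pdivrMr// truncnS_gt.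
have q j : {q : rat | `|F w j 0 - ratr q| < k.+1%:R^-1}.
  have e0 : 0 < k.+1%:R^-1 :> R by rewrite invr_gt0.
  apply: cid; have [] := @rat_in_itvoo R (F w j 0 - k.+1%:R^-1) (F w j 0 + k.+1%:R^-1).
    by rewrite ltrD2l gtrN.
  by move=> q; rewrite in_itv/= -ltr_distl distrC => hq; exists q.
exists (\col_j sval (q j), k) => /=; last by move=> j; rewrite /box/= mxE; exact: svalP (q j).
move=> x bx; apply: rU; split => // i j; rewrite ord1 /ball/=.
have := bx i; rewrite /= mxE; have := svalP (q i); move: kr.
move: (k.+1%:R^-1 : R) (ratr _ : R) => e q' kr; rewrite !ltr_norml; lra.
Qed.

Lemma measurable_dotc d (T : measurableType d) (F : T -> 'cV[R]_p) (u : 'cV[R]_p) :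
  (forall j, measurable_fun setT (fun w => F w j 0)) ->
  measurable_fun setT (fun w => dotc u (F w)).
Proof.
move=> mF; apply: measurable_sum => j; exact: measurable_funM.
Qed.

End VectorMeasurability.

(** * Convergence in law from convergence of characteristic functions *)

Section CharacteristicCriterion.
Context {R : realType} {p : nat} d (Omega : measurableType d).
Context (P : probability Omega R) (Z : nat -> Omega -> 'cV[R]_p).
Context (mu : probability (@borelVec R p) R) (C : R).
Hypotheses (mZ : forall n j, measurable_fun setT (fun w => Z n w j 0)).
Hypotheses (iZ : forall n j, L1 P (fun w => Z n w j 0))
  (CZ : forall n j, Ex P (fun w => `|Z n w j 0|) <= C).
Hypotheses (imu : forall j, L1 mu (fun x : 'cV[R]_p => x j 0))
  (Cmu : forall j, Ex mu (fun x : 'cV[R]_p => `|x j 0|) <= C).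
Hypothesis cosZ : forall u (b : R),
  Ex P (fun w => cos (dotc u (Z n w) + b)) @[n --> \oo] -->
  Ex mu (fun x : 'cV[R]_p => cos (dotc u x + b)).

Let mdot u (b : R) : @measurable_fun _ _ (@borelVec R p) R setT (fun x : 'cV[R]_p => dotc u x + b).
Proof.
apply: measurable_funD => //.
apply: (@measurable_dotc _ _ _ (@borelVec R p) (fun x => x)) => j.
exact: measurable_coord.
Qed.

Let mdotZ n u (b : R) : measurable_fun setT (fun w => dotc u (Z n w) + b).
Proof. by apply: measurable_funD => //; exact: measurable_dotc. Qed.

Let trigpoly_cvg (T : 'cV[R]_p -> R) : trigpoly T ->
  [/\ forall n, L1 P (fun w => T (Z n w)), L1 mu T &
  Ex P (fun w => T (Z n w)) @[n --> \oo] --> Ex mu T].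
Proof.
move=> [s hT]; have -> : T = fun x => \sum_(c <- s) c.1.1 * cos (dotc c.1.2 x + c.2).
  by apply/funext.
have iP c n : L1 P (fun w => c.1.1 * cos (dotc c.1.2 (Z n w) + c.2)) by exact/L1Z/L1_cos.
have iM (c : R * 'cV[R]_p * R) : L1 mu (fun x => c.1.1 * cos (dotc c.1.2 x + c.2)) by exact/L1Z/L1_cos.
split; [by move=> n; exact: L1_sum|exact: L1_sum|].
rewrite Ex_sum//.
rewrite (_ : (fun n => _) = (fun n => \sum_(c <- s) Ex P (fun w => c.1.1 * cos (dotc c.1.2 (Z n w) + c.2)))); last first.
  by apply/funext => n; rewrite Ex_sum.
elim: s {hT} => [|c s IH].
  rewrite big_nil (_ : (fun n => _) = (fun=> 0)); first exact: cvg_cst.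
  by apply/funext => n; rewrite big_nil.
rewrite big_cons (_ : (fun n => _) = (fun n => Ex P (fun w => c.1.1 * cos (dotc c.1.2 (Z n w) + c.2)) +
   \sum_(c <- s) Ex P (fun w => c.1.1 * cos (dotc c.1.2 (Z n w) + c.2)))); last first.
  by apply/funext => n; rewrite big_cons.
apply: cvgD => //.
rewrite ExZ; last exact: L1_cos.
rewrite (_ : (fun n => _) = (fun n => c.1.1 * Ex P (fun w => cos (dotc c.1.2 (Z n w) + c.2)))); last first.
  by apply/funext => n; rewrite ExZ//; exact: L1_cos.
by apply: cvgM; [exact: cvg_cst|exact: cosZ].
Qed.

(** A test function is replaced by a trigonometric polynomial close to it on a large box. Outside
    the box both are at most [H], and Markov's inequality with the uniform first moments makes that
    part small. *)
Lemma cvg_in_law_of_cos : cvg_in_law P Z mu.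
Proof.
move=> h ch [H hH].
have mh := continuous_measurable_borelVec ch.
have ihZ n : L1 P (fun w => h (Z n w)).
  apply: (@L1_bounded _ _ _ _ _ H) => [|w]; last exact: hH.
  exact: (measurableT_comp mh (measurable_borelVec (mZ n))).
have ih : L1 mu h by exact: L1_bounded mh hH.
suff hcvg : Ex P (fun w => h (Z n w)) @[n --> \oo] --> Ex mu h.
  rewrite (Ex_integral ih).
  rewrite (_ : (fun n => _) = (fun n => (Ex P (fun w => h (Z n w)))%:E)); last first.
    by apply/funext => n; rewrite Ex_integral.
  by apply: cvg_EFin; [exact: nearW|exact: hcvg].
apply/cvgrPdist_le => e e0.
have H0 : 0 <= H by apply: le_trans (hH 0).
(* Chosen for the estimate [small]: the part outside the box costs at most [e / 4]. The summand 1
   keeps [M] positive. *)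
pose M := 8 * H * p%:R * `|C| / e + 1.
have M0 : 0 < M.
  by rewrite /M ltr_wpDl// divr_ge0 ?(ltW e0)// !mulr_ge0.
have e8 : 0 < e / 8 by rewrite divr_gt0.
have [T [tT TH TM]] := trigpoly_approx ch hH M0 e8.
have [iTZ iT cT] := trigpoly_cvg tT.
have bnd (x : 'cV[R]_p) : `|T x - h x| <= e / 8 + 2 * H / M * \sum_j `|x j 0|.
  have S0 : 0 <= \sum_j `|x j 0| by rewrite sumr_ge0.
  have [/TM xM|/existsNP[j /negP]] := pselect (forall j, `|x j 0| <= M).
    apply: (le_trans xM); rewrite lerDl.
    by rewrite mulr_ge0// divr_ge0 ?mulr_ge0// ltW.
  rewrite -ltNge => xj; rewrite ler_wpDl ?(ltW e8)//.
  apply: (@le_trans _ _ (2 * H)).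
    rewrite (_ : 2 * H = H + H); last by ring.
    by apply: (le_trans (ler_normB _ _)); rewrite lerD.
  rewrite mulrAC ler_pdivlMr// ler_wpM2l ?mulr_ge0//.
  apply: (le_trans (ltW xj)); rewrite (bigD1 j)//= lerDl sumr_ge0//.
have small : 2 * H / M * (p%:R * C) <= e / 8 * 2.
  rewrite mulrAC ler_pdivrMr//.
  have h1 : 2 * H * (p%:R * C) <= 2 * H * (p%:R * `|C|).
    by rewrite !ler_wpM2l ?mulr_ge0// ler_norm.
  apply: (le_trans h1); rewrite /M mulrDr mulr1.
  have -> : e / 8 * 2 * (8 * H * p%:R * `|C| / e) = 2 * H * (p%:R * `|C|).
    by field; rewrite gt_eqF.
  by rewrite lerDl ltW// mulr_gt0.
have est d' (Om : measurableType d') (Q : probability Om R) (W : Om -> 'cV[R]_p) :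
    (forall j, L1 Q (fun w => W w j 0)) -> (forall j, Ex Q (fun w => `|W w j 0|) <= C) ->
    L1 Q (fun w => h (W w)) -> L1 Q (fun w => T (W w)) ->
    `|Ex Q (fun w => T (W w)) - Ex Q (fun w => h (W w))| <= 3 * (e / 8).
  move=> iW CW ihW iTW; rewrite -ExB//.
  have iS : L1 Q (fun w => \sum_j `|W w j 0|) by apply: L1_sum => j _; exact: L1_norm.
  apply: (@le_trans _ _ (Ex Q (fun w => e / 8 + 2 * H / M * \sum_j `|W w j 0|))).
    apply: norm_Ex_le_dom => [||w].
    - exact: (L1_measurable (L1B iTW ihW)).
    - by apply: L1D; [exact: L1_cst|exact: L1Z].
    - exact: bnd.
  rewrite ExD; [|exact: L1_cst|exact: L1Z].
  rewrite Ex_cst ExZ// Ex_sum; last by move=> j; exact: L1_norm.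
  rewrite (_ : 3 * (e / 8) = e / 8 + e / 8 * 2); last by ring.
  rewrite lerD2l (le_trans _ small)// ler_wpM2l//.
    by rewrite divr_ge0 ?mulr_ge0// ltW.
  have -> : p%:R * C = \sum_(j < p) C by rewrite sumr_const card_ord mulr_natl.
  by apply: ler_sum.
have estM := @est _ (@borelVec R p) mu (fun x => x) imu Cmu ih iT.
have : \forall n \near \oo, `|Ex mu T - Ex P (fun w => T (Z n w))| <= e / 8.
  by move/cvgrPdist_le : cT; apply.
apply: filterS => n hn.
have estZ := est _ _ P (Z n) (iZ n) (CZ n) (ihZ n) (iTZ n).
move: hn estM estZ; rewrite !ler_norml; lra.
Qed.

End CharacteristicCriterion.

(** * Bilinear forms and decomposition of positive semidefinite matrices *)

Section PositiveSemidefinite.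
Context {R : realType} {p : nat}.
Implicit Types (S : 'M[R]_p) (u v A : 'cV[R]_p).

Definition bilin S u v : R := (u^T *m S *m v) 0 0.

Lemma bilinE S u v : bilin S u v = \sum_k \sum_l u k 0 * S k l * v l 0.
Proof.
rewrite /bilin mxE exchange_big /=; apply: eq_bigr => l _.
by rewrite mxE mulr_suml; apply: eq_bigr => k _; rewrite mxE.
Qed.

Lemma dotcE u v : dotc u v = (u^T *m v) 0 0.
Proof. by rewrite mxE; apply: eq_bigr => j _; rewrite mxE. Qed.

Lemma bilinDl S u u' v : bilin S (u + u') v = bilin S u v + bilin S u' v.
Proof. by rewrite /bilin linearD/= !mulmxDl mxE. Qed.

Lemma bilinDr S u v v' : bilin S u (v + v') = bilin S u v + bilin S u v'.
Proof. by rewrite /bilin mulmxDr mxE. Qed.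

Lemma bilinZl S (c : R) u v : bilin S (c *: u) v = c * bilin S u v.
Proof. by rewrite /bilin linearZ/= -!scalemxAl mxE. Qed.

Lemma bilinZr S (c : R) u v : bilin S u (c *: v) = c * bilin S u v.
Proof. by rewrite /bilin -scalemxAr mxE. Qed.

Lemma bilin_delta S i j : bilin S (delta_mx i 0) (delta_mx j 0) = S i j.
Proof.
rewrite bilinE (bigD1 i)//= [X in _ + X]big1 ?addr0 => [|k ki]; last first.
  by rewrite big1// => l _; rewrite mxE (negbTE ki) !mul0r.
rewrite (bigD1 j)//= big1 ?addr0 => [|l lj]; rewrite !mxE !eqxx ?mul1r ?mulr1//.
by rewrite (negbTE lj) mulr0.
Qed.

Lemma bilin_sym S u v : S^T = S -> bilin S u v = bilin S v u.
Proof.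
move=> sS; rewrite !bilinE exchange_big /=; apply: eq_bigr => k _; apply: eq_bigr => l _.
by rewrite -[in LHS]sS mxE mulrC mulrA mulrAC mulrC mulrA.
Qed.

Lemma bilinDS S S' u v : bilin (S + S') u v = bilin S u v + bilin S' u v.
Proof. by rewrite /bilin mulmxDr mulmxDl mxE. Qed.

Lemma bilin_rank1 A u v : bilin (A *m A^T) u v = dotc u A * dotc v A.
Proof.
rewrite /bilin mulmxA -mulmxA mxE big_ord1 -dotcE; congr (_ * _).
by rewrite mxE; apply: eq_bigr => j _; rewrite mxE mulrC.
Qed.

Definition psd S := S^T = S /\ forall u, 0 <= bilin S u u.

(** When [S j j = 0] the form at [e_i + x e_j] is affine in [x]; with a nonzero slope the chosen [x]
    would bring it to -1. *)
Lemma psd_diag0 S i j : psd S -> S j j = 0 -> S i j = 0.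
Proof.
move=> [sS S0] Sjj; apply/eqP; apply: contraT => Sij.
pose x := - (S i i + 1) / (2 * S i j).
have := S0 (delta_mx i 0 + x *: delta_mx j 0).
rewrite !(bilinDl, bilinDr, bilinZl, bilinZr) !bilin_delta Sjj !mulr0 addr0.
have -> : S j i = S i j by rewrite -[in LHS]sS mxE.
rewrite (_ : _ + _ + _ = S i i + 2 * (x * S i j)); last by ring.
have -> : x * S i j = - (S i i + 1) / 2 by rewrite /x; field.
lra.
Qed.

(** Cholesky elimination: subtracting the square of a normalised column with nonzero pivot leaves a
    positive semidefinite Schur complement, and the number of nonzero diagonal entries drops. *)
Lemma psd_decomposition S : psd S -> exists s : seq 'cV[R]_p, S = \sum_(A <- s) A *m A^T.
Proof.
have [n] := ubnP #|[pred j | S j j != 0%R]|; elim: n S => // n IH S; rewrite ltnS => Sn pS.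
have [sS S0] := pS.
have [j Sj|none] := pickP [pred j | S j j != 0]; last first.
  exists [::]; rewrite big_nil; apply/matrixP => i j; rewrite mxE.
  by apply: psd_diag0 => //; have /negbFE/eqP := none j.
move: Sj => /= Sj; have c0 : 0 < S j j by rewrite lt_neqAle eq_sym Sj/= -bilin_delta.
pose A : 'cV[R]_p := (Num.sqrt (S j j))^-1 *: col j S.
have Ai i : A i 0 = (Num.sqrt (S j j))^-1 * S i j by rewrite !mxE.
have r0 : 0 < Num.sqrt (S j j) by rewrite sqrtr_gt0.
have rr : Num.sqrt (S j j) ^+ 2 = S j j by rewrite sqr_sqrtr// ltW.
have uA u : dotc u A = (Num.sqrt (S j j))^-1 * bilin S u (delta_mx j 0).
  rewrite /dotc bilinE mulr_sumr; apply: eq_bigr => k _.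
  rewrite Ai (bigD1 j)//= big1 => [|l lj]; rewrite !mxE ?eqxx ?mulr1 ?addr0.
    by rewrite mulrCA.
  by rewrite (negbTE lj) mulr0.
pose S' := S - A *m A^T.
have S'E i k : S' i k = S i k - A i 0 * A k 0.
  by rewrite !mxE big_ord1 !mxE.
have pS' : psd S'.
  split.
    by apply/matrixP => i k; rewrite mxE !S'E [A k 0 * _]mulrC -[in LHS]sS mxE.
  move=> u.
  have -> : bilin S' u u = bilin S u u - dotc u A ^+ 2.
    by rewrite /S' bilinDS expr2 -bilin_rank1 [X in _ + X]/bilin mulmxN mulNmx mxE.
  (* The point of the line [u + x e_j] where the form of [S] is least; its value there is the form
     of [S'] at [u]. *)
  pose v := u - (bilin S u (delta_mx j 0) / S j j) *: delta_mx j 0.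
  have := S0 v; rewrite /v -scaleNr !(bilinDl, bilinDr, bilinZl, bilinZr) bilin_delta.
  rewrite (bilin_sym (delta_mx j 0) u sS) uA exprMn exprVn rr.
  set b := bilin S u (delta_mx j 0); set q := bilin S u u.
  rewrite (_ : _ + _ = q - (S j j)^-1 * b ^+ 2)//; field; exact: lt0r_neq0.
have S'n : (#|[pred i | S' i i != 0%R]| < n)%N.
  apply: leq_trans Sn; apply: proper_card; apply/properP; split.
    apply/fintype.subsetP => i; rewrite !inE; apply: contraNN => /eqP Sii.
    have Sij : S i j = 0.
      by rewrite -[in LHS]sS mxE; apply: psd_diag0.
    by rewrite S'E Sii Ai Sij mulr0 mul0r subr0.
  exists j; rewrite !inE // negbK S'E Ai.
  rewrite (_ : _ * _ = S j j) ?subrr// -[in RHS]rr.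
  move: rr r0; set r := Num.sqrt (S j j) => rr r0.
  by rewrite -rr; field; rewrite gt_eqF.
have [s hs] := IH S' S'n pS'.
by exists (A :: s); rewrite big_cons -hs /S' addrC subrK.
Qed.

End PositiveSemidefinite.

(** * Existence of normal vectors with a given covariance, possibly degenerate *)

Section NormalVector.
Context {R : realType} {p : nat}.
Implicit Types (S : 'M[R]_p) (u A : 'cV[R]_p).

(** Besides the laws of linear forms it carries integrability and the characteristic function, which
    the convergence criterion needs. *)
Definition centered_normal (mu : probability (@borelVec R p) R) S := [/\
  forall u (B : set R), measurable B ->
    mu [set x | B (dotc u x)] = normal_law 0 (bilin S u u) B,
  forall j, L1 mu (fun x : 'cV[R]_p => x j 0) &
  forall u (b : R), Ex mu (fun x : 'cV[R]_p => cos (dotc u x + b)) =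
    expR (- (bilin S u u / 2)) * cos b].

Lemma L1_gauss1_id : L1 (gauss 1) (fun x : R => x).
Proof.
apply: (L1_le _ _ (L1D (L1_cst _ 1) L1_gauss1_sqr)) => [|x]; first by [].
rewrite -(real_normK (num_real x)); have := normr_ge0 x; nra.
Qed.

Lemma Ex_gauss1_cos (c : R) : Ex (gauss 1) (fun z : R => cos (c * z)) = expR (- (c ^+ 2 / 2)).
Proof.
have [->|c0] := eqVneq c 0.
  rewrite expr0n mul0r oppr0 expR0 -[RHS](Ex_cst (gauss 1)); congr Ex.
  by apply/funext => z; rewrite mul0r cos0.
have nc0 : 0 < `|c| by rewrite normr_gt0.
have mid : measurable_fun setT (@id R) by [].
have [_] := Ex_gauss_scale nc0 (@measurable_cos R) (L1_cos (gauss `|c|) mid).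
rewrite (_ : (fun x : R => cos (`|c| * x)) = (fun z => cos (c * z))); last first.
  apply/funext => z; have [c1|c1] := leP 0 c; first by rewrite ger0_norm.
  by rewrite ltr0_norm// mulNr cosN.
move=> <-; rewrite -gauss_cosE; last by rewrite exprn_even_gt0.
by rewrite /gauss_cos sqrtr_sqr.
Qed.

Lemma Ex_gauss1_sin (c : R) : Ex (gauss 1) (fun z : R => sin (c * z)) = 0.
Proof.
have [->|c0] := eqVneq c 0.
  rewrite -[RHS](Ex_cst (gauss 1)); congr Ex.
  by apply/funext => z; rewrite mul0r sin0.
have nc0 : 0 < `|c| by rewrite normr_gt0.
have mid : measurable_fun setT (@id R) by [].
have [i1] := Ex_gauss_scale nc0 (@measurable_sin R) (L1_sin (gauss `|c|) mid).
move=> /(etrans (esym (Ex_gauss_sin nc0))) e1.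
have [c1|c1] := leP 0 c.
  by rewrite e1; congr Ex; apply/funext => z; rewrite ger0_norm.
rewrite (_ : (fun z : R => sin (c * z)) = (fun z => - sin (`|c| * z))).
  by rewrite ExN// -e1 oppr0.
by apply/funext => z; rewrite ltr0_norm// mulNr sinN opprK.
Qed.

Lemma normal_vector0 : exists mu, centered_normal mu 0.
Proof.
exists (dirac (0 : borelVec p) : probability (@borelVec R p) R).
have mc (h : 'cV[R]_p -> R) : @measurable_fun _ _ (@borelVec R p) R setT h ->
    L1 (dirac (0 : borelVec p) : probability (@borelVec R p) R) h /\
    Ex (dirac (0 : borelVec p) : probability (@borelVec R p) R) h = h 0.
  move=> mh; split.
    apply/integrableP; split; first exact/measurable_EFinP.
    rewrite integral_dirac//.
      by rewrite diracT mul1e ltry.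
    by apply/measurableT_comp => //; exact/measurable_EFinP.
  rewrite Ex.unlock /Rintegral integral_dirac//; last exact/measurable_EFinP.
  by rewrite diracT mul1e.
have mdot u : @measurable_fun _ _ (@borelVec R p) R setT (fun x : 'cV[R]_p => dotc u x).
  by apply: (@measurable_dotc _ _ _ (@borelVec R p) (fun x => x)) => j; exact: measurable_coord.
have q0 u : bilin (0 : 'M[R]_p) u u = 0 by rewrite /bilin mulmx0 mul0mx mxE.
have d0 u : dotc u 0 = 0 by rewrite /dotc big1// => j _; rewrite mxE mulr0.
split.
- move=> u B mB; rewrite q0 /normal_law ltxx diracE.
  transitivity (((0 : 'cV[R]_p) \in [set x | B (dotc u x)])%:R%:E : \bar R); first by [].
  have -> // : ((0 : 'cV[R]_p) \in [set x | B (dotc u x)]) = (0 \in B).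
  by apply/idP/idP; rewrite !inE/= d0.
- by move=> j; apply: (mc _ _).1; exact: measurable_coord.
- move=> u b; rewrite (mc _ _).2; first by rewrite d0 q0 mul0r oppr0 expR0 mul1r add0r.
  by apply: measurableT_comp; [exact: measurable_cos|apply: measurable_funD].
Qed.

(** An independent standard normal multiple of [A] is added, so each linear form undergoes a
    one-dimensional convolution. Vanishing coefficients and vanishing variances are separate cases,
    because [gauss] describes only positive variances. *)
Lemma normal_vector_step mu S A : (forall u, 0 <= bilin S u u) ->
  centered_normal mu S -> exists mu', centered_normal mu' (S + A *m A^T).
Proof.
move=> S0 [lawS iS cS].
pose F (w : borelVec p * R) : 'cV[R]_p := (w.1 : 'cV[R]_p) + w.2 *: A.
have mF : @measurable_fun _ _ _ (@borelVec R p) setT F.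
  apply: measurable_borelVec => j.
  rewrite (_ : (fun w => F w j 0) = (fun w => (w.1 : 'cV[R]_p) j 0 + A j 0 * w.2)); last first.
    by apply/funext => w; rewrite !mxE mulrC.
  apply: measurable_funD.
    apply: (@measurableT_comp _ _ _ _ (@borelVec R p) _ (fun x : 'cV[R]_p => x j 0)).
      exact: measurable_coord.
    exact: measurable_fst.
  by apply: measurable_funM => //; exact: measurable_snd.
have dF u w : dotc u (F w) = dotc u A * w.2 + dotc u (w.1 : 'cV[R]_p).
  rewrite /dotc mulr_suml -big_split; apply: eq_bigr => j _; rewrite /F /= !mxE; ring.
have mdot u : @measurable_fun _ _ (@borelVec R p) R setT (fun x : 'cV[R]_p => dotc u x).
  by apply: (@measurable_dotc _ _ _ (@borelVec R p) (fun x => x)) => j; exact: measurable_coord.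
have mid : measurable_fun setT (@id R) by [].
have mmul (c : R) : measurable_fun setT (fun z : R => c * z) by exact: measurable_funM.
have Q u : bilin (S + A *m A^T) u u = bilin S u u + dotc u A ^+ 2.
  by rewrite bilinDS bilin_rank1 expr2.
exists (law (prodP mu (gauss 1)) mF); split.
- move=> u B mB; rewrite Q; set c := dotc u A; set s2 := bilin S u u.
  have s20 : 0 <= s2 by exact: S0.
  transitivity (prodP mu (gauss 1) [set w : borelVec p * R | B (c * w.2 + dotc u (w.1 : 'cV[R]_p))]).
    by congr (prodP mu (gauss 1) _); apply/seteqP; split => w /=; rewrite /preimage/= dF.
  have [c0|c0] := eqVneq c 0.
    have -> : [set w : borelVec p * R | B (c * w.2 + dotc u (w.1 : 'cV[R]_p))] =
        [set x | B (dotc u x)] `*` setT.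
      apply/seteqP; split => w /=; rewrite c0 mul0r add0r; last by case.
      by split.
    have mS : measurable ([set x | B (dotc u x)] : set (@borelVec R p)).
      by rewrite -[X in measurable X]setTI; exact: (mdot u measurableT B mB).
    rewrite prodPE//.
    rewrite [X in (_ * X)%E](_ : _ = 1%E) ?mule1; last exact: probability_setT.
    rewrite (lawS _ _ mB) -/s2 c0 expr0n addr0; reflexivity.
  pose k (y : R) : \bar R := gauss 1 [set z | B (c * z + y)].
  transitivity (\int[mu]_x k (dotc u (x : 'cV[R]_p)))%E.
    transitivity (\int[mu]_x gauss 1 (xsection [set w : borelVec p * R | B (c * w.2 + dotc u (w.1 : 'cV[R]_p))%R] x))%E.
      by [].
    congr (integral _ _ _); apply/funext => x; congr (gauss 1 _).
    by apply/seteqP; split => z; rewrite /xsection/= inE.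
  have mk : measurable_fun setT k by exact: measurable_gauss1_affine.
  have k0 y : (0 <= k y)%E by [].
  transitivity (\int[law mu (mdot u)]_y k y)%E.
    by rewrite /law ge0_integral_distribution.
  have c2 : 0 < c ^+ 2 by rewrite exprn_even_gt0.
  rewrite /normal_law ltr_wpDl// -gauss_prob.
  move: s20; rewrite le_eqVlt => /orP[/eqP s20|s20].
    transitivity (\int[dirac (0%R : R)]_y k y)%E.
      apply: eq_measure_integral => D mD _.
      transitivity (mu [set x | D (dotc u x)]); first by [].
      rewrite (lawS _ _ mD) -/s2 -s20 /normal_law ltxx; reflexivity.
    rewrite integral_dirac; [|exact: measurableT|exact: mk].
    rewrite diracT mul1e /k (gauss1_affine 0 c0 mB) -s20 add0r sqrtr_sqr gauss_prob; reflexivity.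
  transitivity (\int[gauss (Num.sqrt s2)]_y k y)%E.
    apply: eq_measure_integral => D mD _.
    transitivity (mu [set x | D (dotc u x)]); first by [].
    rewrite (lawS _ _ mD) -/s2 /normal_law s20; exact/esym/gauss_prob.
  have r0 : 0 < Num.sqrt s2 by rewrite sqrtr_gt0.
  rewrite /k (gauss_conv r0 c0 mB) sqr_sqrtr; [reflexivity|exact: ltW].
- move=> j; apply: L1_law; first exact: measurable_coord.
  rewrite (_ : _ \o _ = (fun w : borelVec p * R => (w.1 : 'cV[R]_p) j 0 + A j 0 * w.2)); last first.
    by apply/funext => w; rewrite /= !mxE mulrC.
  apply: L1D.
    exact: (@L1_fst _ _ (@borelVec R p) R R mu (gauss 1) (fun x : 'cV[R]_p => x j 0) (iS j)).
  apply: L1Z; exact: (@L1_snd _ _ (@borelVec R p) R R mu (gauss 1) _ L1_gauss1_id).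
- move=> u b; rewrite Q; set c := dotc u A.
  have mdotb : @measurable_fun _ _ (@borelVec R p) R setT (fun x : 'cV[R]_p => dotc u x + b).
    by apply: measurable_funD.
  rewrite Ex_law; last 2 first.
  + by apply: measurableT_comp; [exact: measurable_cos|exact: mdotb].
  + apply: (@L1_cos _ _ _ _ (fun w => dotc u (F w) + b)); apply: measurable_funD => //.
    exact: (measurableT_comp (mdot u) mF).
  have [j1 f1] := Ex_prod (L1_cos mu mdotb) (L1_cos (gauss 1) (mmul c)).
  have [j2 f2] := Ex_prod (L1_sin mu mdotb) (L1_sin (gauss 1) (mmul c)).
  transitivity (Ex (prodP mu (gauss 1)) (fun w =>
      cos (dotc u (w.1 : 'cV[R]_p) + b) * cos (c * w.2) -
      sin (dotc u (w.1 : 'cV[R]_p) + b) * sin (c * w.2))).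
    congr Ex; apply/funext => w /=; rewrite dF -cosD; congr cos; rewrite -/c; ring.
  rewrite (ExB j1 j2) f1 f2 Ex_gauss1_sin Ex_gauss1_cos cS mulr0 subr0.
  rewrite mulrAC -expRD; congr (expR _ * _); rewrite mulrDl; ring.
Qed.

Lemma normal_vector_exists S : psd S -> exists mu, centered_normal mu S.
Proof.
move=> /psd_decomposition[s ->]; elim: s => [|A s [mu IH]].
  by rewrite big_nil; exact: normal_vector0.
rewrite big_cons addrC; apply: normal_vector_step IH => u.
elim: (s) => [|B r IH]; first by rewrite big_nil /bilin mulmx0 mul0mx mxE.
by rewrite big_cons bilinDS addr_ge0// bilin_rank1 -expr2 sqr_ge0.
Qed.

Lemma centered_normal_law mu S : psd S -> centered_normal mu S ->
  is_normal_vector_law mu 0 S.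
Proof.
move=> [sS S0] [lawS _ _]; split => // u; split; first exact: S0.
move=> B mB; rewrite mulmx0 mxE.
have -> : [set x : 'cV[R]_p | B ((u^T *m x) 0 0)] = [set x | B (dotc u x)].
  by apply/funext => x; rewrite /= dotcE.
exact: lawS.
Qed.

End NormalVector.

(** * Positivity of the Cauchy kernel *)

Section CauchyKernel.
Context {R : realType} {p : nat}.

(** Elimination through [(s_k + s_i)(s_l + s_i) = 2 s_i (s_k + s_l) + (s_k - s_i)(s_l - s_i)]: a
    square splits off, and a kernel form in [y] with [y_i = 0] remains. This is why dividing a
    covariance by [c k + c l - 1] keeps it positive. *)
Lemma cauchy_kernel_ge0 (s x : 'I_p -> R) : (forall k, 0 < s k) ->
  0 <= \sum_k \sum_l x k * x l / (s k + s l).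
Proof.
move=> s0; have [n] := ubnP #|[pred k | x k != 0%R]|; elim: n x => // n IH x; rewrite ltnS => xn.
have [i /= xi|none] := pickP [pred k | x k != 0%R]; last first.
  rewrite big1// => k _; rewrite big1// => l _.
  by have /negbFE/eqP -> := none k; rewrite !mul0r.
have sp k l : s k + s l != 0 by rewrite gt_eqF// addr_gt0.
pose y k := x k * (s k - s i) / (s k + s i).
have -> : \sum_k \sum_l x k * x l / (s k + s l) =
    2 * s i * (\sum_k x k / (s k + s i)) ^+ 2 + \sum_k \sum_l y k * y l / (s k + s l).
  have -> : (\sum_k x k / (s k + s i)) ^+ 2 =
      \sum_k \sum_l x k / (s k + s i) * (x l / (s l + s i)).
    by rewrite expr2 mulr_suml; apply: eq_bigr => k _; rewrite mulr_sumr.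
  rewrite mulr_sumr -big_split/=; apply: eq_bigr => k _.
  rewrite mulr_sumr -big_split/=; apply: eq_bigr => l _.
  by rewrite /y; field; rewrite !sp.
apply: addr_ge0; first by rewrite mulr_ge0 ?sqr_ge0// mulr_ge0// ltW.
apply: IH; apply: leq_trans xn; apply: proper_card; apply/properP; split.
  apply/fintype.subsetP => k; rewrite !inE; apply: contraNN => /eqP xk.
  by rewrite /y xk !mul0r.
by exists i; rewrite !inE// negbK /y subrr mulr0 mul0r.
Qed.

End CauchyKernel.

(** * The limit covariance and the one-step relation of its characteristic function *)

Section GaussianTarget.
Context {R : realType} {p : nat}.
Implicit Types (u v : 'cV[R]_p) (M : 'M[R]_p).

Definition norm1 u : R := \sum_j `|u j 0|.

Lemma norm1_ge0 u : 0 <= norm1 u. Proof. exact: sumr_ge0. Qed.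

Lemma norm1_coord u j : `|u j 0| <= norm1 u.
Proof. by rewrite /norm1 (bigD1 j)//= lerDl sumr_ge0. Qed.

Lemma norm_dotc_le u (x : 'I_p -> R) (b : R) : (forall j, `|x j| <= b) ->
  `|\sum_j u j 0 * x j| <= norm1 u * b.
Proof.
move=> xb; apply: (le_trans (ler_norm_sum _ _ _)); rewrite mulr_suml.
by apply: ler_sum => j _; rewrite normrM ler_wpM2l.
Qed.

Lemma norm_bilin_le M u (b : R) : (forall k l, `|M k l| <= b) ->
  `|bilin M u u| <= b * norm1 u ^+ 2.
Proof.
move=> Mb; rewrite bilinE (_ : b * norm1 u ^+ 2 = norm1 u * (norm1 u * b)); last by ring.
have -> : \sum_k \sum_l u k 0 * M k l * u l 0 = \sum_k u k 0 * \sum_l u l 0 * M k l.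
  by apply: eq_bigr => k _; rewrite mulr_sumr; apply: eq_bigr => l _; ring.
by apply: norm_dotc_le => k; exact: norm_dotc_le.
Qed.

Lemma mx_bound M : exists2 b : R, 0 <= b & forall k l, `|M k l| <= b.
Proof.
exists (\sum_k \sum_l `|M k l|).
  by rewrite sumr_ge0// => k _; exact: sumr_ge0.
move=> k l; rewrite (bigD1 k)//= (bigD1 l)//= -addrA lerDl addr_ge0 ?sumr_ge0//.
by move=> i _; exact: sumr_ge0.
Qed.

Context (c : 'I_p -> R) (kap Cm : R).
Hypotheses (kap0 : 0 < kap) (c_kap : forall j, 1 + 4 * kap <= 2 * c j)
  (c_Cm : forall j, c j <= Cm).
Context (Phi : 'M[R]_p).

(** The solution of the Lyapunov equation [(c k + c l - 1) * S k l = Phi k l]; the term -1 comes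
    from the growth of the normalisation. *)
Definition limit_cov : 'M[R]_p := \matrix_(k, l) (Phi k l / (c k + c l - 1)).

Let c_gt k l : 0 < c k + c l - 1.
Proof. by have := c_kap k; have := c_kap l; have := kap0; lra. Qed.

(* Up to smaller terms, the step of size [g] multiplies the [j]-th coordinate of
   the error, normalised by the square root of the number of steps, by [scal g j]. *)
Definition scal (g : R) (j : 'I_p) : R := (1 - c j * g) / Num.sqrt (1 - g).

Definition scalv (g : R) u : 'cV[R]_p := \col_j (scal g j * u j 0).

(** After squaring, the first-order requirement is [1 + 2 * kap <= 2 * c j]; the other [2 * kap]
    granted by [c_kap] pays for the term [c j ^+ 2 * g]. *)
Lemma scal_bounds g j : 0 < g -> g <= 2^-1 -> Cm * g <= 1 -> Cm ^+ 2 * g <= 2 * kap ->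
  kap * g <= 1 -> 0 <= scal g j <= 1 - kap * g.
Proof.
move=> g0 g2 Cg C2g kg.
have cj : 0 < c j by have := c_kap j; have := kap0; lra.
have cC := c_Cm j.
have r0 : 0 < Num.sqrt (1 - g) by rewrite sqrtr_gt0; lra.
have cg1 : c j * g <= 1 by apply: le_trans Cg; rewrite ler_pM2r.
rewrite divr_ge0 ?(ltW r0) ?subr_ge0//= ler_pdivrMr//.
rewrite -(@ler_pXn2r _ 2)// ?nnegrE ?subr_ge0//; last first.
  by rewrite mulr_ge0 ?subr_ge0// ltW.
rewrite exprMn sqr_sqrtr; last by lra.
have c2 : c j ^+ 2 * g <= 2 * kap.
  by apply: le_trans C2g; rewrite ler_pM2r// lerXn2r ?nnegrE// ltW// (lt_le_trans cj).
have ck := c_kap j.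
have q1 : c j ^+ 2 * g * g <= 2 * kap * g by rewrite ler_pM2r.
have q2 : 0 <= (2 * c j - 1 - 4 * kap) * g by rewrite mulr_ge0 ?(ltW g0)//; lra.
have q3 : 0 <= kap * g * g by rewrite !mulr_ge0// ltW.
have q4 : 0 <= (kap * g) ^+ 2 * (1 - g) by rewrite mulr_ge0 ?sqr_ge0//; lra.
clear -q1 q2 q3 q4; nra.
Qed.

Lemma norm1_scalv g u : (forall j, 0 <= scal g j <= 1 - kap * g) ->
  norm1 (scalv g u) <= (1 - kap * g) * norm1 u.
Proof.
move=> sb; rewrite /norm1 mulr_sumr; apply: ler_sum => j _; rewrite mxE normrM.
by have /andP[s0 s1] := sb j; rewrite ger0_norm// ler_wpM2r.
Qed.

(** The Lyapunov equation cancels the first order in [g], leaving exactly [g ^+ 2 / (1 - g)] times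
    the form of [N]. *)
Lemma limit_cov_stationary : exists2 C : R, 0 <= C & forall g u, 0 < g -> g <= 2^-1 ->
  `|bilin limit_cov u u - bilin limit_cov (scalv g u) (scalv g u) - g * bilin Phi u u| <=
  C * g ^+ 2 * norm1 u ^+ 2.
Proof.
pose N : 'M[R]_p := \matrix_(k, l) (limit_cov k l * (c k + c l - 1 - c k * c l)).
have [b b0 Nb] := mx_bound N.
exists (2 * b); first by rewrite mulr_ge0.
move=> g u g0 g2.
have g1 : 0 < 1 - g by lra.
have rr : Num.sqrt (1 - g) ^+ 2 = 1 - g by rewrite sqr_sqrtr// ltW.
have r0 : 0 < Num.sqrt (1 - g) by rewrite sqrtr_gt0.
have -> : bilin limit_cov u u - bilin limit_cov (scalv g u) (scalv g u) - g * bilin Phi u u =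
    g ^+ 2 / (1 - g) * bilin N u u.
  rewrite !bilinE !mulr_sumr -!sumrB; apply: eq_bigr => k _.
  rewrite !mulr_sumr -!sumrB; apply: eq_bigr => l _.
  have -> : Phi k l = limit_cov k l * (c k + c l - 1).
    by rewrite mxE divfK// gt_eqF.
  rewrite !mxE /scal -/(limit_cov k l).
  have -> : (1 - c k * g) / Num.sqrt (1 - g) * u k 0 * (Phi k l / (c k + c l - 1)) *
      ((1 - c l * g) / Num.sqrt (1 - g) * u l 0) =
      (1 - c k * g) * (1 - c l * g) / (1 - g) * u k 0 * u l 0 * (Phi k l / (c k + c l - 1)).
    rewrite -[X in _ = _ / X * _ * _ * _]rr.
    by move: (Num.sqrt _) r0 => r r0; field; rewrite !gt_eqF.
  by field; rewrite !gt_eqF.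
rewrite normrM ger0_norm ?divr_ge0 ?sqr_ge0 ?(ltW g1)//.
apply: (@le_trans _ _ (g ^+ 2 / (1 - g) * (b * norm1 u ^+ 2))).
  by rewrite ler_wpM2l ?divr_ge0 ?sqr_ge0 ?(ltW g1)// norm_bilin_le.
have -> : 2 * b * g ^+ 2 * norm1 u ^+ 2 = g ^+ 2 * 2 * (b * norm1 u ^+ 2) by ring.
apply: ler_wpM2r; first by rewrite mulr_ge0 ?sqr_ge0.
apply: ler_wpM2l; first exact: sqr_ge0.
by rewrite invf_ple ?posrE//; lra.
Qed.

Lemma expRN_taylor (z : R) : `|z| <= 2^-1 -> `|expR (- z) - 1 + z| <= 2 * z ^+ 2.
Proof.
move=> z1; have h1 := expR_ge1Dx (- z).
rewrite ger0_norm; last by lra.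
have h2 : expR (- z) * (1 + z) <= 1.
  rewrite -[leRHS]expR0 -[0](addNr z) expRD ler_pM2l ?expR_gt0//; exact: expR_ge1Dx.
move: z1; rewrite ler_norml => /andP[z1 z2].
move: h1 h2; generalize (expR (- z)) => y h1 h2; nra.
Qed.

Hypothesis Sigma0 : forall u, 0 <= bilin limit_cov u u.

Definition target u : R := expR (- (bilin limit_cov u u / 2)).

Lemma target_le1 u : 0 <= target u <= 1.
Proof. by rewrite expR_ge0 /target -expR0 ler_expR oppr_le0 divr_ge0. Qed.

Lemma target_near1 : exists2 C : R, 0 <= C & forall u, `|target u - 1| <= C * norm1 u ^+ 2.
Proof.
have [b b0 Sb] := mx_bound limit_cov; exists b => // u.
have /andP[t0 t1] := target_le1 u; have s0 := Sigma0 u.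
have h := expR_ge1Dx (- (bilin limit_cov u u / 2)); rewrite -/(target u) in h.
have h2 := norm_bilin_le u Sb; rewrite ger0_norm// in h2.
rewrite ler0_norm; last by lra.
lra.
Qed.

(** The Gaussian value obeys the same one-step relation as the iterates: passing from [scalv g u] to
    [u] multiplies it by [exp (- z)] with [z] close to [g / 2 * bilin Phi u u]. One factor [norm1 u]
    is kept in the error and the others are bounded by [rho]. *)
Lemma target_step (rho : R) : 0 < rho -> exists2 C : R, 0 <= C &
  exists2 g0 : R, 0 < g0 & forall g u, 0 < g -> g <= g0 -> norm1 u <= rho ->
  `|target u - (1 - g / 2 * bilin Phi u u) * target (scalv g u)| <= C * g ^+ 2 * norm1 u.
Proof.
move=> rho0.
have [C1 C10 H1] := limit_cov_stationary.
have [b b0 Pb] := mx_bound Phi.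
pose K := (b + C1) * rho ^+ 2.
have K0 : 0 <= K by rewrite /K mulr_ge0 ?addr_ge0 ?sqr_ge0.
exists (2 * ((b + C1) * K * rho) + C1 * rho).
  by rewrite addr_ge0// !mulr_ge0 ?addr_ge0// ltW.
exists (Num.min 2^-1 (2 * (K + 1))^-1).
  by rewrite lt_min !invr_gt0 ltr0n/= mulr_gt0 ?ltr_wpDl.
move=> g u gp; rewrite le_min => /andP[g2 gK] un.
have u0 := norm1_ge0 u.
set q := bilin limit_cov u u; set q' := bilin limit_cov (scalv g u) (scalv g u).
set f := bilin Phi u u.
have He := H1 g u gp g2; rewrite -/q -/q' -/f in He.
have Hf : `|f| <= b * norm1 u ^+ 2 by exact: norm_bilin_le.
set z := (q - q') / 2.
have g21 : g ^+ 2 <= g by rewrite expr2 ler_piMl ?(ltW gp)//; lra.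
have zb : `|z| <= g * ((b + C1) * norm1 u ^+ 2).
  have -> : z = (q - q' - g * f) / 2 + g * f / 2 by rewrite /z; lra.
  have h1 : `|(q - q' - g * f) / 2| <= g * (C1 * norm1 u ^+ 2).
    rewrite normrM [`|2^-1|]ger0_norm// ler_pdivrMr//.
    apply: (le_trans He).
    have C1u : 0 <= C1 * norm1 u ^+ 2 by rewrite mulr_ge0 ?sqr_ge0.
    rewrite (_ : C1 * g ^+ 2 * norm1 u ^+ 2 = (C1 * norm1 u ^+ 2) * g ^+ 2); last by ring.
    move: (C1 * norm1 u ^+ 2) C1u => y C1u.
    by have := ler_wpM2l C1u g21; have := mulr_ge0 C1u (ltW gp); lra.
  have h2 : `|g * f / 2| <= g * (b * norm1 u ^+ 2).
    rewrite !normrM [`|2^-1|]ger0_norm// (gtr0_norm gp) -mulrA ler_pM2l//.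
    rewrite ler_pdivrMr//; apply: (le_trans Hf); rewrite mulr_natr mulr2n lerDl.
    by rewrite mulr_ge0 ?sqr_ge0.
  apply: (le_trans (ler_normD _ _)); apply: (le_trans (lerD h1 h2)).
  by rewrite -mulrDr -mulrDl addrC.
have un2 : norm1 u ^+ 2 <= rho ^+ 2 by rewrite lerXn2r ?nnegrE// ltW.
have zK : `|z| <= g * K.
  by apply: (le_trans zb); rewrite ler_pM2l// ler_wpM2l ?addr_ge0.
have z1 : `|z| <= 2^-1.
  have : g * (2 * (K + 1)) <= 1 by rewrite -ler_pdivlMr ?div1r// mulr_gt0// ltr_wpDl.
  by move: zK; lra.
have -> : target u = target (scalv g u) * expR (- z).
  by rewrite /target -expRD -/q -/q' /z; congr expR; lra.
rewrite (_ : _ - _ = target (scalv g u) * ((expR (- z) - 1 + z) - (q - q' - g * f) / 2)); last first.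
  by rewrite /z; field.
have /andP[t0 t1] := target_le1 (scalv g u).
rewrite normrM (ger0_norm t0); apply: (le_trans (ler_piMl _ t1)) => //.
apply: (le_trans (ler_normB _ _)).
have h1 : `|expR (- z) - 1 + z| <= 2 * ((b + C1) * K * rho) * g ^+ 2 * norm1 u.
  apply: (le_trans (expRN_taylor z1)); rewrite -(real_normK (num_real z)) expr2.
  have -> : 2 * ((b + C1) * K * rho) * g ^+ 2 * norm1 u = 2 * ((g * ((b + C1) * (norm1 u * rho))) * (g * K)) by ring.
  rewrite ler_pM2l//; apply: ler_pM => //; apply: (le_trans zb); rewrite ler_pM2l// ler_wpM2l ?addr_ge0//.
  by rewrite expr2 ler_wpM2l.
have h2 : `|(q - q' - g * f) / 2| <= C1 * rho * g ^+ 2 * norm1 u.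
  rewrite normrM [`|2^-1|]ger0_norm// ler_pdivrMr//; apply: (le_trans He).
  have -> : C1 * rho * g ^+ 2 * norm1 u * 2 = C1 * g ^+ 2 * (norm1 u * rho * 2) by ring.
  apply: ler_wpM2l; first by rewrite mulr_ge0 ?sqr_ge0.
  rewrite expr2 -mulrA ler_wpM2l//.
  by apply: (le_trans un); rewrite ler_peMr ?ltW// ltr1n.
by apply: (le_trans (lerD h1 h2)); rewrite -!mulrDl.
Qed.

End GaussianTarget.

(** * The recursion for the tangent and its characteristic functions *)

Lemma measurable_norm_comp d (T : measurableType d) (R : realType) (F : T -> R) :
  measurable_fun setT F -> measurable_fun setT (fun w => `|F w|).
Proof. by move=> mF; apply: (measurableT_comp (@normr_measurable R setT) mF). Qed.

Ltac mfun := repeat first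
  [ lazymatch goal with
    | |- measurable_fun _ (fun _ => (_ - _)%R) => apply: measurable_funB
    | |- measurable_fun _ (fun _ => (_ + _)%R) => apply: measurable_funD
    | |- measurable_fun _ (fun _ => (_ * _)%R) => apply: measurable_funM
    | |- measurable_fun _ (fun _ => (_ ^+ _)%R) => apply: measurable_funX
    | |- measurable_fun _ (fun _ => `|_|%R) => apply: measurable_norm_comp
    | |- measurable_fun _ (fun _ => Num.min _ _) => apply: measurable_minr
    | |- measurable_fun _ (fun _ => cos _) =>
        apply: (@measurableT_comp _ _ _ _ _ _ (@cos _)); [exact: measurable_cos|]
    | |- measurable_fun _ (fun _ => sin _) =>
        apply: (@measurableT_comp _ _ _ _ _ _ (@sin _)); [exact: measurable_sin|]
    | |- measurable_fun _ (fun _ => (\sum_(_ <- _) _)%R) =>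
        apply: measurable_sum => ?
    end
  | exact: measurable_cst | done ].

(* [x n j] stands for [tan (pi D) / pi], where [D] is the error of the [j]-th
   coordinate after [n] steps; [A] is the noise and [M] the random slope of the
   drift. *)
Section LinearizedRecursion.
Context d (Omega : measurableType d) (R : realType) (P : probability Omega R).
Context (I : choiceType) (Z : I -> {RV P >-> R}) (Zindep : mutually_independent Z).
Context (past cur : nat -> set I) (past_cur : forall n, past n `&` cur n = set0).
Context (p : nat) (x A M : nat -> 'I_p -> Omega -> R) (H : nat -> Omega -> R).
Hypotheses (mx : forall n j, meas_on Z (past n) (x n j))
  (mA : forall n j, meas_on Z (cur n) (A n j))
  (mM : forall n j, meas_on Z (cur n) (M n j))
  (mH : forall n, meas_on Z (cur n) (H n)).
Arguments mx : clear implicits.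
Arguments mA : clear implicits.
Arguments mM : clear implicits.
Arguments mH : clear implicits.
Context (T K C k Cm kap : R) (c : 'I_p -> R) (Phi : 'M[R]_p).
Hypotheses (T0 : 0 <= T) (xT : forall n j w, `|x n j w| <= T)
  (H1 : forall n w, 1 <= H n w)
  (AH : forall n j w, `|A n j w| <= H n w) (MH : forall n j w, `|M n j w| <= H n w)
  (iH : forall n, L1 P (fun w => H n w ^+ 2))
  (EH : forall n, Ex P (fun w => H n w ^+ 2) <= K)
  (HLind : forall e : R, 0 < e -> exists2 a : R, 0 < a &
     forall n, Ex P (fun w => H n w ^+ 2 * Num.min 1 (a * H n w)) <= e)
  (EA : forall n j, Ex P (A n j) = 0) (EM : forall n j, Ex P (M n j) = c j)
  (EAA : forall n j l, Ex P (fun w => A n j w * A n l w) = Phi j l)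
  (kap0 : 0 < kap) (c_kap : forall j, 1 + 4 * kap <= 2 * c j)
  (c_Cm : forall j, c j <= Cm) (Cm_ge0 : 0 <= Cm) (C0 : 0 <= C) (k0 : 0 <= k).
Notation gam := (@harmonic R).
Hypothesis step_sqr : forall n j w, x n.+1 j w ^+ 2 <=
  x n j w ^+ 2 + 2 * x n j w *
    (gam n * ((1 - k * x n j w ^+ 2) * A n j w - M n j w * x n j w)) +
  C * (gam n ^+ 2 * H n w ^+ 2).
Hypothesis step_lin : forall n j w,
  `|x n.+1 j w - x n j w -
    gam n * ((1 - k * x n j w ^+ 2) * A n j w - M n j w * x n j w)| <=
  C * (gam n ^+ 2 * H n w ^+ 2 + gam n * (H n w * x n j w ^+ 2)).

Let H0 n w : 0 < H n w. Proof. exact: lt_le_trans ltr01 (H1 n w). Qed.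
Let HH n w : H n w <= H n w ^+ 2. Proof. by rewrite expr2 ler_peMr// ltW. Qed.
Let K1 : 1 <= K.
Proof.
apply: le_trans (EH 0%N); rewrite -(Ex_cst P 1); apply: Ex_le => //; first exact: L1_cst.
by move=> w; apply: le_trans (HH 0 w).
Qed.
Let gam0 n : 0 < gam n. Proof. exact: harmonic_gt0. Qed.
Let gam1 n : gam n <= 1. Proof. by rewrite /harmonic/= invf_le1// ler1n. Qed.

Let Mx n j : measurable_fun setT (x n j). Proof. exact: meas_on_measurable (mx n j). Qed.
Let MA n j : measurable_fun setT (A n j). Proof. exact: meas_on_measurable (mA n j). Qed.
Let MM n j : measurable_fun setT (M n j). Proof. exact: meas_on_measurable (mM n j). Qed.
Let MH' n : measurable_fun setT (H n). Proof. exact: meas_on_measurable (mH n). Qed.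

Let bndL n (F : Omega -> R) (b : R) : 0 <= b -> measurable_fun setT F ->
  (forall w, `|F w| <= b * H n w ^+ 2) -> L1 P F.
Proof. by move=> b0 mF Fb; apply: (L1_le mF Fb); exact: L1Z. Qed.

Let LA n j : L1 P (A n j).
Proof. by apply: (@bndL n (A n j) 1) => // w; rewrite mul1r (le_trans (AH n j w)). Qed.
Let LM n j : L1 P (M n j).
Proof. by apply: (@bndL n (M n j) 1) => // w; rewrite mul1r (le_trans (MH n j w)). Qed.
Let Lx2 n j : L1 P (fun w => x n j w ^+ 2).
Proof.
apply: (@L1_bounded _ _ _ _ _ (T ^+ 2)) => [|w]; first by mfun.
by rewrite normrX lerXn2r ?nnegrE.
Qed.

(** [A n j] is centered and independent of the past, so its entire coefficient, cubic part included,
    vanishes in mean. The slope contributes [- 2 * c j * gam n] times the second moment, and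
    [2 * c j >= 1 + 4 * kap]. *)
Lemma iterate_sqr_rate : exists2 M0 : R, 0 <= M0 &
  forall n, n%:R * \sum_j Ex P (fun w => x n j w ^+ 2) <= M0.
Proof.
apply: (@recursion_rate R (1 + 4 * kap) (p%:R * (C * K)) (p%:R * T ^+ 2)).
- by rewrite ltrDl mulr_gt0.
- by rewrite !mulr_ge0// (le_trans ler01).
- move=> n; rewrite sumr_ge0/= => [|j _]; last by apply: Ex_ge0 => w; exact: sqr_ge0.
  rewrite -[X in X%:R]card_ord -sum1_card natr_sum mulr_suml; apply: ler_sum => j _.
  rewrite mul1r -(Ex_cst P (T ^+ 2)); apply: Ex_le => //; first exact: L1_cst.
  by move=> w; rewrite -(real_normK (num_real (x n j w))) lerXn2r ?nnegrE.
move=> n; rewrite -[X in X%:R * (C * K)]card_ord -sum1_card natr_sum !mulr_suml mulr_sumr -big_split/=.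
apply: ler_sum => j _; rewrite mul1r.
have past_fun : meas_on Z (past n) (fun w => 2 * x n j w * (1 - k * x n j w ^+ 2)).
  by rewrite /meas_on; mfun; exact: mx.
have past_L1 : L1 P (fun w => 2 * x n j w * (1 - k * x n j w ^+ 2)).
  apply: (@L1_bounded _ _ _ _ _ (2 * T * (1 + k * T ^+ 2))) => [|w]; first exact: meas_on_measurable past_fun.
  rewrite !normrM ger0_norm// ler_pM//; first by rewrite ler_wpM2l.
  rewrite (le_trans (ler_normB _ _))// normr1 normrM (ger0_norm k0) lerD2l ler_wpM2l// normrX.
  by rewrite lerXn2r ?nnegrE.
have past_x2 : meas_on Z (past n) (fun w => x n j w ^+ 2) by rewrite /meas_on; mfun; exact: mx.
have i1 : L1 P (fun w => 2 * x n j w * (1 - k * x n j w ^+ 2) * A n j w).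
  exact: (meas_on_mul_L1 Zindep (past_cur n) past_fun (mA n j)).
have i2 : L1 P (fun w => x n j w ^+ 2 * M n j w).
  exact: (meas_on_mul_L1 Zindep (past_cur n) past_x2 (mM n j)).
have e1 := meas_on_mul_Ex Zindep (past_cur n) past_fun (mA n j) past_L1 (LA n j).
have e2 := meas_on_mul_Ex Zindep (past_cur n) past_x2 (mM n j) (Lx2 n j) (LM n j).
rewrite EA mulr0 in e1; rewrite EM in e2.
apply: (@le_trans _ _ (Ex P (fun w => x n j w ^+ 2 +
    (gam n * (2 * x n j w * (1 - k * x n j w ^+ 2) * A n j w) +
     (- (2 * gam n) * (x n j w ^+ 2 * M n j w) + C * gam n ^+ 2 * H n w ^+ 2))))).
  apply: Ex_le => // [|w]; last by apply: (le_trans (step_sqr n j w)); rewrite le_eqVlt; apply/orP; left; apply/eqP; ring.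
  by do ![apply: L1D => //]; apply: L1Z.
rewrite !ExD ?ExZ//; do ?[apply: L1D => //]; do ?[exact: L1Z].
rewrite e1 e2 mulr0 add0r.
have g0 := gam0 n; have x0 : 0 <= Ex P (fun w => x n j w ^+ 2) by apply: Ex_ge0 => w; exact: sqr_ge0.
rewrite addrA lerD//; last first.
  rewrite /harmonic/= exprVn mulrAC ler_wpM2r ?invr_ge0 ?exprn_ge0// ler_wpM2l//.
rewrite (_ : (1 + 4 * kap) / n.+1%:R = (1 + 4 * kap) * gam n)//.
have := ler_wpM2l (mulr_ge0 (ltW g0) x0) (c_kap j).
by move: (Ex _ _) (gam n) => y g; lra.
Qed.


Let Cm0 (j : 'I_p) : 0 < c j.
Proof. by have := c_kap j; have := kap0; lra. Qed.

Notation root n := (@Num.sqrt R n%:R).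
Notation s n := (Num.sqrt (gam n)).

Let s0 n : 0 < s n. Proof. by rewrite sqrtr_gt0. Qed.
Let ss n : s n ^+ 2 = gam n. Proof. by rewrite sqr_sqrtr// ltW. Qed.
Let s1 n : s n <= 1. Proof. by rewrite -[leRHS]sqrtr1 ler_wsqrtr ?gam1. Qed.
Let root_gam n : root n.+1 * gam n = s n.
Proof. by rewrite /harmonic/= sqrtrV ?ler0n// -[X in _ * X^-1](@sqr_sqrtr _ n.+1%:R) ?ler0n// expr2 invfM mulrA divff ?mul1r// gt_eqF// sqrtr_gt0. Qed.

Let L := 1 + k * T ^+ 2 + (1 + Cm) * T.
Let Lx := k * T + 1 + Cm.

(** The step without its mean drift [- c j * x n j w]: centered given the past, with leading part
    [A]. *)
Let xi n j w := A n j w - k * x n j w ^+ 2 * A n j w - (M n j w - c j) * x n j w.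
Let X1 n w := \sum_j `|x n j w|.
Let Q n w := \sum_j x n j w ^+ 2.

Let Lx0 : 0 <= Lx.
Proof. by have := Cm_ge0; have := mulr_ge0 k0 T0; rewrite /Lx; lra. Qed.

Let L1' : 1 <= L.
Proof.
have := mulr_ge0 (addr_ge0 ler01 Cm_ge0) T0; have := mulr_ge0 k0 (sqr_ge0 T).
by rewrite /L; lra.
Qed.
Let L0 : 0 <= L. Proof. exact: le_trans L1'. Qed.
Let L10 : 0 <= L + 1. Proof. exact: addr_ge0. Qed.

Let eta_le n j w : `|xi n j w - A n j w| <= Lx * (H n w * `|x n j w|).
Proof.
rewrite (_ : _ - _ = - (x n j w * (k * x n j w * A n j w + (M n j w - c j)))); last by rewrite /xi; ring.
rewrite normrN normrM mulrA [leRHS]mulrC ler_wpM2l//.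
have Hp := H0 n w; have H1' := H1 n w; have cj := Cm0 j; have cC := c_Cm j.
apply: (le_trans (ler_normD _ _)).
have h1 : `|k * x n j w * A n j w| <= k * T * H n w.
  by rewrite !normrM (ger0_norm k0) ler_pM ?mulr_ge0// ler_wpM2l.
have h2 : `|M n j w - c j| <= (1 + Cm) * H n w.
  apply: (le_trans (ler_normB _ _)); rewrite (ger0_norm (ltW cj)) mulrDl mul1r lerD//.
  by rewrite (le_trans cC)// ler_peMr// (le_trans (ltW cj)).
by rewrite /Lx; move: h1 h2; rewrite -addrA !mulrDl; lra.
Qed.

Let xi_le n j w : `|xi n j w| <= L * H n w.
Proof.
rewrite (_ : xi n j w = A n j w + (xi n j w - A n j w)); last by ring.
apply: (le_trans (ler_normD _ _)); have h1 := AH n j w.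
have h2 : `|xi n j w - A n j w| <= Lx * (H n w * T).
  by apply: (le_trans (eta_le n j w)); rewrite ler_wpM2l ?Lx0// ler_wpM2l// ltW.
rewrite (_ : L * H n w = H n w + Lx * (H n w * T)); last by rewrite /L /Lx; ring.
exact: lerD.
Qed.

Let mxi n j : measurable_fun setT (xi n j).
Proof. by rewrite /xi; mfun. Qed.

(** * One step of the recursion seen through a cosine *)

Section Step.
Context (n : nat) (n0 : (0 < n)%N) (u : 'cV[R]_p) (b rho : R).
Hypothesis urho : norm1 u <= rho.

(** The next phase is [W], known from the past, plus [s n * zeta], centered given the past, plus
    [rem]. In second-order terms [alpha] replaces [zeta]. *)
Let W w := \sum_j scalv c (gam n) u j 0 * (root n * x n j w) + b.
Let zeta w := \sum_j u j 0 * xi n j w.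
Let alpha w := \sum_j u j 0 * A n j w.
Let rem w := \sum_j u j 0 * (root n.+1 * (x n.+1 j w - x n j w -
    gam n * ((1 - k * x n j w ^+ 2) * A n j w - M n j w * x n j w))).

Let u0 := norm1_ge0 u.
Let rho0 : 0 <= rho. Proof. exact: le_trans urho. Qed.

Let next_decomp w : \sum_j u j 0 * (root n.+1 * x n.+1 j w) + b = W w + s n * zeta w + rem w.
Proof.
(* At [n = 0] the step is [gam 0 = 1] and [scal] divides by 0, whence the restriction to positive
   [n]. *)
have rn : root n != 0 by rewrite gt_eqF// sqrtr_gt0 ltr0n.
have sc j : scalv c (gam n) u j 0 * root n = u j 0 * (root n.+1 * (1 - c j * gam n)).
  rewrite mxE /scal (_ : Num.sqrt (1 - gam n) = root n / root n.+1); last first.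
    rewrite /harmonic/= -sqrtrV ?ler0n// -sqrtrM ?ler0n//; congr Num.sqrt.
    have nz : n.+1%:R != 0 :> R by rewrite pnatr_eq0.
    by apply: (mulIf nz); rewrite divfK// mulrBl mul1r mulVf// -natr1 addrK.
  have rn1 : root n.+1 != 0 by rewrite gt_eqF// sqrtr_gt0 ltr0n.
  by move: (root n) (root n.+1) (gam n) rn rn1 => r r' g r0 r'0; field; rewrite r0 r'0.
rewrite [RHS](_ : _ = (\sum_j scalv c (gam n) u j 0 * (root n * x n j w) + s n * zeta w + rem w) + b); last first.
  by rewrite /W; ring.
congr (_ + b); rewrite /rem /zeta mulr_sumr.
rewrite -!big_split/=; apply: eq_bigr => j _.
rewrite [scalv _ _ _ _ _ * _]mulrA sc /xi -root_gam.
rewrite /harmonic/=; by move: (root n.+1) (n.+1%:R^-1) => r g; ring.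
Qed.

Let rem_le w : `|rem w| <= norm1 u * (C * (gam n * s n * H n w ^+ 2 + s n * (H n w * Q n w))).
Proof.
apply: norm_dotc_le => j; rewrite normrM ger0_norm ?sqrtr_ge0//.
apply: (le_trans (ler_wpM2l (sqrtr_ge0 _) (step_lin n j w))).
rewrite mulrCA ler_wpM2l// mulrDr lerD//.
  rewrite (_ : _ * _ = (root n.+1 * gam n) * (gam n * H n w ^+ 2)); last by ring.
  by rewrite root_gam mulrA [s n * _]mulrC.
rewrite mulrA root_gam ler_wpM2l ?(ltW (s0 n))// ler_wpM2l ?(ltW (H0 n w))//.
by rewrite /Q (bigD1 j)//= lerDl sumr_ge0// => i _; exact: sqr_ge0.
Qed.

Let zeta_le w : `|zeta w| <= norm1 u * (L * H n w).
Proof. by apply: norm_dotc_le => j; exact: xi_le. Qed.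

Let alpha_le w : `|alpha w| <= norm1 u * H n w.
Proof. by apply: norm_dotc_le => j; exact: AH. Qed.

Let zeta_alpha_le w : `|zeta w - alpha w| <= norm1 u * (Lx * (H n w * X1 n w)).
Proof.
rewrite (_ : zeta w - alpha w = \sum_j u j 0 * (xi n j w - A n j w)); last first.
  by rewrite /zeta /alpha -sumrB; apply: eq_bigr => j _; exact: esym (mulrBr _ _ _).
apply: norm_dotc_le => j; apply: (le_trans (eta_le n j w)).
rewrite ler_wpM2l ?Lx0// ler_wpM2l ?(ltW (H0 n w))//.
by rewrite /X1 (bigD1 j)//= lerDl sumr_ge0.
Qed.

Let mW : meas_on Z (past n) W.
Proof. by rewrite /meas_on /W; mfun; exact: mx. Qed.

Let MW : measurable_fun setT W. Proof. exact: meas_on_measurable mW. Qed.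
Let mzeta : measurable_fun setT zeta. Proof. by rewrite /zeta; mfun. Qed.
Let malpha : measurable_fun setT alpha. Proof. by rewrite /alpha; mfun. Qed.
Let mrem : measurable_fun setT rem. Proof. by rewrite /rem; mfun. Qed.

Let Ex_past_cur0 (F G : Omega -> R) (b1 b2 : R) : 0 <= b2 -> meas_on Z (past n) F -> meas_on Z (cur n) G ->
  (forall w, `|F w| <= b1) -> (forall w, `|G w| <= b2 * H n w ^+ 2) ->
  L1 P (fun w => F w * G w) /\ Ex P (fun w => F w * G w) = Ex P F * Ex P G.
Proof.
move=> b20 mF mG Fb Gb.
have iF : L1 P F by apply: L1_bounded Fb; exact: meas_on_measurable mF.
have iG : L1 P G by apply: (bndL b20 _ Gb); exact: meas_on_measurable mG.
split; [exact: (meas_on_mul_L1 Zindep (past_cur n) mF mG iF iG)|].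
exact: (meas_on_mul_Ex Zindep (past_cur n) mF mG iF iG).
Qed.

Let zeta_sin : L1 P (fun w => zeta w * sin (W w)) /\ Ex P (fun w => zeta w * sin (W w)) = 0.
Proof.
have msin : meas_on Z (past n) (fun w => sin (W w)) by rewrite /meas_on; mfun.
pose F1 j w := u j 0 * ((1 - k * x n j w ^+ 2) * sin (W w)).
pose F2 j w := u j 0 * (x n j w * sin (W w)).
have bsin w : `|sin (W w)| <= 1 by exact: sin_max.
have F1b j w : `|F1 j w| <= norm1 u * (1 + k * T ^+ 2).
  rewrite /F1 !normrM ler_pM ?norm1_coord ?mulr_ge0// -[leRHS]mulr1 ler_pM//.
  apply: (le_trans (ler_normB _ _)); rewrite normr1 normrM (ger0_norm k0) lerD2l ler_wpM2l//.
  by rewrite normrX lerXn2r ?nnegrE.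
have F2b j w : `|F2 j w| <= norm1 u * T.
  by rewrite /F2 !normrM ler_pM ?norm1_coord ?mulr_ge0// -[leRHS]mulr1 ler_pM.
have mF1 j : meas_on Z (past n) (F1 j) by rewrite /meas_on /F1; mfun; exact: mx.
have mF2 j : meas_on Z (past n) (F2 j) by rewrite /meas_on /F2; mfun; exact: mx.
have mMc j : meas_on Z (cur n) (fun w => M n j w - c j) by rewrite /meas_on; mfun; exact: mM.
have Ab j w : `|A n j w| <= 1 * H n w ^+ 2 by rewrite mul1r (le_trans (AH n j w)).
have Mb j w : `|M n j w - c j| <= (1 + c j) * H n w ^+ 2.
  apply: (le_trans (ler_normB _ _)); rewrite (ger0_norm (ltW (Cm0 j))) mulrDl mul1r lerD//.
    exact: (le_trans (MH n j w)).
  by rewrite ler_peMr// ?(ltW (Cm0 j))// (le_trans (H1 n w)).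
have cj0 j : 0 <= 1 + c j by rewrite addr_ge0// ltW.
have E1 j := Ex_past_cur0 ler01 (mF1 j) (mA n j) (F1b j) (Ab j).
have E2 j := Ex_past_cur0 (cj0 j) (mF2 j) (mMc j) (F2b j) (Mb j).
have -> : (fun w => zeta w * sin (W w)) =
    (fun w => \sum_j (F1 j w * A n j w - F2 j w * (M n j w - c j))).
  apply/funext => w; rewrite /zeta mulr_suml; apply: eq_bigr => j _.
  by rewrite /F1 /F2 /xi; ring.
have Li j : L1 P (fun w => F1 j w * A n j w - F2 j w * (M n j w - c j)).
  by apply: L1B; [exact: (E1 j).1|exact: (E2 j).1].
split; first exact: L1_sum.
rewrite Ex_sum// big1// => j _; rewrite ExB; [|exact: (E1 j).1|exact: (E2 j).1].
rewrite (E1 j).2 (E2 j).2 EA mulr0 ExB//; last exact: L1_cst.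
by rewrite EM Ex_cst subrr mulr0 subrr.
Qed.

Let alpha_sqr : Ex P (fun w => alpha w ^+ 2) = bilin Phi u u.
Proof.
have iAA j l : L1 P (fun w => A n j w * A n l w).
  apply: (@bndL n _ 1) => //[|w]; first by mfun.
  by rewrite mul1r normrM expr2 ler_pM.
have -> : (fun w => alpha w ^+ 2) =
    (fun w => \sum_j \sum_l (u j 0 * u l 0) * (A n j w * A n l w)).
  apply/funext => w; rewrite /alpha expr2 mulr_suml; apply: eq_bigr => j _.
  by rewrite mulr_sumr; apply: eq_bigr => l _; ring.
rewrite bilinE Ex_sum => [|j]; last by apply: L1_sum => l _; exact: L1Z.
apply: eq_bigr => j _; rewrite Ex_sum => [|l]; last exact: L1Z.
by apply: eq_bigr => l _; rewrite ExZ// EAA; ring.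
Qed.

Lemma bilin_drift_ge0 : 0 <= bilin Phi u u.
Proof. by rewrite -alpha_sqr Ex_ge0// => w; exact: sqr_ge0. Qed.

Let alpha_sqr_cos : L1 P (fun w => cos (W w) * alpha w ^+ 2) /\
  Ex P (fun w => cos (W w) * alpha w ^+ 2) = Ex P (fun w => cos (W w)) * bilin Phi u u.
Proof.
rewrite -alpha_sqr; apply: (@Ex_past_cur0 _ _ 1 (norm1 u ^+ 2)).
- exact: sqr_ge0.
- by rewrite /meas_on; mfun.
- by rewrite /meas_on /alpha; mfun; exact: mA.
- by move=> w; exact: cos_max.
- by move=> w; rewrite normrX -exprMn lerXn2r ?nnegrE// mulr_ge0// ltW.
Qed.

Let EQ := Ex P (Q n).
Let EX1 := Ex P (X1 n).
Let lin := Ex P (fun w => H n w ^+ 2 * Num.min 1 (s n * rho * L * H n w)).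

(** Taylor expansion of the cosine at [W]: the first-order term has mean 0 and the second-order one
    factors by independence. Every error keeps one factor [norm1 u]; further ones are bounded by
    [rho]. *)
Lemma char_step :
  `|Ex P (fun w => cos (\sum_j u j 0 * (root n.+1 * x n.+1 j w) + b)) -
    (1 - gam n / 2 * bilin Phi u u) *
    Ex P (fun w => cos (\sum_j scalv c (gam n) u j 0 * (root n * x n j w) + b))| <=
  gam n * norm1 u * (C * (s n * K + s n * (n.+1%:R * (K * EQ))) + 2 * rho * L ^+ 2 * lin
     + rho * Lx * (L + 1) * (K * EX1)).
Proof.
have g0 := gam0 n; have s0' := s0 n.
have mQ : meas_on Z (past n) (Q n) by rewrite /meas_on /Q; mfun; exact: mx.
have mX : meas_on Z (past n) (X1 n) by rewrite /meas_on /X1; mfun; exact: mx.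
have mH2 : meas_on Z (cur n) (fun w => H n w ^+ 2) by rewrite /meas_on; mfun; exact: mH.
have Q0 w : 0 <= Q n w by apply: sumr_ge0 => j _; exact: sqr_ge0.
have X0 w : 0 <= X1 n w by exact: sumr_ge0.
have Qb w : `|Q n w| <= p%:R * T ^+ 2.
  rewrite ger0_norm// /Q -[X in X%:R]card_ord -sum1_card natr_sum mulr_suml; apply: ler_sum => j _.
  by rewrite mul1r -(real_normK (num_real (x n j w))) lerXn2r ?nnegrE.
have Xb w : `|X1 n w| <= p%:R * T.
  rewrite ger0_norm// /X1 -[X in X%:R]card_ord -sum1_card natr_sum mulr_suml; apply: ler_sum => j _.
  by rewrite mul1r.
have Hb w : `|H n w| <= 1 * H n w ^+ 2 by rewrite mul1r gtr0_norm.
have H2b w : `|H n w ^+ 2| <= 1 * H n w ^+ 2 by rewrite mul1r ger0_norm// sqr_ge0.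
have [iQH eQH] := Ex_past_cur0 ler01 mQ (mH n) Qb Hb.
have [iXH eXH] := Ex_past_cur0 ler01 mX mH2 Xb H2b.
have [iz ez] := zeta_sin; have [ia ea] := alpha_sqr_cos.
have icos : L1 P (fun w => cos (W w)).
  by apply: (@L1_bounded _ _ _ _ _ 1) => [|w]; [mfun|exact: cos_max].
have sL0 : 0 <= s n * rho * L by rewrite !mulr_ge0// ltW.
have ilin : L1 P (fun w => H n w ^+ 2 * Num.min 1 (s n * rho * L * H n w)).
  apply: (@bndL n _ 1) => //[|w]; first by mfun.
  have sH0 : 0 <= s n * rho * L * H n w by rewrite mulr_ge0// ltW.
  have m0 : 0 <= Num.min 1 (s n * rho * L * H n w) by rewrite le_min ler01.
  by rewrite mul1r normrM (ger0_norm m0) (ger0_norm (sqr_ge0 _)) ler_piMr ?sqr_ge0// ge_min lexx.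
pose main w := cos (W w) + (- s n * (zeta w * sin (W w)) + - (gam n / 2) * (cos (W w) * alpha w ^+ 2)).
have imain : L1 P main by do ![apply: L1D => //]; exact: L1Z.
have Emain : Ex P main = (1 - gam n / 2 * bilin Phi u u) * Ex P (fun w => cos (W w)).
  rewrite /main ExD ?ExD ?ExZ//; do ?[exact: L1Z]; last by apply: L1D; exact: L1Z.
  by rewrite ez ea; ring.
(* The first two terms dominate [rem], the third the Taylor remainder, the last the replacement of
   [zeta ^+ 2] by [alpha ^+ 2]. *)
pose G w := norm1 u * (C * (gam n * s n)) * H n w ^+ 2 + (norm1 u * (C * s n) * (Q n w * H n w) +
   (gam n * norm1 u * (2 * rho * L ^+ 2) * (H n w ^+ 2 * Num.min 1 (s n * rho * L * H n w)) +
    gam n * norm1 u * (rho * Lx * (L + 1)) * (X1 n w * H n w ^+ 2))).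
have iG : L1 P G by do ![apply: L1D => //]; exact: L1Z.
have EG : Ex P G <= gam n * norm1 u * (C * (s n * K + s n * (n.+1%:R * (K * EQ))) + 2 * rho * L ^+ 2 * lin
     + rho * Lx * (L + 1) * (K * EX1)).
  rewrite /G !ExD ?ExZ//; do ?[apply: L1D => //]; do ?[exact: L1Z].
  rewrite eQH eXH -/EQ -/EX1 -/lin.
  have EQ0 : 0 <= EQ by exact: Ex_ge0.
  have EX0 : 0 <= EX1 by exact: Ex_ge0.
  have EHK : Ex P (H n) <= K.
    by apply: le_trans (EH n); apply: Ex_le => //; apply: (@bndL n _ 1).
  rewrite [leRHS](_ : _ = norm1 u * (C * (gam n * s n)) * K +
      (norm1 u * (C * s n) * (EQ * K) + (gam n * norm1 u * (2 * rho * L ^+ 2) * lin +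
       gam n * norm1 u * (rho * Lx * (L + 1)) * (EX1 * K)))); last first.
    have -> : s n * (n.+1%:R * (K * EQ)) = s n * (K * EQ) / gam n by rewrite /harmonic/= invrK; ring.
    by move: (s n) (gam n) g0 => t g tg; field; rewrite gt_eqF.
  have gu : 0 <= gam n * norm1 u by rewrite mulr_ge0// ltW.
  apply: lerD; first by apply: ler_wpM2l => //; rewrite !mulr_ge0// ltW.
  apply: lerD.
    by apply: ler_wpM2l; [rewrite !mulr_ge0// ltW|exact: ler_wpM2l].
  by rewrite lerD2l; apply: ler_wpM2l; [exact: (mulr_ge0 gu (mulr_ge0 (mulr_ge0 rho0 Lx0) L10))|exact: ler_wpM2l].
rewrite -Emain; have mnext : measurable_fun setT
    (fun w => cos (\sum_j u j 0 * (root n.+1 * x n.+1 j w) + b)) by mfun.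
have inext : L1 P (fun w => cos (\sum_j u j 0 * (root n.+1 * x n.+1 j w) + b)).
  by apply: (@L1_bounded _ _ _ _ _ 1 mnext) => w; exact: cos_max.
rewrite -ExB//; apply: le_trans EG; apply: norm_Ex_le_dom => //.
  by apply: measurable_funB => //; exact: L1_measurable imain.
move=> w; rewrite next_decomp.
have h1 : `|cos (W w + s n * zeta w + rem w) - cos (W w + s n * zeta w)| <= `|rem w|.
  by apply: (le_trans (cos_lipschitz _ _)); rewrite addrAC subrr add0r.
have h2 := cosD_taylor2_le (W w) (s n * zeta w).
have zb : `|zeta w| <= rho * (L * H n w).
  by apply: (le_trans (zeta_le w)); rewrite ler_wpM2r// mulr_ge0// ltW.
have h3 : 2 * ((s n * zeta w) ^+ 2 * Num.min 1 `|s n * zeta w|) <=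
    gam n * norm1 u * (2 * rho * L ^+ 2) * (H n w ^+ 2 * Num.min 1 (s n * rho * L * H n w)).
  rewrite (_ : gam n * norm1 u * (2 * rho * L ^+ 2) * (H n w ^+ 2 * Num.min 1 (s n * rho * L * H n w)) =
     2 * ((gam n * ((norm1 u * (L * H n w)) * (rho * (L * H n w)))) * Num.min 1 (s n * rho * L * H n w))); last by ring.
  rewrite ler_wpM2l//; apply: ler_pM.
  - exact: sqr_ge0.
  - by rewrite le_min ler01/=.
  - rewrite exprMn ss ler_wpM2l ?(ltW g0)// -(real_normK (num_real (zeta w))) expr2.
    by apply: ler_pM.
  - rewrite le_min !ge_min lexx/=; apply/orP; right.
    by rewrite normrM (gtr0_norm s0') -!mulrA ler_wpM2l ?(ltW s0')// mulrA mulrAC -mulrA [H _ _ * _]mulrC.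
have h4 : `|gam n / 2 * (zeta w ^+ 2 - alpha w ^+ 2) * cos (W w)| <=
    gam n * norm1 u * (rho * Lx * (L + 1)) * (X1 n w * H n w ^+ 2).
  rewrite normrM -[leRHS]mulr1; apply: ler_pM => //; last exact: cos_max.
  have -> : gam n / 2 * (zeta w ^+ 2 - alpha w ^+ 2) = gam n * ((zeta w - alpha w) * ((zeta w + alpha w) / 2)) by field.
  rewrite !normrM (gtr0_norm g0).
  rewrite (_ : gam n * norm1 u * (rho * Lx * (L + 1)) * (X1 n w * H n w ^+ 2) =
    gam n * ((norm1 u * (Lx * (H n w * X1 n w))) * (rho * ((L + 1) * H n w)))); last by ring.
  rewrite ler_wpM2l ?(ltW g0)//; apply: ler_pM; [exact: normr_ge0|exact: mulr_ge0|exact: zeta_alpha_le|].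
  rewrite (ger0_norm (_ : 0 <= 2^-1))//.
  have rh : 0 <= rho * ((L + 1) * H n w) by exact: mulr_ge0 rho0 (mulr_ge0 L10 (ltW (H0 n w))).
  apply: (@le_trans _ _ `|zeta w + alpha w|); first by rewrite ler_piMr// invf_le1// ler1n.
  apply: (le_trans (ler_normD _ _)).
  rewrite mulrDl mul1r mulrDr lerD//.
  by apply: (le_trans (alpha_le w)); rewrite ler_wpM2r// ltW.
have h5 := rem_le w.
rewrite (_ : _ - main w = (cos (W w + s n * zeta w + rem w) - cos (W w + s n * zeta w)) +
  ((cos (W w + s n * zeta w) - (cos (W w) - s n * zeta w * sin (W w) - (s n * zeta w) ^+ 2 / 2 * cos (W w))) -
   gam n / 2 * (zeta w ^+ 2 - alpha w ^+ 2) * cos (W w))); last first.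
  by rewrite /main exprMn ss; ring.
apply: (le_trans (ler_normD _ _)); rewrite /G addrA; apply: lerD.
  by apply: (le_trans h1); apply: (le_trans h5); rewrite le_eqVlt; apply/orP; left; apply/eqP; ring.
apply: (le_trans (ler_normB _ _)); apply: lerD => //; exact: le_trans h3.

Qed.

End Step.

(** Since [c k + c l - 1 = (c k - 1/2) + (c l - 1/2)], the form is the expectation of a Cauchy
    kernel form evaluated at the noise. *)
Lemma limit_cov_ge0 u : 0 <= bilin (limit_cov c Phi) u u.
Proof.
have sp j : 0 < c j - 2^-1 by have := c_kap j; have := kap0; lra.
have iAA j l : L1 P (fun w => A 0 j w * A 0 l w).
  apply: (@bndL 0%N _ 1) => //[|w]; first by mfun.
  by rewrite mul1r normrM expr2 ler_pM.
have -> : bilin (limit_cov c Phi) u u = Ex P (fun w => \sum_k \sum_l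
    (u k 0 * A 0 k w) * (u l 0 * A 0 l w) / (c k - 2^-1 + (c l - 2^-1))).
  have -> : (fun w => \sum_k \sum_l
      (u k 0 * A 0 k w) * (u l 0 * A 0 l w) / (c k - 2^-1 + (c l - 2^-1))) =
      (fun w => \sum_k \sum_l (u k 0 * u l 0 / (c k + c l - 1)) * (A 0 k w * A 0 l w)).
    apply/funext => w; apply: eq_bigr => k' _; apply: eq_bigr => l _.
    rewrite (_ : c k' - 2^-1 + (c l - 2^-1) = c k' + c l - 1); first by ring.
    by field.
  rewrite bilinE Ex_sum => [|j]; last by apply: L1_sum => l _; exact: L1Z.
  apply: eq_bigr => j _; rewrite Ex_sum => [|l]; last exact: L1Z.
  by apply: eq_bigr => l _; rewrite ExZ// EAA mxE; ring.
by apply: Ex_ge0 => w; exact: cauchy_kernel_ge0.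
Qed.

(** The rate [O(1/n)] for second moments makes the remainder and replacement errors [O(s n)]; the
    Taylor error vanishes by the Lindeberg condition. *)
Lemma char_step_vanishing (rho : R) : 0 <= rho -> exists2 e : nat -> R,
  (forall n, 0 <= e n) /\ e n @[n --> \oo] --> (0 : R) &
  forall n u b, (0 < n)%N -> norm1 u <= rho ->
  `|Ex P (fun w => cos (\sum_j u j 0 * (root n.+1 * x n.+1 j w) + b)) -
    (1 - gam n / 2 * bilin Phi u u) *
    Ex P (fun w => cos (\sum_j scalv c (gam n) u j 0 * (root n * x n j w) + b))| <=
  gam n * norm1 u * e n.
Proof.
move=> rho0; have [M0 M00 HM0] := iterate_sqr_rate.
pose B := C * (K + 2 * (K * M0)) + rho * Lx * (L + 1) * (K * (2 * M0 + p%:R)).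
pose lin n := Ex P (fun w => H n w ^+ 2 * Num.min 1 (s n * rho * L * H n w)).
have K0 : 0 <= K by exact: le_trans K1.
have B0 : 0 <= B.
  have MK : 0 <= K * M0 by exact: mulr_ge0.
  have MK' : 0 <= K * (2 * M0 + p%:R) by rewrite mulr_ge0 ?addr_ge0 ?mulr_ge0.
  by rewrite addr_ge0// mulr_ge0// ?addr_ge0 ?mulr_ge0.
have srL0 n : 0 <= s n * rho * L by rewrite !mulr_ge0// ltW.
have sH0 n w : 0 <= s n * rho * L * H n w by rewrite mulr_ge0// ltW.
have bmin (y : R) n w : 0 <= y -> `|H n w ^+ 2 * Num.min 1 y| <= 1 * H n w ^+ 2.
  move=> y0; have m0 : 0 <= Num.min 1 y by rewrite le_min ler01.
  by rewrite mul1r normrM (ger0_norm m0) (ger0_norm (sqr_ge0 _)) ler_piMr ?sqr_ge0// ge_min lexx.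
have imin n (y : R) : 0 <= y -> L1 P (fun w => H n w ^+ 2 * Num.min 1 (y * H n w)).
  move=> y0; apply: (@bndL n _ 1) => //[|w]; first by mfun.
  by apply: bmin; rewrite mulr_ge0// ltW.
have lin0 n : 0 <= lin n.
  by apply: Ex_ge0 => w; rewrite mulr_ge0 ?sqr_ge0// le_min ler01 (sH0 n w).
have s_cvg : s n @[n --> \oo] --> (0 : R).
  rewrite -(@sqrtr0 R); apply: (cvg_comp _ _ (@cvg_harmonic R)).
  exact: sqrt_continuous.
have rL0 : 0 <= rho * L by exact: mulr_ge0.
have lin_cvg : lin n @[n --> \oo] --> (0 : R).
  apply/cvgrPdist_le => e e0; have [a a0 Ha] := HLind e0.
  have rLp : 0 < rho * L + 1 by rewrite ltr_wpDl.
  have ar : 0 < a / (rho * L + 1) by rewrite divr_gt0.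
  move/cvgrPdist_le: s_cvg => /(_ _ ar); apply: filterS => n.
  rewrite sub0r normrN (gtr0_norm (s0 n)) sub0r normrN (ger0_norm (lin0 n)) => sa.
  apply: le_trans (Ha n); apply: Ex_le; [exact: imin|exact/imin/ltW|] => w.
  rewrite ler_wpM2l ?sqr_ge0// le_min ge_min lexx/= ge_min; apply/orP; right.
  rewrite ler_wpM2r ?(ltW (H0 n w))// -mulrA.
  rewrite ler_pdivlMr// in sa; apply: le_trans sa.
  by rewrite ler_wpM2l ?lerDl// ltW// s0.
have n1 n : (0 < n)%N -> n.+1%:R <= 2 * n%:R :> R.
  by move=> n0; rewrite -natrM ler_nat mul2n -addnn -addn1 leq_add2l.
exists (fun n => s n * B + 2 * rho * L ^+ 2 * lin n).
  split=> [n|].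
    by rewrite addr_ge0// ?mulr_ge0// ?sqr_ge0// ltW.
  rewrite -[X in _ --> X](addr0 0); apply: cvgD.
    by rewrite -[X in _ --> X](mul0r B); apply: cvgM => //; exact: cvg_cst.
  by rewrite -[X in _ --> X](mulr0 (2 * rho * L ^+ 2)); apply: cvgM => //; exact: cvg_cst.
move=> n u b n0 urho; apply: (le_trans (char_step n0 b urho)).
rewrite ler_wpM2l ?mulr_ge0 ?norm1_ge0 ?(ltW (gam0 n))//.
rewrite -/(lin n).
have iX j : L1 P (fun w => `|x n j w|).
  by apply: (@L1_bounded _ _ _ _ _ T) => [|w]; [mfun|rewrite normr_id].
have EQe : Ex P (Q n) = \sum_j Ex P (fun w => x n j w ^+ 2) by rewrite /Q Ex_sum.
have EQ1 : n.+1%:R * Ex P (Q n) <= 2 * M0.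
  have EQ0 : 0 <= Ex P (Q n) by apply: Ex_ge0 => w; apply: sumr_ge0 => j _; exact: sqr_ge0.
  apply: (le_trans (ler_wpM2r EQ0 (n1 n n0))); rewrite -mulrA ler_wpM2l// EQe; exact: HM0.
have EX : Ex P (X1 n) <= s n * (2 * M0 + p%:R).
  (* Completing a square with [s n ^+ 2 * n.+1 = 1] gives [|x| <= s n * n.+1 * x ^+ 2 + s n] for
     each coordinate. *)
  apply: (@le_trans _ _ (Ex P (fun w => s n * n.+1%:R * Q n w + s n * p%:R))).
    apply: Ex_le.
    - exact: L1_sum.
    - by apply: L1D; [apply: L1Z; exact: L1_sum|exact: L1_cst].
    move=> w; rewrite /X1 /Q (_ : p%:R = \sum_(j < p) 1); last by rewrite sumr_const card_ord.
    rewrite !mulr_sumr -big_split/=.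
    apply: ler_sum => j _; rewrite mulr1.
    have nn : s n ^+ 2 * n.+1%:R = 1 by rewrite ss mulVf.
    rewrite -(real_normK (num_real (x n j w))) -subr_ge0.
    rewrite (_ : _ - _ = s n * n.+1%:R * (`|x n j w| - s n / 2) ^+ 2 + 3 / 4 * s n).
      have sp := ltW (s0 n); apply: addr_ge0; last exact: mulr_ge0.
      by apply: mulr_ge0; [exact: mulr_ge0|exact: sqr_ge0].
    rewrite /harmonic/= in nn *; move: (Num.sqrt _) nn `|x n j w| => q nn t.
    apply/eqP; rewrite -subr_eq0 [X in X == 0](_ : _ = (q ^+ 2 * n.+1%:R - 1) * (t - q / 4)).
      by rewrite nn subrr mul0r.
    by field.
  rewrite ExD; [|by apply: L1Z; exact: L1_sum|exact: L1_cst].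
  rewrite Ex_cst ExZ; last exact: L1_sum.
  by rewrite -mulrA -mulrDr ler_wpM2l ?(ltW (s0 n))// lerD2r.
have h1 : C * (s n * K + s n * (n.+1%:R * (K * Ex P (Q n)))) <= s n * (C * (K + 2 * (K * M0))).
  rewrite -mulrDr mulrCA ler_wpM2l ?(ltW (s0 n))// ler_wpM2l// lerD2l.
  by rewrite mulrCA [leRHS]mulrCA ler_wpM2l.
have h2 : rho * Lx * (L + 1) * (K * Ex P (X1 n)) <= s n * (rho * Lx * (L + 1) * (K * (2 * M0 + p%:R))).
  rewrite [leRHS]mulrCA; apply: ler_wpM2l; first exact: mulr_ge0 (mulr_ge0 rho0 Lx0) L10.
  by rewrite [leRHS]mulrCA ler_wpM2l.
by rewrite /B [leRHS](_ : _ = s n * (C * (K + 2 * (K * M0))) + 2 * rho * L ^+ 2 * lin n +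
  s n * (rho * Lx * (L + 1) * (K * (2 * M0 + p%:R)))); [rewrite lerD// lerD|ring].
Qed.

Lemma char_cvg (u : 'cV[R]_p) (b : R) :
  (fun n => Ex P (fun w => cos (\sum_j u j 0 * (root n * x n j w) + b))) @ \oo -->
  (target c Phi u * cos b : R).
Proof.
pose rho := norm1 u + 1.
have rho0 : 0 < rho by rewrite ltr_wpDl// norm1_ge0.
have S0 := limit_cov_ge0.
have [e [e0 ecvg] He] := char_step_vanishing (ltW rho0).
have [C2 C20 [g1 g10 Hg1]] := target_step kap0 c_kap S0 rho0.
have [b1 b10 Hb1] := mx_bound Phi.
(* Each summand serves one of the six smallness conditions in [gN], all of which hold once
   [gam n <= S^-1]. *)
pose S := g1^-1 + 2 + Cm + Cm ^+ 2 / (2 * kap) + kap + b1 * rho ^+ 2.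
have p1 : 0 <= g1^-1 by rewrite invr_ge0 ltW.
have p2 : 0 <= Cm ^+ 2 / (2 * kap) by rewrite divr_ge0 ?sqr_ge0// mulr_ge0// ltW.
have p3 : 0 <= b1 * rho ^+ 2 by rewrite mulr_ge0 ?sqr_ge0.
have kp := kap0; have Cp := Cm_ge0.
have S1 : 0 < S.
  by rewrite /S; lra.
have [N0 _ HN0] : \forall n \near \oo, gam n <= S^-1.
  have Si : 0 < S^-1 by rewrite invr_gt0.
  move/cvgrPdist_le: (@cvg_harmonic R) => /(_ _ Si); apply: filterS => n.
  by rewrite sub0r normrN ger0_norm// ltW.
pose N := N0.+1.
have gN n : (N <= n)%N -> [/\ gam n <= g1, gam n <= 2^-1 & Cm * gam n <= 1] /\
    [/\ Cm ^+ 2 * gam n <= 2 * kap, kap * gam n <= 1 & b1 * rho ^+ 2 * gam n <= 1].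
  move=> Nn; have gS : S * gam n <= 1.
    by rewrite mulrC -ler_pdivlMr// div1r; apply: HN0 => /=; exact: ltnW.
  have t1 t : t <= S -> t * gam n <= 1.
    by move=> tS; apply: le_trans gS; rewrite ler_wpM2r// ltW.
  split; split.
  - by rewrite -[leRHS]mulr1 -ler_pdivrMl//; apply: t1; rewrite /S; lra.
  - by rewrite -[leRHS]mulr1 -ler_pdivrMl// invrK; apply: t1; rewrite /S; lra.
  - by apply: t1; rewrite /S; lra.
  - have : Cm ^+ 2 / (2 * kap) * gam n <= 1 by apply: t1; rewrite /S; lra.
    by rewrite mulrAC ler_pdivrMr ?mul1r// mulr_gt0.
  - by apply: t1; rewrite /S; lra.
  - by apply: t1; rewrite /S; lra.
pose dist n (v : 'cV[R]_p) (b : R) := `|Ex P (fun w => cos (\sum_j v j 0 * (root n * x n j w) + b)) -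
  target c Phi v * cos b|.
have [C3 C30 Hnear] := target_near1 S0.
(* The modulus at time [N]: the bounded iterate gives [root N * T], and the quadratic bound on
   [target v - 1] gives [C3 * rho] on the ball. *)
pose D0 := root N * T + C3 * rho.
have D00 : 0 <= D0 by rewrite addr_ge0// mulr_ge0 ?sqrtr_ge0// ltW.
pose D := fix D n := if n is m.+1 then
  if (N <= m)%N then (1 - kap * gam m) * D m + (e m + C2 * gam m) * gam m else D0 else D0.
have Dge0 n : 0 <= D n.
  elim: n => //= n IH; case: ifP => // Nn; have [_ [_ q5 _]] := gN n Nn.
  by rewrite addr_ge0 ?mulr_ge0 ?subr_ge0 ?addr_ge0 ?mulr_ge0 ?(ltW (gam0 n)).
(* The Lipschitz modulus contracts because [scalv] shrinks [norm1] by the factor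
   [1 - kap * gam m]. *)
have PD n v b' : (N <= n)%N -> norm1 v <= rho -> dist n v b' <= D n * norm1 v.
  elim: n v b' => [//|n IH] v b'.
  rewrite leq_eqVlt => /orP[/eqP Nn|]; last rewrite ltnS => Nn; move=> vrho.
    have -> : D n.+1 = D0 by rewrite /= Nn ltnn.
    rewrite -Nn /dist; have v0 := norm1_ge0 v.
    rewrite (_ : _ - _ = (Ex P (fun w => cos (\sum_j v j 0 * (root N * x N j w) + b')) - Ex P (fun=> cos b')) -
       (target c Phi v - 1) * cos b'); last by rewrite Ex_cst; ring.
    apply: (le_trans (ler_normB _ _)); rewrite /D0 [leRHS]mulrDl; apply: lerD.
      rewrite -ExB; first last.
      - exact: L1_cst.
      - by apply: (@L1_bounded _ _ _ _ _ 1) => [|w]; [mfun|exact: cos_max].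
      rewrite -[leRHS](Ex_cst P); apply: norm_Ex_le_dom; [by mfun|exact: L1_cst|] => w.
      apply: (le_trans (cos_lipschitz _ _)); rewrite addrK [leRHS]mulrC.
      by apply: norm_dotc_le => j; rewrite normrM ger0_norm ?sqrtr_ge0// ler_wpM2l ?sqrtr_ge0.
    rewrite normrM -[leRHS]mulr1 ler_pM ?cos_max//; apply: (le_trans (Hnear v)).
    by rewrite -mulrA ler_wpM2l// expr2 ler_wpM2r.
  have [[q1 q2 q3] [q4 q5 q6]] := gN n Nn.
  have sb j : 0 <= scal c (gam n) j <= 1 - kap * gam n.
    exact: (scal_bounds kap0 c_kap c_Cm).
  have n0 : (0 < n)%N by exact: leq_trans Nn.
  have nv := norm1_scalv v sb.
  have v0 := norm1_ge0 v.
  have sv : norm1 (scalv c (gam n) v) <= rho.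
    apply: (le_trans nv); apply: le_trans vrho; rewrite ler_piMl//.
    by rewrite gerBl mulr_ge0// ltW.
  have h1 := He n v b' n0 vrho.
  have h2 := IH (scalv c (gam n) v) b' Nn sv.
  have h3 := Hg1 (gam n) v (gam0 n) q1 vrho.
  have Ph0 : 0 <= bilin Phi v v by exact: bilin_drift_ge0.
  have Ph1 : bilin Phi v v <= b1 * rho ^+ 2.
    apply: le_trans (ler_norm _) _; apply: (le_trans (norm_bilin_le v Hb1)).
    by rewrite ler_wpM2l// lerXn2r ?nnegrE// ltW.
  have g0 := gam0 n.
  have Pg : gam n * bilin Phi v v <= 1.
    by apply: le_trans q6; rewrite mulrC ler_wpM2r// ltW.
  rewrite /dist; set E' := Ex P _; set a := 1 - gam n / 2 * bilin Phi v v in h1 h3.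
  have a0 : 0 <= a <= 1.
    rewrite /a mulrAC; apply/andP; split.
      by rewrite subr_ge0 ler_pdivrMr// mul1r (le_trans Pg)// ler1n.
    by rewrite gerBl divr_ge0// mulr_ge0// ltW.
  rewrite (_ : E' - _ = (E' - a * Ex P (fun w => cos (\sum_j scalv c (gam n) v j 0 * (root n * x n j w) + b'))) +
    (a * (Ex P (fun w => cos (\sum_j scalv c (gam n) v j 0 * (root n * x n j w) + b')) -
       target c Phi (scalv c (gam n) v) * cos b') -
     (target c Phi v - a * target c Phi (scalv c (gam n) v)) * cos b')); last by ring.
  have -> : D n.+1 = (1 - kap * gam n) * D n + (e n + C2 * gam n) * gam n by rewrite /= Nn.
  have -> : ((1 - kap * gam n) * D n + (e n + C2 * gam n) * gam n) * norm1 v =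
    gam n * norm1 v * e n + (D n * ((1 - kap * gam n) * norm1 v) + C2 * gam n ^+ 2 * norm1 v) by ring.
  apply: (le_trans (ler_normD _ _)); apply: lerD => //.
  apply: (le_trans (ler_normB _ _)); apply: lerD.
    have /andP[a0' a1] := a0; rewrite normrM (ger0_norm a0').
    apply: (le_trans (ler_piMl (normr_ge0 _) a1)); apply: (le_trans h2).
    exact: ler_wpM2l.
  by rewrite normrM -[leRHS]mulr1 ler_pM// cos_max.
have kN : kap <= N.+1%:R.
  have [_ [_ q5 _]] := gN N (leqnn N).
  by rewrite -[leRHS]mul1r -ler_pdivrMr.
have Dcvg : D @ \oo --> (0 : R).
  apply: (@recursion_cvg0 _ kap N D (fun m => e m + C2 * gam m)) => //.
    by move=> n Nn; rewrite /= Nn.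
  rewrite -[X in _ --> X](addr0 0); apply: cvgD => //.
  rewrite -[X in _ --> X](mulr0 C2); apply: cvgM; [exact: cvg_cst|exact: cvg_harmonic].
have Ducvg : (fun n => D n * norm1 u) @ \oo --> (0 : R).
  by rewrite -[X in _ --> X](mul0r (norm1 u)); apply: cvgM => //; exact: cvg_cst.
have urho : norm1 u <= rho by rewrite lerDl.
apply/cvgrPdist_le => eps eps0; move/cvgrPdist_le: Ducvg => /(_ _ eps0) De.
near=> n; rewrite distrC; apply: (@le_trans _ _ (D n * norm1 u)).
  by apply: PD => //; near: n; exact: nbhs_infty_ge.
apply: (@le_trans _ _ `|0 - D n * norm1 u|); last by near: n.
by rewrite sub0r normrN ler_norm.
Unshelve. all: by end_near.
Qed.

End LinearizedRecursion.

(** * Integrals over one period under translation and reflection *)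

Section PeriodicIntegrals.
Context {R : realType}.
Local Notation leb := (@lebesgue_measure R).
Implicit Types (h m : R -> R) (t : R).

(** The inverse is continuous away from 0, and its default value 0 there is that of the extension by
    zero. *)
Lemma measurable_inv : measurable_fun setT (@GRing.inv R).
Proof.
pose D := [set x : R | x != 0]; have oD : open D by exact: open_neq.
have -> : (@GRing.inv R) = (@GRing.inv R) \_ D.
  apply/funext => x; rewrite patchE; case: ifPn => //; rewrite notin_setE => /negP/negPn/eqP ->.
  by rewrite invr0.
apply: (proj1 (measurable_restrictT (@GRing.inv R) (open_measurable oD))).
apply: open_continuous_measurable_fun => // x; rewrite inE => x0.
exact: inv_continuous.
Qed.

Let ge0_integral_shift (c a b : R) (h : R -> \bar R) : measurable_fun setT h ->
  (forall x, 0 <= h x)%E ->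
  (\int[leb]_(x in `]a, b]) h x = \int[leb]_(x in `](a - c)%R, (b - c)%R]) h (x + c)%R)%E.
Proof.
move=> mh h0; rewrite integral_mkcond [RHS]integral_mkcond.
have mD : measurable_fun setT (h \_ `]a, b]).
  by apply: (proj1 (measurable_restrictT h _)); [exact: measurable_itv|exact: measurable_funTS].
have D0 x : (0 <= (h \_ `]a, b]) x)%E by rewrite patchE; case: ifP.
rewrite (@ge0_integral_affine R 1 c _ (oner_neq0 R) mD D0).
rewrite normr1 mul1e; apply: eq_integral => x _; rewrite !patchE mul1r.
congr (if _ then _ else _); apply/idP/idP; rewrite !inE/= !in_itv/=; lra.
Qed.

(** The shifted period is cut at [- 2^-1], and the piece sticking out is moved back by 1. *)
Let ge0_integral_translate_pos t (h : R -> \bar R) : 0 <= t <= 1 -> measurable_fun setT h ->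
  (forall x, 0 <= h x)%E -> (forall x, h (x + 1) = h x) ->
  (\int[leb]_(x in `](- 2^-1)%R, 2^-1%R]) h (x - t)%R = \int[leb]_(x in `](- 2^-1)%R, 2^-1%R]) h x)%E.
Proof.
move=> /andP[t0 t1] mh h0 hp.
have split (a b c : R) : a <= b -> b <= c ->
    (\int[leb]_(x in `]a, c]) h x = \int[leb]_(x in `]a, b]) h x + \int[leb]_(x in `]b, c]) h x)%E.
  move=> ab bc; rewrite -ge0_integral_setU//; first last.
  - apply/disj_setPS => x [] /=; rewrite !in_itv/= => /andP[_ x1] /andP[x2 _].
    by move: (lt_le_trans x2 x1); rewrite ltxx.
  - exact: measurable_funTS.
  congr (integral _ _ _); apply/seteqP; split => x /=; rewrite !in_itv/=.
    by move=> /andP[x1 x2]; have [xb|xb] := leP x b; [left|right]; rewrite ?x1 ?x2 ?xb.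
  by move=> [] /andP[x1 x2]; apply/andP; split=> //; [exact: le_trans bc|exact: le_lt_trans x1].
rewrite (@ge0_integral_shift t _ _ (fun x => h (x - t)%R))//; last first.
  by apply: measurableT_comp mh _; exact: measurable_funB.
under eq_integral do rewrite addrK.
rewrite (split (- 2^-1 - t) (- 2^-1) (2^-1 - t)); [|lra|lra].
rewrite [RHS](split _ (2^-1 - t)); [|lra|lra].
rewrite addeC; congr (_ + _)%E.
rewrite [RHS](@ge0_integral_shift 1)//.
have -> : 2^-1 - t - 1 = - 2^-1 - t by lra.
have -> : 2^-1 - 1 = - 2^-1 :> R by lra.
by apply: eq_integral => x _; rewrite hp.
Qed.

Lemma ge0_integral_translate t (h : R -> \bar R) : -1 <= t <= 1 -> measurable_fun setT h ->
  (forall x, 0 <= h x)%E -> (forall x, h (x + 1) = h x) ->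
  (\int[leb]_(x in half_itv) h (x - t)%R = \int[leb]_(x in half_itv) h x)%E.
Proof.
move=> /andP[t0 t1] mh h0 hp.
have mht : measurable_fun setT (fun x : R => h (x - t)).
  by apply: measurableT_comp mh _; exact: measurable_funB.
rewrite /half_itv -!integral_itv_obnd_cbnd; [|exact: measurable_funTS|exact: measurable_funTS].
have [t0'|/ltW t0'] := leP 0 t; first by apply: ge0_integral_translate_pos; rewrite ?t0'.
have := @ge0_integral_translate_pos (- t) (fun x => h (x - t)%R).
rewrite oppr_ge0 t0' lerNl t0 => /(_ isT mht (fun x => h0 _)) <-.
  by apply: eq_integral => x _; rewrite opprK addrK.
by move=> x; rewrite addrAC hp.
Qed.

Lemma ge0_integral_reflect (h : R -> \bar R) : measurable_fun setT h ->
  (forall x, 0 <= h x)%E ->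
  (\int[leb]_(x in half_itv) h (- x)%R = \int[leb]_(x in half_itv) h x)%E.
Proof.
move=> mh h0; rewrite [RHS]integral_mkcond [LHS]integral_mkcond.
have mD : measurable_fun setT (h \_ half_itv).
  by apply: (proj1 (measurable_restrictT h _)); [exact: measurable_itv|exact: measurable_funTS].
have D0 x : (0 <= (h \_ half_itv) x)%E by rewrite patchE; case: ifP.
have n0 : - 1 != 0 :> R by rewrite oppr_eq0 oner_neq0.
rewrite [RHS](@ge0_integral_affine R (- 1) 0 _ n0 mD D0).
rewrite normrN1 mul1e; apply: eq_integral => x _; rewrite !patchE mulN1r addr0.
congr (if _ then _ else _); apply/idP/idP; rewrite !inE /half_itv/= !in_itv/=; lra.
Qed.

Definition mean m : R := \int[leb]_(x in half_itv) m x.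

Let leb_half : leb half_itv = 1%E.
Proof. by rewrite /half_itv lebesgue_measure_itv/= lte_fin ifT ?EFinN; [rewrite -EFinB; congr EFin; lra|lra]. Qed.

Let mhalf : measurable (@half_itv R). Proof. exact: measurable_itv. Qed.

Let imean m (M : R) : measurable_fun setT m -> (forall x, `|m x| <= M) ->
  leb.-integrable half_itv (EFin \o m).
Proof.
move=> mm mM; apply: measurable_bounded_integrable => //.
- by rewrite (_ : _ half_itv = 1%E) ?ltry//; exact: leb_half.
- exact: measurable_funTS.
- by exists M; split; [exact: num_real|move=> y My x _; exact: le_trans (mM x) (ltW My)].
Qed.

Lemma meanE m (M : R) : measurable_fun setT m -> (forall x, `|m x| <= M) ->
  (\int[leb]_(x in half_itv) (m x)%:E = (mean m)%:E)%E.
Proof.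
by move=> mm mM; rewrite /mean /Rintegral fineK// integrable_fin_num//; exact: imean mM.
Qed.

Lemma meanD m1 m2 (M : R) : measurable_fun setT m1 -> measurable_fun setT m2 ->
  (forall x, `|m1 x| <= M) -> (forall x, `|m2 x| <= M) ->
  mean (fun x => m1 x + m2 x) = mean m1 + mean m2.
Proof.
by move=> mm1 mm2 M1 M2; rewrite /mean RintegralD//; [exact: imean M1|exact: imean M2].
Qed.

Lemma meanZ (c : R) m (M : R) : measurable_fun setT m -> (forall x, `|m x| <= M) ->
  mean (fun x => c * m x) = c * mean m.
Proof. by move=> mm mM; rewrite /mean RintegralZl//; exact: imean mM. Qed.

Let add_cst_ge0 m (M : R) x : (forall x, `|m x| <= M) -> 0 <= m x + M.
Proof. by move=> /(_ x); rewrite ler_norml -lerBlDr sub0r => /andP[]. Qed.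

(** Adding the bound [M] makes bounded functions nonnegative, which transfers the identities above
    to signed functions. *)
Let mean_change m m' (M : R) : measurable_fun setT m -> measurable_fun setT m' ->
  (forall x, `|m x| <= M) -> (forall x, `|m' x| <= M) ->
  (\int[leb]_(x in half_itv) (m' x + M)%:E = \int[leb]_(x in half_itv) (m x + M)%:E)%E ->
  mean m' = mean m.
Proof.
move=> mm mm' mM m'M e.
have M0 : 0 <= M by exact: le_trans (mM 0).
have cM (y : R) : `|M| <= M by rewrite ger0_norm.
have bM (f : R -> R) : (forall x, `|f x| <= M) -> forall x, `|f x + M| <= M + M.
  by move=> fM x; rewrite (le_trans (ler_normD _ _))// lerD// ger0_norm.
have mc (f : R -> R) : measurable_fun setT f -> measurable_fun setT (fun x => f x + M).
  by move=> mf; apply: measurable_funD.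
rewrite (meanE (mc _ mm') (bM _ m'M)) (meanE (mc _ mm) (bM _ mM)) in e.
have mcst : measurable_fun setT (fun _ : R => M) by exact: measurable_cst.
move: e => -[]; rewrite (meanD mm' mcst m'M cM) (meanD mm mcst mM cM).
exact: addIr.
Qed.

Lemma mean_translate t m (M : R) : -1 <= t <= 1 -> measurable_fun setT m ->
  (forall x, `|m x| <= M) -> (forall x, m (x + 1) = m x) ->
  mean (fun x => m (x - t)) = mean m.
Proof.
move=> t1 mm mM mp; apply: (@mean_change _ _ M) => //.
  by apply: measurableT_comp mm _; exact: measurable_funB.
apply: (@ge0_integral_translate t (fun x => (m x + M)%:E)) => // [|x|x].
- by apply/measurable_EFinP; exact: measurable_funD.
- by rewrite lee_fin add_cst_ge0.
- by rewrite mp.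
Qed.

Lemma mean_odd m (M : R) : measurable_fun setT m -> (forall x, `|m x| <= M) ->
  (forall x, m (- x) = - m x) -> mean m = 0.
Proof.
move=> mm mM modd; have e : mean (fun x => m (- x)) = mean m.
  apply: (@mean_change _ _ M) => //.
    by apply: measurableT_comp mm _; exact: measurable_funN.
  apply: (@ge0_integral_reflect (fun x => (m x + M)%:E)) => // [|x].
    by apply/measurable_EFinP; exact: measurable_funD.
  by rewrite lee_fin add_cst_ge0.
have : mean (fun x => m (- x)) = - mean m.
  rewrite -mulN1r -(meanZ _ mm mM); congr mean; apply/funext => x.
  by rewrite modd mulN1r.
by rewrite e => h; apply/eqP; rewrite -eqr_opp oppr0 -[X in _ == X](subrr (mean m)) -h; apply/eqP; lra.
Qed.

End PeriodicIntegrals.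

(** * Weighting by the inverse of the design density *)

Section DesignDensity.
Context {R : realType} (g : R -> R).
Hypothesis hg : regular_density g.
Local Notation leb := (@lebesgue_measure R).

Lemma density_measurable : measurable_fun setT g.
Proof.
have [g0 _ gc _] := hg.
have -> : g = g \_ half_itv.
  apply/funext => x; rewrite patchE; case: ifPn => //; rewrite notin_setE => /g0 ->.
  by [].
apply: (proj1 (measurable_restrictT g (measurable_itv _))).
by apply: subspace_continuous_measurable_fun => //; exact: measurable_itv.
Qed.

Lemma density_ge0 x : 0 <= g x.
Proof.
have [g0 gp _ _] := hg; have [/gp/ltW//|/g0 -> //] := pselect (half_itv x).
Qed.

(** The density has a positive minimum on the compact interval; outside it vanishes and its inverse
    takes the default value 0. *)
Lemma density_inv_bounded : exists2 G : R, 0 < G & forall x, `|(g x)^-1| <= G.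
Proof.
have [g0 gp gc _] := hg.
have h : - 2^-1 <= 2^-1 :> R by lra.
have [c ci cmin] := EVT_min h gc.
have gcp : 0 < g c by exact: gp.
exists (g c)^-1; first by rewrite invr_gt0.
move=> x; have [hx|/g0 ->] := pselect (half_itv x); last by rewrite invr0 normr0 invr_ge0 ltW.
have gxp := gp _ hx.
rewrite ger0_norm ?invr_ge0 ?(ltW gxp)// lef_pV2//; exact: cmin.
Qed.

Context d (Omega : measurableType d) (P : probability Omega R).
Context (X : {RV P >-> R}).
Hypothesis hX : has_density X g.

Let mX : measurable_fun setT (X : Omega -> R). Proof. exact: measurable_funP. Qed.

Let minv : measurable_fun setT (fun x => (g x)^-1).
Proof. by apply: measurableT_comp; [exact: measurable_inv|exact: density_measurable]. Qed.

Lemma L1_over_density (m : R -> R) (M : R) : measurable_fun setT m ->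
  (forall x, `|m x| <= M) -> L1 P (fun w => m (X w) / g (X w)).
Proof.
move=> mm mM; have [G G0 gG] := density_inv_bounded.
apply: (@L1_bounded _ _ _ _ _ (M * G)) => [|w]; last by rewrite normrM ler_pM.
have mq : measurable_fun setT (fun x => m x / g x) by exact: measurable_funM.
exact: (measurableT_comp mq mX).
Qed.

(** The weight cancels the density on the interval, and both integrands vanish outside. *)
Let Ex_over_density_ge0 (m : R -> R) (M : R) : measurable_fun setT m ->
  (forall x, `|m x| <= M) -> (forall x, 0 <= m x) ->
  Ex P (fun w => m (X w) / g (X w)) = mean m.
Proof.
move=> mm mM m0.
have mq : measurable_fun setT (fun x => m x / g x) by exact: measurable_funM.
have q0 x : 0 <= m x / g x by rewrite divr_ge0// density_ge0.
suff: (Ex P (fun w => m (X w) / g (X w)))%:E = (mean m)%:E by case.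
rewrite -(Ex_integral (L1_over_density mm mM)) -(meanE mm mM).
have mX' : measurable_fun setT (X : Omega -> measurableTypeR R) by exact: mX.
transitivity (\int[law P mX']_x (m x / g x)%:E)%E.
  rewrite /law ge0_integral_distribution; first by [].
  - exact/measurable_EFinP.
  - by move=> x; rewrite lee_fin.
rewrite (@ge0_integral_density _ (measurableTypeR R) R leb (law P mX') g density_measurable density_ge0 _ _ mq q0).
  rewrite [RHS]integral_mkcond; apply: eq_integral => x _; rewrite patchE.
  have [g0 gp _ _] := hg; case: ifPn => [|]; rewrite (inE, notin_setE) => hx.
    by rewrite divfK// gt_eqF// gp.
  by rewrite g0// mulr0.
exact: hX.
Qed.

Lemma Ex_over_density (m : R -> R) (M : R) : measurable_fun setT m ->
  (forall x, `|m x| <= M) -> Ex P (fun w => m (X w) / g (X w)) = mean m.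
Proof.
move=> mm mM; have M0 : 0 <= M by exact: le_trans (mM 0).
have mc : measurable_fun setT (fun _ : R => M) by exact: measurable_cst.
have cM (x : R) : `|M| <= M by rewrite ger0_norm.
have mD : measurable_fun setT (fun x => m x + M) by exact: measurable_funD.
have DM x : `|m x + M| <= M + M by rewrite (le_trans (ler_normD _ _))// lerD// (cM x).
have D0 x : 0 <= m x + M by have := mM x; rewrite ler_norml -lerBlDr sub0r => /andP[].
have := Ex_over_density_ge0 mD DM D0.
have -> : (fun w => (m (X w) + M) / g (X w)) = (fun w => m (X w) / g (X w) + M / g (X w)).
  by apply/funext => w; rewrite mulrDl.
rewrite ExD; [|exact: (L1_over_density mm mM)|exact: (L1_over_density mc cM)].
rewrite (Ex_over_density_ge0 mc cM)//.
rewrite (meanD mm mc mM cM); exact: addIr.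
Qed.

End DesignDensity.

(** * Moments of the sine and cosine scores at the true parameter *)

Section Scores.
Context {R : realType} {d : measure_display} {Omega : measurableType d}.
Context (P : probability Omega R) {p : nat}.
Context (g f : R -> R) (a theta v : 'cV[R]_p) (sigma : 'I_p -> R).
Context (X : nat -> {RV P >-> R}) (eps : nat -> 'I_p -> {RV P >-> R}).
Hypotheses (hg : regular_density g) (hXdens : forall i, has_density (X i) g)
  (hXindep : mutually_independent X) (hf : admissible_shape f)
  (htheta : forall j, `|theta j 0| <= 1)
  (hepsindep : mutually_independent (fun ij : nat * 'I_p => eps ij.1 ij.2))
  (hXeps : independent_families X (fun ij : nat * 'I_p => eps ij.1 ij.2))
  (hepsmean : forall i j, ('E_P[eps i j] = 0)%E)
  (hepsvar : forall i j,
     ('E_P[fun w => (eps i j w ^+ 2)%R] = (sigma j ^+ 2)%:E)%E)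
  (hepslaw : forall i j, same_law (eps i j) (eps 0%N j)).

Definition observations : nat + nat * 'I_p -> {RV P >-> R} :=
  sum_family X (fun ij => eps ij.1 ij.2).

Definition obs_time (k : nat + nat * 'I_p) : nat :=
  match k with inl i => i | inr ij => ij.1 end.

(** With times numbered from 0, [obs_before n] determines the iterate [n], and [obs_at n] is the
    fresh data that leads to the next one. *)
Definition obs_at (n : nat) : set (nat + nat * 'I_p) := [set k | obs_time k = n].

Definition obs_before (n : nat) : set (nat + nat * 'I_p) :=
  [set k | (obs_time k < n)%N].

Lemma observations_indep : mutually_independent observations.
Proof. exact: sum_family_indep. Qed.

Lemma obs_before_at n : obs_before n `&` obs_at n = set0.
Proof.
apply/seteqP; split => // k [h1 h2].
by have : (obs_time k < n)%N := h1; rewrite (h2 : obs_time k = n) ltnn.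
Qed.

Local Notation Zon := (meas_on observations).

Let meas_X n : Zon [set inl n] (X n).
Proof. exact: (@meas_on_coord _ _ _ P _ observations [set inl n] (inl n)). Qed.

Let meas_eps n j : Zon [set inr (n, j)] (eps n j).
Proof. exact: (@meas_on_coord _ _ _ P _ observations [set inr (n, j)] (inr (n, j))). Qed.

Arguments meas_X : clear implicits.
Arguments meas_eps : clear implicits.

Let MX n : measurable_fun setT (X n : Omega -> R). Proof. exact: measurable_funP. Qed.
Let Meps n j : measurable_fun setT (eps n j : Omega -> R). Proof. exact: measurable_funP. Qed.

Lemma L1_noise_sqr n j : L1 P (fun w => eps n j w ^+ 2).
Proof.
apply: L1_ge0 => [|w|]; [by mfun|exact: sqr_ge0|].
by have := hepsvar n j; rewrite unlock => ->; rewrite ltry.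
Qed.

Lemma Ex_noise_sqr n j : Ex P (fun w => eps n j w ^+ 2) = sigma j ^+ 2.
Proof.
have := hepsvar n j; rewrite unlock (Ex_integral (L1_noise_sqr n j)).
by case.
Qed.

Lemma L1_noise n j : L1 P (eps n j).
Proof.
apply: (@L1_le _ _ _ _ _ (fun w => 1 + eps n j w ^+ 2)) => [//|w|].
  by rewrite -(real_normK (num_real (eps n j w))); have := sqr_ge0 (`|eps n j w| - 1); nra.
by apply: L1D; [exact: L1_cst|exact: L1_noise_sqr].
Qed.

Lemma Ex_noise n j : Ex P (eps n j) = 0.
Proof. by have := hepsmean n j; rewrite unlock (Ex_integral (L1_noise n j)); case. Qed.

Let Ex_design_noise n j (h : R -> R) (M : R) : measurable_fun setT h ->
  (forall x, `|h x| <= M) ->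
  L1 P (fun w => h (X n w) * eps n j w) /\ Ex P (fun w => h (X n w) * eps n j w) = 0.
Proof.
move=> mh hM; have J : [set inl n] `&` [set inr (n, j)] = set0 :> set (nat + nat * 'I_p).
  by apply/seteqP; split => // k [/= -> ].
have mhX : Zon [set inl n] (fun w => h (X n w)) by apply: measurableT_comp mh _; exact: meas_X.
have iX : L1 P (fun w => h (X n w)).
  by apply: L1_bounded (meas_on_measurable mhX) (fun w => hM (X n w)).
split; first exact: (meas_on_mul_L1 observations_indep J mhX (meas_eps n j) iX (L1_noise n j)).
rewrite (meas_on_mul_Ex observations_indep J mhX (meas_eps n j) iX (L1_noise n j)).
by rewrite Ex_noise mulr0.
Qed.

Let noise_prod n j l : L1 P (fun w => eps n j w * eps n l w) /\
  Ex P (fun w => eps n j w * eps n l w) = (if j == l then sigma j ^+ 2 else 0).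
Proof.
have [<-|jl] := eqVneq j l.
  have -> : (fun w => eps n j w * eps n j w) = (fun w => eps n j w ^+ 2).
    by apply/funext => w; rewrite expr2.
  by split; [exact: L1_noise_sqr|exact: Ex_noise_sqr].
have J : [set inr (n, j)] `&` [set inr (n, l)] = set0 :> set (nat + nat * 'I_p).
  by apply/seteqP; split => // k [/= -> [e]]; move: jl; rewrite e eqxx.
split; first exact: (meas_on_mul_L1 observations_indep J (meas_eps n j) (meas_eps n l) (L1_noise n j) (L1_noise n l)).
rewrite (meas_on_mul_Ex observations_indep J (meas_eps n j) (meas_eps n l) (L1_noise n j) (L1_noise n l)).
by rewrite Ex_noise mul0r.
Qed.

Let Ex_design_noise2 n j l (h : R -> R) (M : R) : measurable_fun setT h ->
  (forall x, `|h x| <= M) ->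
  L1 P (fun w => h (X n w) * (eps n j w * eps n l w)) /\
  Ex P (fun w => h (X n w) * (eps n j w * eps n l w)) =
  Ex P (fun w => h (X n w)) * (if j == l then sigma j ^+ 2 else 0).
Proof.
move=> mh hM; have J : [set inl n] `&` [set inr (n, j); inr (n, l)] = set0 :> set (nat + nat * 'I_p).
  by apply/seteqP; split => // k [/= -> [] ].
have mhX : Zon [set inl n] (fun w => h (X n w)) by apply: measurableT_comp mh _; exact: meas_X.
have iX : L1 P (fun w => h (X n w)).
  by apply: L1_bounded (meas_on_measurable mhX) (fun w => hM (X n w)).
have mee : Zon [set inr (n, j); inr (n, l)] (fun w => eps n j w * eps n l w).
  rewrite /meas_on; apply: measurable_funM.
  - by apply: (meas_on_sub _ (meas_eps n j)) => k /= ->; left.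
  - by apply: (meas_on_sub _ (meas_eps n l)) => k /= ->; right.
have [i e] := noise_prod n j l.
split; first exact: (meas_on_mul_L1 observations_indep J mhX mee iX i).
by rewrite (meas_on_mul_Ex observations_indep J mhX mee iX i) e.
Qed.

Lemma Ex_design_stationary n (h : R -> R) (M : R) : measurable_fun setT h ->
  (forall x, `|h x| <= M) -> Ex P (fun w => h (X n w)) = Ex P (fun w => h (X 0%N w)).
Proof.
move=> mh hM.
have E k : Ex P (fun w => h (X k w)) = Ex (law P (MX k)) h.
  rewrite (Ex_law (MX k) mh)//.
  by apply: L1_bounded (measurableT_comp mh (MX k)) (fun w => hM (X k w)).
rewrite !E; apply: eq_Ex_measure => A mA.
by transitivity (\int[lebesgue_measure]_(x in A) (g x)%:E)%E; [exact: hXdens|exact/esym/hXdens].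
Qed.


Context (F G : R) (fF : forall x, `|f x| <= F) (gG : forall x, `|(g x)^-1| <= G).

(** For [q = sin] and [q = cos] these are [A] and [B]; the statistic computed at another parameter
    is a rotation of the pair. *)
Definition score (q : R -> R) (n : nat) (j : 'I_p) (w : Omega) : R :=
  Num.sg (a j 0 * fourier1 f) * (q (2 * pi * (X n w - theta j 0)) / g (X n w) *
    (a j 0 * f (X n w - theta j 0) + v j 0 + eps n j w)).

Let F0 : 0 <= F. Proof. exact: le_trans (fF 0). Qed.
Let G0 : 0 <= G. Proof. exact: le_trans (gG 0). Qed.

Let sg1 (y : R) : `|Num.sg y| <= 1.
Proof. by rewrite normr_sg; case: (_ != _). Qed.

Let minv : measurable_fun setT (fun x => (g x)^-1).
Proof. by apply: measurableT_comp; [exact: measurable_inv|exact: density_measurable]. Qed.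

Let mf : measurable_fun setT f. Proof. by have [] := hf. Qed.

Section GenericScore.
Context (q : R -> R) (mq : measurable_fun setT q) (q1 : forall y, `|q y| <= 1)
  (qp : forall y, q (y + 2 * pi) = q y).

(** The score is a function of the design, namely a translate of the periodic [base] over [g], plus
    a bounded design weight times the noise. *)
Let base j x := Num.sg (a j 0 * fourier1 f) * (q (2 * pi * x) * (a j 0 * f x + v j 0)).
Let signal j x := base j (x - theta j 0).
Let weight j x := Num.sg (a j 0 * fourier1 f) * q (2 * pi * (x - theta j 0)).
Let B j := `|a j 0| * F + `|v j 0|.

Let scoreE n j w : score q n j w =
  signal j (X n w) / g (X n w) + weight j (X n w) / g (X n w) * eps n j w.
Proof. by rewrite /score /signal /weight /base; ring. Qed.

Let mq2 (t : R) : measurable_fun setT (fun x : R => q (2 * pi * (x - t))).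
Proof.
apply: measurableT_comp mq _; apply: measurable_funM; first exact: measurable_cst.
by apply: measurable_funB.
Qed.

Let mq2' : measurable_fun setT (fun x => q (2 * pi * x)).
Proof. by apply: measurableT_comp mq _; apply: measurable_funM; first exact: measurable_cst. Qed.

Let mbase j : measurable_fun setT (base j).
Proof.
apply: measurable_funM; first exact: measurable_cst.
apply: measurable_funM => //; apply: measurable_funD; last exact: measurable_cst.
by apply: measurable_funM; first exact: measurable_cst.
Qed.

Let msignal j : measurable_fun setT (signal j).
Proof. by apply: measurableT_comp (mbase j) _; exact: measurable_funB. Qed.

Let mweight j : measurable_fun setT (weight j).
Proof. by apply: measurable_funM; first exact: measurable_cst. Qed.

Let base_le j x : `|base j x| <= B j.
Proof.
rewrite /base !normrM -[leRHS]mul1r; apply: ler_pM => //; rewrite -[leRHS]mul1r; apply: ler_pM => //; apply: (le_trans (ler_normD _ _)).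
by rewrite normrM lerD2r ler_wpM2l.
Qed.

Let signal_le j x : `|signal j x| <= B j. Proof. exact: base_le. Qed.

Let weight_le j x : `|weight j x| <= 1.
Proof. by rewrite /weight normrM -[leRHS]mul1r ler_pM. Qed.

Let B0 j : 0 <= B j. Proof. by rewrite addr_ge0// mulr_ge0. Qed.

Let mdiv (h : R -> R) : measurable_fun setT h -> measurable_fun setT (fun x => h x / g x).
Proof. by move=> mh; exact: measurable_funM. Qed.

Let div_le (h : R -> R) (M : R) : (forall x, `|h x| <= M) -> forall x, `|h x / g x| <= M * G.
Proof. by move=> hM x; rewrite normrM ler_pM. Qed.

Lemma score_le n j w : `|score q n j w| <= G * (B j + `|eps n j w|).
Proof.
rewrite scoreE mulrDr; apply: (le_trans (ler_normD _ _)); apply: lerD.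
  by rewrite [leRHS]mulrC; exact: (div_le (signal_le j)).
rewrite normrM ler_wpM2r// -[leRHS]mul1r; exact: (div_le (weight_le j)).
Qed.

Lemma score_meas n j : Zon (obs_at n) (score q n j).
Proof.
have hX : Zon (obs_at n) (X n) by apply: (meas_on_sub _ (meas_X n)) => k /= ->.
have he : Zon (obs_at n) (eps n j) by apply: (meas_on_sub _ (meas_eps n j)) => k /= ->.
have -> : score q n j = fun w => signal j (X n w) / g (X n w) + weight j (X n w) / g (X n w) * eps n j w.
  by apply/funext => w; exact: scoreE.
apply: measurable_funD; first by apply: measurableT_comp (mdiv (msignal j)) hX.
by apply: measurable_funM => //; apply: measurableT_comp (mdiv (mweight j)) hX.
Qed.

Let bw j := div_le (weight_le j).
Let bs j : forall x, `|signal j x / g x| <= B j * G.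
Proof. exact: div_le (signal_le j). Qed.

(** The noise part is centered, the density cancels, and periodicity removes the translation by
    [theta]. *)
Lemma Ex_score n j : Ex P (score q n j) = Num.sg (a j 0 * fourier1 f) *
  (a j 0 * mean (fun x => q (2 * pi * x) * f x) + v j 0 * mean (fun x => q (2 * pi * x))).
Proof.
have [iw ew] := Ex_design_noise n j (mdiv (mweight j)) (bw j).
have is_ : L1 P (fun w => signal j (X n w) / g (X n w)).
  exact: (@L1_over_density _ _ hg _ _ P (X n) _ _ (msignal j) (signal_le j)).
have -> : score q n j = fun w => signal j (X n w) / g (X n w) + weight j (X n w) / g (X n w) * eps n j w.
  by apply/funext => w; exact: scoreE.
rewrite ExD// ew addr0 (Ex_over_density hg (hXdens n) (msignal j) (signal_le j)).
have [_ _ _ fp _] := hf.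
rewrite (@mean_translate R (theta j 0) (base j) (B j))//; last 2 first.
- by have := htheta j; rewrite ler_norml.
- by move=> x; rewrite /base fp [2 * pi * (x + 1)]mulrDr mulr1 qp.
have m1 : measurable_fun setT (fun x => q (2 * pi * x) * f x) by exact: measurable_funM.
have b1 x : `|q (2 * pi * x) * f x| <= F by rewrite normrM -[leRHS]mul1r ler_pM.
have b2 x : `|q (2 * pi * x)| <= 1 by [].
have m1' : measurable_fun setT (fun x => a j 0 * (q (2 * pi * x) * f x)).
  by apply: measurable_funM => //; exact: measurable_cst.
have m2' : measurable_fun setT (fun x => v j 0 * q (2 * pi * x)).
  by apply: measurable_funM => //; exact: measurable_cst.
have b1' x : `|a j 0 * (q (2 * pi * x) * f x)| <= B j.
  by rewrite normrM /B -[leLHS]addr0 lerD// ler_wpM2l.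
have b2' x : `|v j 0 * q (2 * pi * x)| <= B j.
  by rewrite normrM /B -[leLHS]add0r lerD ?mulr_ge0// -[leRHS]mulr1 ler_wpM2l.
have m3 : measurable_fun setT (fun x => a j 0 * (q (2 * pi * x) * f x) + v j 0 * q (2 * pi * x)).
  exact: measurable_funD.
have b3 x : `|a j 0 * (q (2 * pi * x) * f x) + v j 0 * q (2 * pi * x)| <= B j + B j.
  by rewrite (le_trans (ler_normD _ _))// lerD.
rewrite -(meanZ _ m1 b1) -(meanZ _ mq2' b2) -(meanD m1' m2' b1' b2') -(meanZ _ m3 b3).
by congr mean; apply/funext => x; rewrite /base; ring.
Qed.

(** Terms with a single noise vanish. The others involve only the design law and the noise
    variances, which do not depend on [n]. *)
Lemma Ex_score_prod_stationary n j l :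
  Ex P (fun w => score q n j w * score q n l w) = Ex P (fun w => score q 0 j w * score q 0 l w).
Proof.
pose hs i x := signal i x / g x; pose hw i x := weight i x / g x.
have ms i : measurable_fun setT (hs i) by exact: mdiv.
have mw i : measurable_fun setT (hw i) by exact: mdiv.
have bss x : `|hs j x * hs l x| <= B j * G * (B l * G) by rewrite normrM ler_pM ?bs.
have bsw i i' x : `|hs i x * hw i' x| <= B i * G * (1 * G) by rewrite normrM ler_pM ?bs ?bw.
have bww x : `|hw j x * hw l x| <= 1 * G * (1 * G) by rewrite normrM ler_pM ?bw.
have mss : measurable_fun setT (fun x => hs j x * hs l x) by exact: measurable_funM.
have msw i i' : measurable_fun setT (fun x => hs i x * hw i' x) by exact: measurable_funM.
have mww : measurable_fun setT (fun x => hw j x * hw l x) by exact: measurable_funM.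
suff E k : Ex P (fun w => score q k j w * score q k l w) =
    Ex P (fun w => hs j (X 0 w) * hs l (X 0 w)) +
    Ex P (fun w => hw j (X 0 w) * hw l (X 0 w)) * (if j == l then sigma j ^+ 2 else 0).
  by rewrite !E.
have [i1 e1] := Ex_design_noise k l (msw j l) (bsw j l).
have [i2 e2] := Ex_design_noise k j (msw l j) (bsw l j).
have [i3 e3] := Ex_design_noise2 k j l mww bww.
have i0 : L1 P (fun w => hs j (X k w) * hs l (X k w)).
  by apply: L1_bounded (fun w => bss (X k w)); exact: (measurableT_comp mss (MX k)).
have -> : (fun w => score q k j w * score q k l w) =
   (fun w => hs j (X k w) * hs l (X k w) + (hs j (X k w) * hw l (X k w) * eps k l w +
     (hs l (X k w) * hw j (X k w) * eps k j w + hw j (X k w) * hw l (X k w) * (eps k j w * eps k l w)))).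
  by apply/funext => w; rewrite !scoreE /hs /hw; ring.
rewrite !ExD//; do ?[apply: L1D => //].
rewrite e1 e2 !add0r e3; congr (_ + _ * _).
  exact: (Ex_design_stationary k mss bss).
exact: (Ex_design_stationary k mww bww).
Qed.

End GenericScore.

Let sin_per (y : R) : sin (y + 2 * pi) = sin y.
Proof. by rewrite mulrDl mul1r addrA !sinDpi opprK. Qed.
Let cos_per (y : R) : cos (y + 2 * pi) = cos y.
Proof. by rewrite mulrDl mul1r addrA !cosDpi opprK. Qed.

Lemma Ex_score_sin n j : Ex P (score sin n j) = 0.
Proof.
have [_ fN _ _ _] := hf.
have m1 : measurable_fun setT (fun x : R => sin (2 * pi * x)) by mfun.
rewrite (Ex_score (@measurable_sin R) (@sin_max R) sin_per).
rewrite (@mean_odd R _ F); first last.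
- by move=> x; rewrite fN mulrN sinN mulNr.
- by move=> x; rewrite normrM -[leRHS]mul1r ler_pM// sin_max.
- exact: measurable_funM.
rewrite (@mean_odd R _ 1)//; first by rewrite !mulr0 addr0 mulr0.
- by move=> x; exact: sin_max.
- by move=> x; rewrite mulrN sinN.
Qed.

Lemma Ex_score_cos n j : Ex P (score cos n j) = `|a j 0 * fourier1 f|.
Proof.
rewrite (Ex_score (@measurable_cos R) (@cos_max R) cos_per).
have m1 : measurable_fun setT (fun x : R => cos (2 * pi * x)) by mfun.
have b1 (x : R) : `|cos (2 * pi * x)| <= 1 by exact: cos_max.
(* Translation by half a period changes the sign of this cosine but not its mean. *)
have e : mean (fun x : R => cos (2 * pi * x)) = 0.
  have := @mean_translate R 2^-1 _ 1 _ m1 b1.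
  have -> : (fun x : R => cos (2 * pi * (x - 2^-1))) = (fun x : R => -1 * cos (2 * pi * x)).
    apply/funext => x; rewrite (_ : 2 * pi * x = 2 * pi * (x - 2^-1) + pi); last by field.
    by rewrite cosDpi mulN1r opprK.
  rewrite (meanZ _ m1 b1) => h.
  have {}h : -1 * mean (fun x : R => cos (2 * pi * x)) = mean (fun x : R => cos (2 * pi * x)).
    by apply: h => [|x]; [lra|rewrite mulrDr mulr1 cos_per].
  lra.
rewrite e mulr0 addr0 normrEsg; congr (_ * (_ * _)).
Qed.

Lemma phi_score : phi P g f a theta v (X 0%N) (fun j => eps 0%N j) theta =
  \matrix_(k, l) Ex P (fun w => score sin 0 k w * score sin 0 l w).
Proof.
apply/matrixP => k l; rewrite !mxE; rewrite Ex.unlock /Rintegral unlock; congr fine.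
apply: eq_integral => w _; congr EFin.
have V j : Vvec g f a theta v theta (X 0 w) (fun j => eps 0%N j w) j 0 = score sin 0 j w.
  rewrite /Vvec /Dmat -mulmxA mul_diag_mx -scalemxAl mul_diag_mx !mxE /score; ring.
by rewrite mxE big_ord1 [X in _ * X]mxE !V.
Qed.

End Scores.

(** * A common bound for the scores and its Lindeberg condition *)

Section NoiseEnvelope.
Context {R : realType} {d : measure_display} {Omega : measurableType d}.
Context (P : probability Omega R) {p : nat} (sigma : 'I_p -> R).
Context (eps : nat -> 'I_p -> {RV P >-> R}).
Hypotheses (hepsvar : forall i j,
     ('E_P[fun w => (eps i j w ^+ 2)%R] = (sigma j ^+ 2)%:E)%E)
  (hepslaw : forall i j, same_law (eps i j) (eps 0%N j)).
Context (c : R) (c1 : 1 <= c).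

(** The square root makes the squared envelope affine in the squared noises, so its second moment is
    explicit. *)
Definition envelope (n : nat) (w : Omega) : R :=
  c * Num.sqrt (1 + \sum_j eps n j w ^+ 2).

Let S0 n w : 0 <= \sum_j eps n j w ^+ 2.
Proof. by apply: sumr_ge0 => j _; exact: sqr_ge0. Qed.

Let c0 : 0 < c. Proof. exact: lt_le_trans c1. Qed.

Lemma envelope_ge n w : c <= envelope n w.
Proof.
rewrite /envelope ler_peMr ?(ltW c0)// -[leLHS]sqrtr1 ler_wsqrtr//.
by rewrite lerDl.
Qed.

Lemma envelope_ge_affine n j w (s t : R) : 0 <= s -> 0 <= t -> s + t <= c ->
  s + t * `|eps n j w| <= envelope n w.
Proof.
move=> s0 t0 stc; set r := Num.sqrt (1 + \sum_i eps n i w ^+ 2).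
have r0 : 0 <= r by exact: sqrtr_ge0.
have r1 : 1 <= r by rewrite -[leLHS]sqrtr1 ler_wsqrtr// lerDl.
have re : `|eps n j w| <= r.
  rewrite -sqrtr_sqr ler_wsqrtr// (bigD1 j)//= addrCA lerDl.
  by rewrite addr_ge0// sumr_ge0// => i _; exact: sqr_ge0.
apply: (@le_trans _ _ ((s + t) * r)); last by rewrite ler_wpM2r.
by rewrite mulrDl lerD ?ler_peMr// ler_wpM2l.
Qed.

Lemma envelope_sqr n w : envelope n w ^+ 2 = c ^+ 2 * (1 + \sum_j eps n j w ^+ 2).
Proof. by rewrite exprMn sqr_sqrtr// addr_ge0. Qed.

Lemma L1_envelope_sqr n : L1 P (fun w => envelope n w ^+ 2).
Proof.
under [X in L1 _ X]eq_fun do rewrite envelope_sqr.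
apply: L1Z; apply: L1D; first exact: L1_cst.
by apply: L1_sum => j _; exact: (L1_noise_sqr hepsvar).
Qed.

Lemma Ex_envelope_sqr n : Ex P (fun w => envelope n w ^+ 2) = c ^+ 2 * (1 + \sum_j sigma j ^+ 2).
Proof.
have iS : L1 P (fun w => \sum_j eps n j w ^+ 2).
  by apply: L1_sum => j _; exact: (L1_noise_sqr hepsvar).
under [X in Ex _ X]eq_fun do rewrite envelope_sqr.
rewrite ExZ; last by apply: L1D => //; exact: L1_cst.
rewrite ExD//; last exact: L1_cst.
rewrite Ex_cst Ex_sum => [|j]; last exact: (L1_noise_sqr hepsvar).
by under eq_bigr do rewrite (Ex_noise_sqr hepsvar).
Qed.

Let b (t z : R) := z * Num.min 1 (t * Num.sqrt z).

Let b_ge0 t z : 0 <= t -> 0 <= z -> 0 <= b t z.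
Proof. by move=> t0 z0; rewrite mulr_ge0// le_min ler01 mulr_ge0// sqrtr_ge0. Qed.

Let b_le t z : 0 <= z -> b t z <= z.
Proof. by move=> z0; rewrite ler_piMr// ge_min lexx. Qed.

Let b_le_lin t z : 0 <= z -> b t z <= t * (z * Num.sqrt z).
Proof. by move=> z0; rewrite /b [leRHS]mulrCA ler_wpM2l// ge_min lexx orbT. Qed.

Let b_homo t z z' : 0 <= t -> 0 <= z -> z <= z' -> b t z <= b t z'.
Proof.
move=> t0 z0 zz; apply: ler_pM => //.
  by rewrite le_min ler01 mulr_ge0// sqrtr_ge0.
rewrite le_min !ge_min lexx/=; apply/orP; right.
by rewrite ler_wpM2l// ler_wsqrtr.
Qed.

Let q : R := p.+1%:R.

(** Among the [q = p + 1] terms of the sum, the largest is at least the average; since [b t] is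
    nondecreasing, [b t] of the sum is at most [b t] of [q] times that term. *)
Let b_sum n t w : 0 <= t ->
  b t (1 + \sum_j eps n j w ^+ 2) <= b t q + \sum_j b t (q * eps n j w ^+ 2).
Proof.
move=> t0; set S := \sum_j _ ^+ 2.
have S1 : 0 <= 1 + S by rewrite addr_ge0// S0.
have q0 : 0 <= q by exact: ler0n.
have bs j : 0 <= b t (q * eps n j w ^+ 2) by apply: b_ge0 => //; rewrite mulr_ge0// sqr_ge0.
have [Sq|Sq] := leP (1 + S) q.
  by rewrite -[leLHS]addr0 lerD ?sumr_ge0//; exact: b_homo.
have [/existsP[j jS]|/existsPn none] := boolP [exists j, 1 + S <= q * eps n j w ^+ 2].
  rewrite (bigD1 j)//= addrCA -[leLHS]addr0 lerD//; first exact: b_homo.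
  by rewrite addr_ge0 ?sumr_ge0// b_ge0.
exfalso.
have : q * S <= \sum_(j < p) (1 + S).
  rewrite /S mulr_sumr; apply: ler_sum => j _.
  by have := none j; rewrite -ltNge => /ltW.
rewrite sumr_const card_ord -[_ *+ p]mulr_natl.
by move: Sq; rewrite /q -natr1; lra.
Qed.

Let mb t (F : Omega -> R) : measurable_fun setT F -> measurable_fun setT (fun w => b t (F w)).
Proof.
move=> mF; apply: measurable_funM => //; apply: measurable_minr; first exact: measurable_cst.
apply: measurable_funM; first exact: measurable_cst.
apply: measurableT_comp mF; apply: continuous_measurable_fun; exact: sqrt_continuous.
Qed.

Let L1b n j t : 0 <= t -> L1 P (fun w => b t (q * eps n j w ^+ 2)).
Proof.
move=> t0; apply: (@L1_le _ _ _ _ _ (fun w => q * eps n j w ^+ 2)).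
- by apply: mb; mfun.
- move=> w; have z0 : 0 <= q * eps n j w ^+ 2 by rewrite mulr_ge0 ?sqr_ge0.
  by rewrite ger0_norm ?b_ge0 ?b_le.
- by apply: L1Z; exact: (L1_noise_sqr hepsvar).
Qed.

Let Exb_stationary n j t : 0 <= t -> Ex P (fun w => b t (q * eps n j w ^+ 2)) =
  Ex P (fun w => b t (q * eps 0%N j w ^+ 2)).
Proof.
move=> t0; have mid : measurable_fun setT (fun y : R => y) by exact: measurable_id.
have mh : measurable_fun setT (fun y : R => b t (q * y ^+ 2)).
  apply: measurable_funM; first by mfun.
  apply: measurable_minr; first exact: measurable_cst.
  apply: measurable_funM; first exact: measurable_cst.
  apply: (@measurableT_comp _ _ _ _ _ _ (@Num.sqrt R)); last by mfun.
  apply: continuous_measurable_fun; exact: sqrt_continuous.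
have me k : measurable_fun setT (eps k j : Omega -> R) by exact: measurable_funP.
have E k : Ex P (fun w => b t (q * eps k j w ^+ 2)) = Ex (law P (me k)) (fun y : R => b t (q * y ^+ 2)).
  by rewrite (Ex_law (me k) mh)//; exact: L1b.
by rewrite !E; apply: eq_Ex_measure => A mA; exact: hepslaw.
Qed.

(** Dominated convergence along [t = 1 / m.+1] for the noises at time 0; equality in law makes the
    bound uniform in [n]. The final [t] is divided by [c] to offset the scale of the envelope. *)
Lemma envelope_lindeberg (e : R) : 0 < e -> exists2 t : R, 0 < t &
  forall n, Ex P (fun w => envelope n w ^+ 2 * Num.min 1 (t * envelope n w)) <= e.
Proof.
move=> e0.
have q0 : 0 <= q by exact: ler0n.
have z0 n j w : 0 <= q * eps n j w ^+ 2 by rewrite mulr_ge0 ?sqr_ge0.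
pose Gm n m w := b (@harmonic R m) q + \sum_j b (@harmonic R m) (q * eps n j w ^+ 2).
have h0 m : 0 <= @harmonic R m by exact: harmonic_ge0.
have iG n m : L1 P (Gm n m).
  apply: L1D; first exact: L1_cst.
  by apply: L1_sum => j _; exact: L1b.
have EG n m : Ex P (Gm n m) = Ex P (Gm 0%N m).
  have E k : Ex P (Gm k m) = b (@harmonic R m) q + \sum_j Ex P (fun w => b (@harmonic R m) (q * eps k j w ^+ 2)).
    rewrite /Gm ExD; [|exact: L1_cst|by apply: L1_sum => j _; exact: L1b].
    by rewrite Ex_cst Ex_sum// => j; exact: L1b.
  by rewrite !E; congr (_ + _); apply: eq_bigr => j _; exact: Exb_stationary.
have G0 n m w : 0 <= Gm n m w.
  by rewrite addr_ge0 ?b_ge0// sumr_ge0// => j _; exact: b_ge0.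
have Gcvg : Ex P (Gm 0%N m) @[m --> \oo] --> (0 : R).
  rewrite -[X in _ --> X](Ex_cst P 0).
  apply: (@Ex_dominated_cvg _ _ _ _ _ _ (fun w => q + \sum_j q * eps 0%N j w ^+ 2)).
  - by move=> m; exact: L1_measurable (iG 0%N m).
  - exact: L1_cst.
  - apply: L1D; first exact: L1_cst.
    by apply: L1_sum => j _; apply: L1Z; exact: (L1_noise_sqr hepsvar).
  - move=> m w; rewrite ger0_norm//; apply: lerD; first exact: b_le.
    by apply: ler_sum => j _; exact: b_le.
  - move=> w; pose W := q * Num.sqrt q + \sum_j (q * eps 0%N j w ^+ 2) * Num.sqrt (q * eps 0%N j w ^+ 2).
    apply: (@squeeze_cvgr _ _ _ _ (fun=> 0) (fun m => @harmonic R m * W)).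
    + apply: nearW => m; rewrite G0/= /Gm /W mulrDr mulr_sumr lerD//.
        exact: b_le_lin.
      by apply: ler_sum => j _; exact: b_le_lin.
    + exact: cvg_cst.
    + by rewrite -[X in _ --> X](mul0r W); apply: cvgM; [exact: cvg_harmonic|exact: cvg_cst].
have ec : 0 < e / c ^+ 2 by rewrite divr_gt0// exprn_gt0.
move/cvgrPdist_le: Gcvg => /(_ _ ec) [m _ /(_ m (leqnn m))].
rewrite sub0r normrN ger0_norm; last by apply: Ex_ge0.
move=> Gm_le; exists (@harmonic R m / c); first by rewrite divr_gt0// harmonic_gt0.
move=> n; rewrite ler_pdivlMr ?exprn_gt0// mulrC in Gm_le.
apply: le_trans Gm_le; rewrite -(EG n m) -ExZ//.
have E w : envelope n w ^+ 2 * Num.min 1 (@harmonic R m / c * envelope n w) =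
    c ^+ 2 * b (@harmonic R m) (1 + \sum_j eps n j w ^+ 2).
  by rewrite envelope_sqr /b -mulrA; congr (_ * (_ * Num.min _ _)); rewrite /envelope mulrA divfK ?gt_eqF.
have mH : measurable_fun setT (fun w => b (@harmonic R m) (1 + \sum_j eps n j w ^+ 2)) by apply: mb; mfun.
under [X in Ex _ X <= _]eq_fun do rewrite E.
apply: Ex_le; [|exact: L1Z|] => [|w]; last by rewrite ler_wpM2l ?sqr_ge0// b_sum.
apply: L1Z; apply: (L1_le mH _ (iG n m)) => w.
by rewrite ger0_norm ?b_sum// b_ge0// addr_ge0// S0.
Qed.

End NoiseEnvelope.

(** * The Robbins-Monro iterates of the shape invariant model *)

Section ShapeInvariantModel.
Context {R : realType} {d : measure_display} {Omega : measurableType d}.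
Context (P : probability Omega R) {p : nat}.
Context (g f : R -> R) (a theta v : 'cV[R]_p) (sigma : 'I_p -> R).
Context (X : nat -> {RV P >-> R}) (eps : nat -> 'I_p -> {RV P >-> R}).
Context (theta0 : 'cV[R]_p) (eta kap F G : R).
Hypotheses (hg : regular_density g) (hXdens : forall i, has_density (X i) g)
  (hXindep : mutually_independent X) (hf : admissible_shape f)
  (hepsindep : mutually_independent (fun ij : nat * 'I_p => eps ij.1 ij.2))
  (hXeps : independent_families X (fun ij : nat * 'I_p => eps ij.1 ij.2))
  (hepsmean : forall i j, ('E_P[eps i j] = 0)%E)
  (hepsvar : forall i j,
     ('E_P[fun w => (eps i j w ^+ 2)%R] = (sigma j ^+ 2)%:E)%E)
  (hepslaw : forall i j, same_law (eps i j) (eps 0%N j))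
  (htheta0 : forall j, `|theta0 j 0| <= 4^-1).
Hypotheses (eta_itv : 0 < eta < 4^-1) (htheta : forall j, `|theta j 0| <= 4^-1 - eta)
  (kap0 : 0 < kap)
  (hgain : forall j, 1 + 4 * kap <= 2 * (2 * pi * `|a j 0 * fourier1 f|))
  (fF : forall x, `|f x| <= F) (gG : forall x, `|(g x)^-1| <= G).

Local Notation Zon := (meas_on (observations X eps)).
Local Notation A := (score g f a theta v X eps sin).
Local Notation B := (score g f a theta v X eps cos).

Let iterate (n : nat) (w : Omega) : 'cV[R]_p :=
  robbins_monro g f a theta v (fun k => k%:R^-1) X (fun i j => eps i j) theta0 n w.

Let dev n j w : R := iterate n w j 0 - theta j 0.
(** Division by [pi] makes [x] agree with the deviation to first order. *)
Let x n j w : R := tan (pi * dev n j w) / pi.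
Let M n j w : R := 2 * pi * B n j w.
Let c j : R := 2 * pi * `|a j 0 * fourier1 f|.
Let V := \sum_j (`|a j 0| * F + `|v j 0|).
(** Large enough for [H] to dominate [2 * pi + 2] times either score, hence [A], [M] and the whole
    update; the summand 1 ensures [H >= 1]. *)
Let cH := 1 + (2 * pi + 2) * G * (V + 1).
Let H := envelope eps cH.
Let m := sin (pi * eta).

Let pi0 : 0 < pi :> R. Proof. exact: pi_gt0. Qed.
Let pi1 : 1 <= pi :> R. Proof. by have := @pi_ge2 R; lra. Qed.
Let F0 : 0 <= F. Proof. exact: le_trans (fF 0). Qed.
Let G0 : 0 <= G. Proof. exact: le_trans (gG 0). Qed.
Let Vj0 j : 0 <= `|a j 0| * F + `|v j 0|. Proof. by rewrite addr_ge0// mulr_ge0. Qed.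
Let V0 : 0 <= V. Proof. by apply: sumr_ge0. Qed.
Let L0 : 0 <= (2 * pi + 2) * G. Proof. by rewrite mulr_ge0// addr_ge0// mulr_ge0// ltW. Qed.
Let cH1 : 1 <= cH. Proof. by rewrite /cH lerDl mulr_ge0// addr_ge0. Qed.
Let H1 n w : 1 <= H n w. Proof. exact: le_trans (envelope_ge _ cH1 _ _). Qed.
Let H0 n w : 0 <= H n w. Proof. exact: le_trans (H1 n w). Qed.

Let iterateS n j w : iterate n.+1 w j 0 =
  piK (theta j 0 + dev n j w + harmonic n *
    (cos (2 * (pi * dev n j w)) * A n j w - sin (2 * (pi * dev n j w)) * B n j w)).
Proof.
rewrite /iterate /= mxE -/(iterate n w) mxE; congr piK.
rewrite /dev [theta j 0 + _]addrC subrK; congr (_ + _); rewrite -mulrA; congr (_ * _).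
have -> : 2 * pi * (X n w - iterate n w j 0) =
    2 * pi * (X n w - theta j 0) - 2 * (pi * (iterate n w j 0 - theta j 0)) by ring.
by rewrite sinB /score; ring.
Qed.

Let iterate_bound n j w : `|iterate n w j 0| <= 4^-1.
Proof. by case: n => [|n]; [exact: htheta0|rewrite iterateS piK_bound]. Qed.

Let devE n j w : theta j 0 + dev n j w = iterate n w j 0.
Proof. by rewrite /dev addrC subrK. Qed.

Let dev_bound n j w : `|dev n j w| <= 2^-1 - eta.
Proof.
apply: (le_trans (ler_normB _ _)); have := iterate_bound n j w; have := htheta j; lra.
Qed.

Let m0 : 0 < m.
Proof. by apply: sin_pi_gt0; have := eta_itv; lra. Qed.

Let cos_dev n j w : m <= cos (pi * dev n j w).
Proof. by apply: cos_pi_ge => //; have /andP[] := eta_itv. Qed.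

Let x_bound n j w : `|x n j w| <= m^-1.
Proof.
rewrite normrM normfV (gtr0_norm pi0) ler_pdivrMr//.
apply: (le_trans (tan_bound m0 (cos_dev n j w))).
by rewrite ler_peMr// invr_ge0 ltW.
Qed.

Let score_H (q : R -> R) n j w : (forall y, `|q y| <= 1) ->
  (2 * pi + 2) * `|score g f a theta v X eps q n j w| <= H n w.
Proof.
move=> q1; have p2 : 0 <= 2 * pi + 2 :> R by rewrite addr_ge0// mulr_ge0// ltW.
apply: (le_trans (ler_wpM2l p2 (score_le _ _ _ _ _ fF gG q1 n j w))).
rewrite mulrA mulrDr; apply: envelope_ge_affine => //; first by rewrite mulr_ge0.
have jV : `|a j 0| * F + `|v j 0| <= V.
  by rewrite /V (bigD1 j)//= lerDl sumr_ge0.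
have := ler_wpM2l L0 jV; rewrite /cH mulrDr; lra.
Qed.

Let A_H n j w : `|A n j w| <= H n w.
Proof.
have := score_H n j w (@sin_max R); have := normr_ge0 (A n j w).
by have := mulr_ge0 (ltW pi0) (normr_ge0 (A n j w)); lra.
Qed.

Let M_H n j w : `|M n j w| <= H n w.
Proof.
have p2 : 0 < 2 * pi :> R by rewrite mulr_gt0.
have := score_H n j w (@cos_max R); have := normr_ge0 (B n j w).
have -> : `|M n j w| = 2 * pi * `|B n j w| by rewrite /M normrM (gtr0_norm p2).
lra.
Qed.

Let U_H n j w :
  `|cos (2 * (pi * dev n j w)) * A n j w - sin (2 * (pi * dev n j w)) * B n j w| <= H n w.
Proof.
have h1 : `|cos (2 * (pi * dev n j w)) * A n j w| <= `|A n j w| by rewrite normrM ler_piMl// cos_max.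
have h2 : `|sin (2 * (pi * dev n j w)) * B n j w| <= `|B n j w| by rewrite normrM ler_piMl// sin_max.
apply: (le_trans (ler_normB _ _)); apply: (le_trans (lerD h1 h2)).
have := score_H n j w (@cos_max R); have := score_H n j w (@sin_max R).
have := mulr_ge0 (ltW pi0) (normr_ge0 (A n j w)); have := mulr_ge0 (ltW pi0) (normr_ge0 (B n j w)).
lra.
Qed.

(* The half-angle substitution [t = tan (pi D)] turns the periodic drift into a
   polynomial: [(1 + t^2) cos (2 pi D) = 1 - t^2] and [(1 + t^2) sin (2 pi D) = 2 t]. *)
Let half_angle n j w (t := tan (pi * dev n j w)) (al be : R) :
  (1 + t ^+ 2) * (cos (2 * (pi * dev n j w)) * al - sin (2 * (pi * dev n j w)) * be) =
  (1 - t ^+ 2) * al - 2 * t * be.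
Proof.
have c0 : cos (pi * dev n j w) != 0 by rewrite gt_eqF// (lt_le_trans m0).
rewrite /t /tan; move: (pi * dev n j w) c0 => y c0.
have sc := cos2Dsin2 y; rewrite (_ : 2 * y = y + y); last by ring.
rewrite cosD sinD; move: (cos y) (sin y) c0 sc => C S c0 sc.
have e : 1 + (S / C) ^+ 2 = (C ^+ 2)^-1.
  by rewrite expr_div_n -[X in X + _](@divff _ (C ^+ 2)) ?expf_neq0// -mulrDl sc mul1r.
by rewrite e; field.
Qed.

(** [tan_step] in the variable [x = t / pi]: by [half_angle] the drift [pi (1 + t^2) U] is [pi]
    times the polynomial one, and the powers of [pi >= 1] fit into the constant [C * pi]. *)
Let tan_recursion : exists2 C : R, 0 <= C & forall n j w,
  x n.+1 j w ^+ 2 <= x n j w ^+ 2 + 2 * x n j w *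
    (harmonic n * ((1 - pi ^+ 2 * x n j w ^+ 2) * A n j w - M n j w * x n j w)) +
    C * (harmonic n ^+ 2 * H n w ^+ 2) /\
  `|x n.+1 j w - x n j w -
    harmonic n * ((1 - pi ^+ 2 * x n j w ^+ 2) * A n j w - M n j w * x n j w)| <=
  C * (harmonic n ^+ 2 * H n w ^+ 2 + harmonic n * (H n w * x n j w ^+ 2)).
Proof.
have [C C0 HC] := tan_step eta_itv.
exists (C * pi); first by rewrite mulr_ge0// ltW.
move=> n j w; have g0 := @harmonic_ge0 R n.
set U := cos (2 * (pi * dev n j w)) * A n j w - sin (2 * (pi * dev n j w)) * B n j w.
set t := tan (pi * dev n j w).
have tx : t = pi * x n j w by rewrite /x mulrCA divff ?mulr1// gt_eqF.
have [] := HC (theta j 0) (dev n j w) (harmonic n * U) (htheta j) _.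
  by rewrite devE.
rewrite -/t -iterateS -/(dev n.+1 j w).
have -> : tan (pi * dev n.+1 j w) = pi * x n.+1 j w by rewrite /x mulrCA divff ?mulr1// gt_eqF.
have e : pi * (1 + t ^+ 2) * (harmonic n * U) =
    pi * (harmonic n * ((1 - pi ^+ 2 * x n j w ^+ 2) * A n j w - M n j w * x n j w)).
  have := half_angle n j w (A n j w) (B n j w); rewrite -/t -/U => h.
  rewrite -mulrA; congr (_ * _); rewrite mulrCA h tx /M; ring.
rewrite e tx; have UH := U_H n j w; rewrite -/U in UH.
move: (harmonic n * (_ - _)) => drift.
have q1 : (harmonic n * U) ^+ 2 <= harmonic n ^+ 2 * H n w ^+ 2.
  rewrite exprMn ler_wpM2l ?sqr_ge0// -(real_normK (num_real U)) lerXn2r ?nnegrE//.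
have q2 : `|harmonic n * U| <= harmonic n * H n w by rewrite normrM ger0_norm// ler_wpM2l.
move=> h1 h2; split.
  have p2 : 0 < pi ^+ 2 :> R by rewrite exprn_gt0.
  rewrite -(ler_pM2l p2) [leLHS](_ : _ = (pi * x n.+1 j w) ^+ 2); last exact: esym (exprMn _ _ _).
  apply: (le_trans h1).
  have h3 : C * (harmonic n * U) ^+ 2 <= pi ^+ 2 * (C * pi * (harmonic n ^+ 2 * H n w ^+ 2)).
    apply: (@le_trans _ _ (C * (harmonic n ^+ 2 * H n w ^+ 2))); first by rewrite ler_pM2l.
    rewrite [leRHS](_ : _ = (C * (harmonic n ^+ 2 * H n w ^+ 2)) * pi ^+ 3); last by ring.
    apply: ler_peMr; last exact: exprn_ege1.
    by apply: mulr_ge0; [exact: ltW|apply: mulr_ge0; exact: sqr_ge0].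
  apply: (le_trans (lerD (lexx _) h3)); rewrite le_eqVlt; apply/orP; left; apply/eqP; ring.
rewrite -(ler_pM2l pi0) [leLHS](_ : _ = `|pi * x n.+1 j w - pi * x n j w - pi * drift|); last first.
  by rewrite -!mulrBr normrM (gtr0_norm pi0).
apply: (le_trans h2).
rewrite (_ : pi * (C * pi * _) = C * (pi ^+ 2 * (harmonic n ^+ 2 * H n w ^+ 2) +
    harmonic n * H n w * (pi * x n j w) ^+ 2)); last by ring.
rewrite ler_pM2l//; apply: lerD; last by rewrite ler_wpM2r ?sqr_ge0.
apply: (le_trans q1); apply: ler_peMl; last exact: exprn_ege1.
by apply: mulr_ge0; exact: sqr_ge0.
Qed.

Let iterate_meas n j : Zon (obs_before n) (fun w => iterate n w j 0).
Proof.
have mg := density_measurable hg; have mf : measurable_fun setT f by have [] := hf.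
elim: n j => [|n IH] j; first exact: measurable_cst.
have hX : Zon (obs_before n.+1) (X n).
  exact: (@meas_on_coord _ _ _ P _ (observations X eps) _ (inl n) (ltnSn n)).
have he : Zon (obs_before n.+1) (eps n j).
  exact: (@meas_on_coord _ _ _ P _ (observations X eps) _ (inr (n, j)) (ltnSn n)).
have hI : Zon (obs_before n.+1) (fun w => iterate n w j 0).
  by apply: (meas_on_sub _ (IH j)) => k /= kn; exact: ltnW.
have mpiK : measurable_fun setT (@piK R).
  have -> : @piK R = (fun y : R => Num.max (- 4^-1) (Num.min 4^-1 y)).
    apply/funext => y; rewrite /piK ler_norml; have [y1|y1] := leP (- 4^-1) y; have [y2|y2] := leP y 4^-1 => /=.
    - by rewrite max_r.
    - by rewrite ltW// max_r//; lra.
    - by rewrite max_l ?(ltW y1)//; case: ifP => //; lra.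
    - by lra.
  by apply: measurable_maxr; [exact: measurable_cst|apply: measurable_minr; [exact: measurable_cst|exact: measurable_id]].
rewrite /meas_on; under eq_fun do rewrite /iterate /= mxE -/(iterate _ _) mxE.
apply: measurableT_comp mpiK _; apply: measurable_funD => //.
apply: measurable_funM; first exact: measurable_cst.
apply: measurable_funM.
  apply: measurable_funM; first by mfun.
  by apply: (measurableT_comp (@measurable_inv R)); exact: (measurableT_comp mg).
apply: measurable_funD => //; apply: measurable_funD; last exact: measurable_cst.
apply: measurable_funM; first exact: measurable_cst.
by apply: (measurableT_comp mf); mfun.
Qed.

Arguments iterate_meas : clear implicits.

Let x_meas n j : Zon (obs_before n) (x n j).
Proof.
have hI := iterate_meas n j.
have hd : Zon (obs_before n) (fun w => pi * dev n j w) by rewrite /meas_on /dev; mfun.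
rewrite /meas_on /x /tan; apply: measurable_funM; last exact: measurable_cst.
apply: measurable_funM; first exact: (measurableT_comp (@measurable_sin R) hd).
apply: (measurableT_comp (@measurable_inv R)).
exact: (measurableT_comp (@measurable_cos R) hd).
Qed.

Let theta1 j : `|theta j 0| <= 1.
Proof. by have := htheta j; have := eta_itv; lra. Qed.

(** On [[0, 2]], which contains [pi * |dev|], the cubic bound gives [z <= 3 sin z]; and the sine is
    at most the tangent. *)
Let dev_le n j w : `|dev n j w| <= 3 * `|x n j w|.
Proof.
have pt : pi * `|x n j w| = `|tan (pi * dev n j w)|.
  by rewrite -[X in X * _](gtr0_norm pi0) -normrM /x mulrCA divff ?mulr1// gt_eqF.
have cp : 0 < cos (pi * dev n j w) by exact: lt_le_trans (cos_dev n j w).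
have st : `|sin (pi * dev n j w)| <= `|tan (pi * dev n j w)|.
  rewrite /tan normrM ler_peMr// ger0_norm ?invr_ge0 ?(ltW cp)//.
  by rewrite invf_ge1// cos_le1.
have sb : pi * `|dev n j w| <= 3 * `|sin (pi * dev n j w)|.
  have db := dev_bound n j w; have p2 := @pihalf_lt2 R; have e0 := eta_itv.
  have := normr_ge0 (dev n j w).
  have -> : `|sin (pi * dev n j w)| = `|sin (pi * `|dev n j w|)|.
    by case: (ger0P (dev n j w)) => // _; rewrite mulrN sinN normrN.
  move: `|dev n j w| db => y db y0.
  have yp : 0 <= pi * y by rewrite mulr_ge0// ltW.
  have y2 : pi * y <= 2.
    have : pi * y <= pi * 2^-1 by rewrite ler_pM2l//; lra.
    lra.
  apply: (@le_trans _ _ (3 * sin (pi * y))); last by rewrite ler_pM2l// ler_norm.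
  have := sin_ge_cubic yp; move: (pi * y) yp y2 => z z0 z2; nra.
rewrite -(ler_pM2l pi0) mulrCA pt; apply: (le_trans sb).
by rewrite ler_pM2l.
Qed.

(** [tan_taylor1] at 0 gives the factor 3 and the square of [dev_le] the factor 9. *)
Let dev_x n j w : `|dev n j w - x n j w| <= 27 * pi / m ^+ 3 * x n j w ^+ 2.
Proof.
have m1 : m <= 1 by apply: le_trans (cos_dev n j w) (cos_le1 _).
have c01 : m <= cos (0 : R) by rewrite cos0.
have := tan_taylor1 m0 (cos_dev n j w) c01; rewrite tan0 !subr0 expr0n/= addr0 mul1r => h.
have -> : `|dev n j w - x n j w| = `|tan (pi * dev n j w) - pi * dev n j w| / pi.
  rewrite distrC -[X in _ = _ / X](gtr0_norm pi0) -normf_div; congr (`|_|).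
  by rewrite mulrBl /x [pi * _]mulrC mulfK// gt_eqF.
rewrite ler_pdivrMr//; apply: (le_trans h).
have m3 : 0 <= 3 / m ^+ 3 by rewrite divr_ge0// exprn_ge0// ltW.
have d2 : dev n j w ^+ 2 <= 9 * x n j w ^+ 2.
  rewrite -(real_normK (num_real (dev n j w))) -(real_normK (num_real (x n j w))).
  have := dev_le n j w; have := normr_ge0 (dev n j w); have := normr_ge0 (x n j w).
  by move: (`|x n j w|) (`|dev n j w|) => s t; nra.
rewrite [leRHS](_ : _ = 3 / m ^+ 3 * (pi ^+ 2 * (9 * x n j w ^+ 2))); last by ring.
by rewrite exprMn ler_wpM2l// ler_wpM2l// sqr_ge0.
Qed.

(** The limit is known for [sqrt n] times [x]. The deviation differs from [x] by [O(x^2)], so the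
    two cosines differ in mean by [O(n^(-1/2))]. *)
Lemma robbins_monro_clt : cvg_in_law_to_normal P
  (fun n w => Num.sqrt (n%:R : R) *:
    (robbins_monro g f a theta v (fun k => k%:R^-1) X (fun i j => eps i j) theta0 n w - theta))
  0 (Sigma f a (phi P g f a theta v (X 0%N) (fun j => eps 0%N j) theta)).
Proof.
set Phi := phi _ _ _ _ _ _ _ _ _.
have SigE : Sigma f a Phi = limit_cov c Phi.
  apply/matrixP => k l; rewrite !mxE; congr (_ / _).
  by rewrite /c !normrM; ring.
have EAA n j l : Ex P (fun w => A n j w * A n l w) = Phi j l.
  rewrite /Phi phi_score mxE.
  exact: (Ex_score_prod_stationary a theta v hg hXdens hXindep hf hepsindep hXeps hepsmean
    hepsvar fF gG (@measurable_sin R) (@sin_max R)).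
have EA n j : Ex P (A n j) = 0.
  exact: (Ex_score_sin _ _ hg hXdens hXindep hf theta1 hepsindep hXeps hepsmean hepsvar fF gG).
have mA n j : Zon (obs_at n) (A n j).
  exact: (@score_meas _ _ _ P _ g f a theta v X eps hg hf _ (@measurable_sin R) n j).
have mB n j : Zon (obs_at n) (B n j).
  exact: (@score_meas _ _ _ P _ g f a theta v X eps hg hf _ (@measurable_cos R) n j).
have iH n : L1 P (fun w => H n w ^+ 2) by exact: (L1_envelope_sqr hepsvar).
have HH n w : H n w <= H n w ^+ 2 by rewrite expr2 ler_peMr.
have iB n j : L1 P (B n j).
  apply: (L1_le (meas_on_measurable (mB n j)) _ (iH n)) => w; apply: le_trans (HH n w).
  have := score_H n j w (@cos_max R); have := normr_ge0 (B n j w).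
  by have := mulr_ge0 (ltW pi0) (normr_ge0 (B n j w)); lra.
have EM n j : Ex P (M n j) = c j.
  rewrite ExZ//; congr (_ * _).
  exact: (Ex_score_cos _ _ hg hXdens hXindep hf theta1 hepsindep hXeps hepsmean hepsvar fF gG).
have mM n j : Zon (obs_at n) (M n j) by apply: measurable_funM; [exact: measurable_cst|exact: mB].
have mH n : Zon (obs_at n) (H n).
  have me j : Zon (obs_at n) (eps n j).
    exact: (@meas_on_coord _ _ _ P _ (observations X eps) _ (inr (n, j)) erefl).
  apply: measurable_funM; first exact: measurable_cst.
  apply: (@measurableT_comp _ _ _ _ _ _ (@Num.sqrt R)); last by mfun; exact: me.
  by apply: continuous_measurable_fun; exact: sqrt_continuous.
have [C C0 HC] := tan_recursion.
have k0 : 0 <= pi ^+ 2 :> R by exact: sqr_ge0.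
have T0 : 0 <= m^-1 by rewrite invr_ge0 ltW.
have EH n : Ex P (fun w => H n w ^+ 2) <= cH ^+ 2 * (1 + \sum_j sigma j ^+ 2).
  by rewrite (Ex_envelope_sqr hepsvar).
have Zi := observations_indep hXindep hepsindep hXeps.
have lind := envelope_lindeberg hepsvar hepslaw cH1.
have cC j : c j <= \sum_i c i.
  by rewrite (bigD1 j)//= lerDl sumr_ge0// => i _; rewrite mulr_ge0// mulr_ge0// ltW.
have C1 : 0 <= \sum_i c i by apply: sumr_ge0 => i _; rewrite mulr_ge0// mulr_ge0// ltW.
have S0 : forall u, 0 <= bilin (limit_cov c Phi) u u.
  exact: (limit_cov_ge0 mA A_H iH EAA kap0 hgain).
have psdS : psd (limit_cov c Phi).
  split=> //; apply/matrixP => k l; rewrite [LHS]mxE [LHS]mxE [RHS]mxE; congr (_ / _); last by ring.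
  by rewrite -!(EAA 0%N); congr Ex; apply/funext => w; exact: mulrC.
have [mu Hmu] := normal_vector_exists psdS.
exists mu; rewrite SigE; split; first exact: centered_normal_law.
have [_ imu cosmu] := Hmu.
have [M0 M00 HM0] := iterate_sqr_rate Zi obs_before_at x_meas mA mM T0 x_bound H1 A_H M_H iH EH EA EM
  kap0 hgain C0 k0 (fun n j w => (HC n j w).1).
have ccvg := char_cvg Zi obs_before_at x_meas mA mM mH T0 x_bound H1 A_H M_H iH EH lind EA EM EAA
  kap0 hgain cC C1 C0 k0 (fun n j w => (HC n j w).1) (fun n j w => (HC n j w).2).
have Mx n j : measurable_fun setT (x n j) by exact: meas_on_measurable (@x_meas n j).
have Mdev n j : measurable_fun setT (dev n j).
  by apply: measurable_funB; [exact: meas_on_measurable (iterate_meas n j)|exact: measurable_cst].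
have ZE n j w : (Num.sqrt (n%:R : R) *: (iterate n w - theta)) j 0 = Num.sqrt n%:R * dev n j w.
  by rewrite !mxE.
pose EQ n := \sum_j Ex P (fun w => x n j w ^+ 2).
have Lx2 n j : L1 P (fun w => x n j w ^+ 2).
  apply: (@L1_bounded _ _ _ _ _ (m^-1 ^+ 2)) => [|w]; first by mfun.
  by rewrite normrX lerXn2r ?nnegrE.
have EQ0 n : 0 <= EQ n by apply: sumr_ge0 => j _; apply: Ex_ge0 => w; exact: sqr_ge0.
have EQj n j : Ex P (fun w => x n j w ^+ 2) <= EQ n.
  rewrite /EQ (bigD1 j)//= lerDl sumr_ge0// => i _; apply: Ex_ge0 => w; exact: sqr_ge0.
have iZ n j : L1 P (fun w => Num.sqrt n%:R * dev n j w).
  by apply: L1Z; apply: (@L1_bounded _ _ _ _ _ (2^-1 - eta)).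
have tight n j : Ex P (fun w => `|Num.sqrt n%:R * dev n j w|) <= 3 * (1 + M0).
  apply: (@le_trans _ _ (Ex P (fun w => 3 + 3 * n%:R * x n j w ^+ 2))).
    apply: Ex_le => [||w]; [exact: L1_norm|by apply: L1D; [exact: L1_cst|exact: L1Z]|].
    rewrite normrM ger0_norm ?sqrtr_ge0//.
    have nr : n%:R = Num.sqrt n%:R ^+ 2 :> R by rewrite sqr_sqrtr.
    rewrite [X in 3 * X]nr -(real_normK (num_real (x n j w))).
    have h1 := ler_wpM2l (sqrtr_ge0 (n%:R : R)) (dev_le n j w).
    apply: (le_trans h1); have := sqr_ge0 (Num.sqrt n%:R * `|x n j w| - 1).
    by move: (Num.sqrt _) (`|x n j w|) => r y; nra.
  rewrite ExD; [|exact: L1_cst|exact: L1Z].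
  rewrite Ex_cst ExZ// -mulrA mulrDr mulr1 lerD2l ler_pM2l//.
  by apply: le_trans (HM0 n); rewrite ler_wpM2l.
(* One constant bounds the first moments of the sequence and of its limit. *)
pose Cmu := 3 * (1 + M0) + \sum_j Ex mu (fun y : 'cV[R]_p => `|y j 0|).
have Emu0 j : 0 <= Ex mu (fun y : 'cV[R]_p => `|y j 0|) by apply: Ex_ge0.
apply: (@cvg_in_law_of_cos _ _ _ _ _ _ _ Cmu).
- move=> n j; rewrite (_ : (fun w => _) = (fun w => Num.sqrt n%:R * dev n j w)); first by mfun.
  by apply/funext => w; exact: ZE.
- move=> n j; rewrite (_ : (fun w => _) = (fun w => Num.sqrt n%:R * dev n j w)); first exact: iZ.
  by apply/funext => w; exact: ZE.
- move=> n j; rewrite (_ : (fun w => _) = (fun w => `|Num.sqrt n%:R * dev n j w|)); last first.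
    by apply/funext => w; congr (`|_|); exact: ZE.
  by apply: (le_trans (tight n j)); rewrite lerDl sumr_ge0.
- exact: imu.
- move=> j; apply: (@le_trans _ _ (\sum_j Ex mu (fun y : 'cV[R]_p => `|y j 0|))).
    by rewrite (bigD1 j)//= lerDl sumr_ge0.
  by rewrite lerDr mulr_ge0// addr_ge0.
move=> u b; rewrite cosmu.
have icos n : L1 P (fun w => cos (\sum_j u j 0 * (Num.sqrt n%:R * dev n j w) + b)).
  by apply: (@L1_bounded _ _ _ _ _ 1) => [|w]; [mfun|exact: cos_max].
have icos' n : L1 P (fun w => cos (\sum_j u j 0 * (Num.sqrt n%:R * x n j w) + b)).
  by apply: (@L1_bounded _ _ _ _ _ 1) => [|w]; [mfun|exact: cos_max].
have -> : (fun n => Ex P (fun w => cos (dotc u (Num.sqrt (n%:R : R) *: (iterate n w - theta)) + b))) =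
    (fun n => Ex P (fun w => cos (\sum_j u j 0 * (Num.sqrt n%:R * x n j w) + b)) +
      Ex P (fun w => cos (\sum_j u j 0 * (Num.sqrt n%:R * dev n j w) + b) -
                     cos (\sum_j u j 0 * (Num.sqrt n%:R * x n j w) + b))).
  apply/funext => n; rewrite ExB// addrC subrK; congr Ex; apply/funext => w.
  by rewrite /dotc; congr (cos (_ + _)); apply: eq_bigr => j _; rewrite ZE.
rewrite -[X in _ --> X]addr0; apply: cvgD; first exact: ccvg.
have Cd0 : 0 <= 27 * pi / m ^+ 3 by rewrite divr_ge0 ?exprn_ge0 ?mulr_ge0// ltW.
pose K := norm1 u * (27 * pi / m ^+ 3) * M0.
have small n : (0 < n)%N -> `|Ex P (fun w => cos (\sum_j u j 0 * (Num.sqrt n%:R * dev n j w) + b) -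
    cos (\sum_j u j 0 * (Num.sqrt n%:R * x n j w) + b))| <= (Num.sqrt n%:R)^-1 * K.
  move=> n0; have r0 : 0 < Num.sqrt n%:R :> R by rewrite sqrtr_gt0 ltr0n.
  have iQ : L1 P (fun w => \sum_j x n j w ^+ 2) by exact: L1_sum.
  apply: (@le_trans _ _ (Ex P (fun w => norm1 u * (Num.sqrt n%:R * (27 * pi / m ^+ 3)) * \sum_j x n j w ^+ 2))).
    apply: norm_Ex_le_dom => [||w]; [by mfun|exact: L1Z|].
    apply: (le_trans (cos_lipschitz _ _)); rewrite opprD addrACA subrr addr0 -sumrB -mulrA.
    have -> : \sum_j (u j 0 * (Num.sqrt n%:R * dev n j w) - u j 0 * (Num.sqrt n%:R * x n j w)) =
        \sum_j u j 0 * (Num.sqrt n%:R * (dev n j w - x n j w)).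
      by apply: eq_bigr => j _; ring.
    apply: norm_dotc_le => j; rewrite normrM ger0_norm ?(ltW r0)//.
    rewrite [leRHS](_ : _ = Num.sqrt n%:R * (27 * pi / m ^+ 3 * \sum_i x n i w ^+ 2)); last exact: esym (mulrA _ _ _).
    rewrite ler_pM2l//.
    apply: (le_trans (dev_x n j w)); rewrite ler_wpM2l// (bigD1 j)//= lerDl.
    by apply: sumr_ge0 => i _; exact: sqr_ge0.
  rewrite ExZ// Ex_sum// -/(EQ n).
  have h : Num.sqrt n%:R ^+ 2 * EQ n <= M0 by rewrite sqr_sqrtr//; exact: HM0.
  rewrite /K ler_pdivlMl// [leLHS](_ : _ = norm1 u * (27 * pi / m ^+ 3) * (Num.sqrt n%:R ^+ 2 * EQ n)); last by ring.
  by rewrite ler_wpM2l// mulr_ge0// norm1_ge0.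
(* The bound [small] requires a positive index. *)
rewrite -cvg_shiftS.
apply: (@squeeze_cvgr _ _ _ _ (fun n => - (Num.sqrt (@harmonic R n) * K)) (fun n => Num.sqrt (@harmonic R n) * K)).
- apply: nearW => n; rewrite -ler_norml; apply: (le_trans (small n.+1 isT)).
  by rewrite /harmonic/= sqrtrV.
- rewrite -oppr0; apply: cvgN; rewrite -[X in _ --> X](mul0r K); apply: cvgM; last exact: cvg_cst.
  rewrite -(@sqrtr0 R); apply: (cvg_comp _ _ (@cvg_harmonic R)); exact: sqrt_continuous.
- rewrite -[X in _ --> X](mul0r K); apply: cvgM; last exact: cvg_cst.
  rewrite -(@sqrtr0 R); apply: (cvg_comp _ _ (@cvg_harmonic R)); exact: sqrt_continuous.
Qed.

End ShapeInvariantModel.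

Theorem theorem4p2 (R : realType) (d : measure_display)
    (Omega : measurableType d) (P : probability Omega R)
    (p : nat) (hp : (2 <= p)%N)
    (g f : R -> R) (a theta v : 'cV[R]_p) (sigma : 'I_p -> R)
    (X : nat -> {RV P >-> R}) (eps : nat -> 'I_p -> {RV P >-> R})
    (theta0 : 'cV[R]_p)
    (hg : regular_density g)
    (hXdens : forall i, has_density (X i) g)
    (hXindep : mutually_independent X)
    (hf : admissible_shape f)
    (hf1 : fourier1 f != 0)
    (ha : forall j, a j 0 != 0)
    (ha1 : forall j : 'I_p, j = 0%N :> nat -> a j 0 = 1)
    (htheta1 : forall j : 'I_p, j = 0%N :> nat -> theta j 0 = 0)
    (htheta : \big[Num.max/0]_(j < p) `|theta j 0| < 4^-1)
    (hepsindep : mutually_independent (fun ij : nat * 'I_p => eps ij.1 ij.2))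
    (hXeps : independent_families X (fun ij : nat * 'I_p => eps ij.1 ij.2))
    (hepsmean : forall i j, ('E_P[eps i j] = 0)%E)
    (hepsvar : forall i j,
        ('E_P[fun w => (eps i j w ^+ 2)%R] = (sigma j ^+ 2)%:E)%E)
    (hepslaw : forall i j, same_law (eps i j) (eps 0%N j))
    (hepsmom : exists2 q : R, 2 < q &
        forall j, ('E_P[fun w => (`|eps 0%N j w| `^ q)%R] < +oo)%E)
    (htheta0 : forall j, `|theta0 j 0| <= 4^-1)
    (hgain : 1 < 4 * pi * `|fourier1 f| *
        inf (range (fun j : 'I_p => `|a j 0|))) :
  cvg_in_law_to_normal P
    (fun n w => Num.sqrt (n%:R : R) *:
      (robbins_monro g f a theta v (fun k => k%:R^-1) X
         (fun i j => eps i j) theta0 n w - theta))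
    0
    (Sigma f a (phi P g f a theta v (X 0%N) (fun j => eps 0%N j) theta)).
Proof.
have [_ _ [F0 F0f] _ _] := hf.
have fF x : `|f x| <= F0 by exact: F0f.
have [G _ gG] := density_inv_bounded hg.
set mx := \big[Num.max/0]_(j < p) `|theta j 0| in htheta.
have thmax j : `|theta j 0| <= mx by exact: le_bigmax.
have mx0 : 0 <= mx by exact: bigmax_ge_id.
(* Half of the gap left by the strict bound on [theta], so that the margin is positive and below
   [4^-1]. *)
pose eta : R := (4^-1 - mx) / 2.
have eta_itv : 0 < eta < 4^-1 by rewrite /eta; lra.
have theta_eta j : `|theta j 0| <= 4^-1 - eta by have := thmax j; rewrite /eta; lra.
set A := inf _ in hgain.
have infA j : A <= `|a j 0|.
  apply: ge_inf; last by exists j.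
  by exists 0 => _ [i _ <-].
(* A quarter of the excess in the gain condition, so that [1 + 4 * kap] is exactly its right-hand
   side. *)
pose kap := (4 * pi * `|fourier1 f| * A - 1) / 4.
have kap0 : 0 < kap by rewrite divr_gt0// subr_gt0.
have gain j : 1 + 4 * kap <= 2 * (2 * pi * `|a j 0 * fourier1 f|).
  have c0 : 0 <= 4 * pi * `|fourier1 f| by rewrite !mulr_ge0// pi_ge0.
  have := ler_wpM2l c0 (infA j); rewrite normrM /kap; lra.
exact: (robbins_monro_clt v hg hXdens hXindep hf hepsindep hXeps hepsmean hepsvar hepslaw
  htheta0 eta_itv theta_eta kap0 gain fF gG).
Qed.
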